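(* Let $d\ge0$ and $N\ge1$ be integers. Fix a point $(x_0,z_0)\in\mathbb{C}^d\times\mathbb{C}^N$, a domain $X\subset\mathbb{C}^d$ containing $x_0$, and a direction $\theta$. Let $$\hat F=\hat F(x,\hbar,z)=\sum_{k=0}^\infty F_k(x,z)\hbar^k$$ be a formal power series in $\hbar$ whose coefficients $F_k$ are holomorphic maps $X\times\mathbb{C}^N\to\mathbb{C}^N$ such that $F_0(x_0,z_0)=0$ and the Jacobian $\partial F_0/\partial z$ is invertible at $(x_0,z_0)$. Suppose $\hat F$ is Borel-summable in the direction $\theta$ uniformly for all $x\in X$ and locally uniformly for all $z\in\mathbb{C}^N$. Then there is a subdomain $X_0\subset X$ containing $x_0$ such that the unique formal series $$\hat f=\hat f(x,\hbar)=\sum_{n=0}^\infty f_n(x)\hbar^n$$ with holomorphic coefficients $f_n:X_0\to\mathbb{C}^N$ which satisfies $f_0(x_0)=z_0$ and $\hat F(x,\hbar,\hat f(x,\hbar))=0$ is Borel-summable in the direction $\theta$ uniformly for all $x\in X_0$.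
   Context: The equation $\hat F(x,\hbar,\hat f(x,\hbar))=0$ is an identity of formal power series in $\hbar$ (substitute $z=\hat f$ and Taylor-expand each $F_k(x,\cdot)$ at $z=f_0(x)$). Borel summability: for a power series $\hat f(\hbar)=\sum_k f_k\hbar^k$ (with scalar or vector coefficients), the formal Borel transform is $\hat\phi(\xi)=\sum_{k\ge0}\frac{1}{k!}f_{k+1}\xi^k$. A Gevrey power series $\hat f$ (i.e. $|f_n|\le CM^nn!$ for all $n\geq 0$ and some $C,M>0$) is Borel summable in the direction $\theta$ if its convergent Borel transform $\hat\phi$ admits an analytic continuation $\phi$ to a tubular neighbourhood $\Xi_\theta=\{\xi\in\mathbb{C}:\operatorname{dist}(\xi,e^{i\theta}\mathbb{R}_+)<\epsilon\}$ of the ray $e^{i\theta}\mathbb{R}_+$, for some $\epsilon>0$, with at-most-exponential growth: there are $K,L>0$ with $|\phi(\xi)|\le Ke^{L|\xi|}$ for all $\xi\in\Xi_\theta$. When the coefficients depend holomorphically on parameters, Borel summability is uniform in a parameter if the constants $C,M,\epsilon,K,L$ can be chosen independent of that parameter (and $\phi$ is holomorphic jointly in the parameters and $\xi$); it is locally uniform in $z$ if this holds on some neighbourhood of each $z$. *)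

(* Defs.v *)
From HB Require Import structures.
From mathcomp Require Import all_boot all_order all_algebra.
From mathcomp Require Import complex.
From mathcomp Require Import all_classical all_reals all_analysis.

Set Implicit Arguments.
Unset Strict Implicit.
Unset Printing Implicit Defensive.

Import Order.TTheory GRing.Theory Num.Theory.
Import numFieldNormedType.Exports.

Local Open Scope classical_set_scope.
Local Open Scope ring_scope.
Local Open Scope complex_scope.

(* The library gives K its normed topology only for an abstract numeric field
   K (numFieldNormedType); this transports it to the concrete field R[i]. *)
#[non_forgetful_inheritance]
HB.instance Definition _ (R : realType) := GRing.ComAlgebra.copy R[i] R[i]^o.
#[non_forgetful_inheritance]
HB.instance Definition _ (R : realType) := Vector.copy R[i] R[i]^o.
#[non_forgetful_inheritance]
HB.instance Definition _ (R : realType) := NormedModule.copy R[i] R[i]^o.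

(* The complex numbers are R[i] with R : realType, and C^n is 'rV[R[i]]_n with
   the sup norm.
   A norm `|x| is a (real) element of R[i]; since the order of R[i] compares
   only numbers with equal imaginary parts, `|x| <= r%:C is the usual bound. *)

Definition domain (T : topologicalType) (A : set T) : Prop :=
  [/\ open A, connected A & A !=set0].

(* Differentiability is over the scalar field R[i], i.e. C-linear. *)
Definition holomorphic (R : realType) (V W : normedModType R[i])
    (D : set V) (f : V -> W) : Prop :=
  forall p, D p -> differentiable f p.

(* dist (xi, e^(i theta) R_+) < eps *)
Definition tube (R : realType) (theta eps : R) : set R[i] :=
  [set xi | exists2 t : R, 0 <= t &
     `|xi - t%:C * (cos theta +i* sin theta)| < eps%:C].

(* A formal power series sum_k f_k h^k is the sequence of its coefficients. *)
Definition Borel_transform (R : realType) (W : normedModType R[i])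
    (f : nat -> W) : nat -> W :=
  fun k => (k`!%:R : R[i])^-1 *: f k.+1.

(* Borel summability in the direction theta, uniform over p in P, of the
   series sum_k (f k p) h^k whose coefficients depend on the parameter p:
   the constants do not depend on p, and phi is jointly holomorphic in the
   parameter and xi. *)
Definition Borel_summable_uniformly (R : realType) (V W : normedModType R[i])
    (theta : R) (P : set V) (f : nat -> V -> W) : Prop :=
  exists C M eps K L : R,
  [/\ [/\ 0 < C, 0 < M, 0 < eps, 0 < K & 0 < L],
      forall n p, P p -> `|f n p| <= (C * M ^+ n * n`!%:R)%:C &
      exists phi : V * R[i] -> W,
      [/\ holomorphic (P `*` tube theta eps) phi,
          forall p, P p -> \forall xi \near (0 : R[i]),
            series (fun k => xi ^+ k *: Borel_transform (f ^~ p) k) @ \oo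
              --> phi (p, xi) &
          forall p xi, P p -> tube theta eps xi ->
            `|phi (p, xi)| <= (K * expR (L * complex.Re `|xi|))%:C]].

(* The iterated partial derivative d^alpha g, for a multi-index alpha. *)
Definition partial (R : realType) (N : nat) (W : normedModType R[i])
    (alpha : 'I_N -> nat) (g : 'rV[R[i]]_N -> W) : 'rV[R[i]]_N -> W :=
  foldr (fun j => iter (alpha j) (fun h => 'D_(delta_mx 0 j) h)) g (enum 'I_N).

(* The coefficient of h^m in sum_k G_k(a(h)) h^k, where each G_k is replaced by
   its Taylor series at a_0:
     G_k(a(h)) = sum_alpha (d^alpha G_k(a_0) / alpha!) (a(h) - a_0)^alpha.
   The polynomial w j is the j-th component of a(h) - a_0 modulo h^(m+1). It
   has no constant term, so only alpha with |alpha| <= m - k contribute and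
   the bound alpha j <= m omits no nonzero term. *)
Definition subst_coef (R : realType) (N : nat) (W : normedModType R[i])
    (G : nat -> 'rV[R[i]]_N -> W) (a : nat -> 'rV[R[i]]_N) (m : nat) : W :=
  let w j := \poly_(n < m.+1) (if n == 0%N then 0 else a n 0 j) in
  \sum_(k < m.+1) \sum_(alpha : {ffun 'I_N -> 'I_m.+1})
    (\prod_j w j ^+ alpha j)`_(m - k)%N *:
      ((\prod_j (alpha j)`!)%N%:R^-1 *:
         partial (fun j => alpha j) (G k) (a 0%N)).

(* f = sum_n f_n h^n has coefficients holomorphic on X0, f_0(x0) = z0, and
   F(x, h, f(x, h)) = 0 as a formal power series in h for every x in X0. *)
Definition formal_solution (R : realType) (d N : nat)
    (x0 : 'rV[R[i]]_d) (z0 : 'rV[R[i]]_N)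
    (F : nat -> 'rV[R[i]]_d * 'rV[R[i]]_N -> 'rV[R[i]]_N)
    (X0 : set 'rV[R[i]]_d) (f : nat -> 'rV[R[i]]_d -> 'rV[R[i]]_N) : Prop :=
  [/\ forall n, holomorphic X0 (f n),
      f 0%N x0 = z0 &
      forall x, X0 x -> forall m,
        subst_coef (fun k z => F k (x, z)) (f ^~ x) m = 0].

(* Main.v *)
Require Import Defs.
From HB Require Import structures.
From mathcomp Require Import all_boot all_order all_algebra.
From mathcomp Require Import complex.
From mathcomp Require Import all_classical all_reals all_analysis.
From mathcomp Require Import ring lra.
Import Order.TTheory GRing.Theory Num.Theory.
Import numFieldNormedType.Exports.
Set Implicit Arguments.
Unset Strict Implicit.
Unset Printing Implicit Defensive.
Local Open Scope classical_set_scope.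
Local Open Scope ring_scope.
Local Open Scope complex_scope.

(* Let J = dF_0/dz (x, f_0 x), where f_0 is the implicit function.  The equation
   for the remaining coefficients reads
     u = - sum_alpha A_alpha u^alpha,   u = f - f_0,
   with A_alpha = sum_k hbar^k (d^alpha F_k (x, f_0 x) / alpha!) J^-1, the terms
   of order hbar^0 being dropped when |alpha| <= 1.  The Borel transform turns
   products into convolutions, A_alpha into a_alpha delta + b_alpha, and this
   into a fixed point equation phi = Phi(phi) for functions on the tube.  The
   tube is star-shaped about 0, so the convolution is an integral over the
   segment [0, xi], and the weight
     w(r) = (lam/4) e^((L + lam) r) / (1 + lam r)^2
   satisfies w * w <= w, while K e^(L r) <= (16 K / lam) w(r).  Hence the Picard
   iterates of Phi and their successive differences are majorized by w times
   those of a scalar monotone iteration, which is bounded as soon as lam is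
   large.  The limit is holomorphic and grows at most exponentially; its Taylor
   coefficients at xi = 0 are the f_(n+1) / n!, because the jets of the iterates
   follow the same iteration in the ring of formal power series, where it
   stabilizes one more coefficient at each step.

   Holomorphy is complex differentiability at every point, with no continuity
   of the derivative assumed: Cauchy's estimates come from Goursat's theorem on
   rectangles, applied along complex lines. *)

(** * Real-valued norms and limits *)

(** Two different mechanisms keep the iteration bounded. A function part b_alpha is small because
    its growth e^(L r) is measured against the weight, which gains a factor 1 / lam. A unit part
    a_alpha is not made small by any choice of lam, but it occurs only with |alpha| >= 2, where it
    multiplies at least two small factors u. Hence the size S of the solution is fixed first,
    against the unit parts, and lam afterwards, depending on S. The terms dropped at order hbar^0
    are exactly those that disappear: alpha = 0 gives F_0 (x, f_0 x) = 0, and the unit multi-indices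
    give u itself after multiplication by J^-1. Phi is never shown to be a contraction. Its scalar
    majorant has nonnegative coefficients, so its iterates from 0 increase, and their increments
    bound those of the functions. Uniqueness on all of X_0, where only f_0 (x_0) = z_0 is
    prescribed, is a separate matter: the implicit function is unique in a ball of radius rho but
    takes values in the ball of radius rho / 2, and a continuous f_0 on a connected X_0 cannot cross
    the gap. *)

Section RealNorm.
Context {R : realType}.
Notation K := R[i].

(** [R[i]] is only partially ordered. Norms have zero imaginary part ([nmE]), so their real parts
    carry all estimates to the total order of [R]. *)
Definition nm (V : normedModType K) (x : V) : R := complex.Re `|x|.

Section One.
Variable V : normedModType K.
Implicit Types (x y : V) (a b : K).

Lemma nmE x : `|x| = (nm x)%:C.
Proof. have := normr_ge0 x; rewrite /nm; case: `|x| => u v; rewrite lecE /= => /andP[/eqP -> _] //. Qed.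

Lemma nm_ge0 x : 0 <= nm x.
Proof. by have := normr_ge0 x; rewrite nmE lecR. Qed.

Lemma nmD x y : nm (x + y) <= nm x + nm y.
Proof. by have := ler_normD x y; rewrite !nmE -rmorphD lecR. Qed.

Lemma nmN x : nm (- x) = nm x.
Proof. by rewrite /nm normrN. Qed.

Lemma nmB x y : nm (x - y) = nm (y - x).
Proof. by rewrite -nmN opprB. Qed.

Lemma nm_triB x y : nm (x - y) <= nm x + nm y.
Proof. by rewrite -(nmN y) nmD. Qed.

Lemma nm_tri y x z : nm (x - z) <= nm (x - y) + nm (y - z).
Proof. by apply: le_trans (nmD _ _); rewrite addrA subrK. Qed.

Lemma nm0 : nm (0 : V) = 0.
Proof. by rewrite /nm normr0. Qed.

Lemma nm0_eq0 x : nm x = 0 -> x = 0.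
Proof. by move=> h; apply/normr0_eq0; rewrite nmE h. Qed.

Lemma le_nmP x (r : R) : (`|x| <= r%:C) = (nm x <= r).
Proof. by rewrite nmE lecR. Qed.

Lemma lt_nmP x (r : R) : (`|x| < r%:C) = (nm x < r).
Proof. by rewrite nmE ltcR. Qed.

Lemma nbhs_nmP x (A : set V) :
  nbhs x A <-> exists2 e : R, 0 < e & forall y, nm (y - x) < e -> A y.
Proof.
split.
  move=> /nbhs_normP[e /= e0 eA]; exists (complex.Re e).
    by move: e0; rewrite ltcE => /andP[].
  move=> y yx; apply: eA => /=; rewrite distrC nmE.
  move: e0 yx; case: e => u v; rewrite ltcE /= => /andP[/eqP -> u0] yx.
  by rewrite ltcR.
move=> [e e0 eA]; apply: (iffRL (nbhs_normP _ _)); exists e%:C => /=.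
  by rewrite ltcR.
by move=> y /=; rewrite distrC nmE ltcR => /eA.
Qed.

Lemma nm_eps0 x : (forall e : R, 0 < e -> nm x <= e) -> x = 0.
Proof.
move=> h; apply: nm0_eq0; apply/eqP; rewrite eq_le nm_ge0 andbT leNgt.
apply/negP => x0; have := h (nm x / 2); rewrite divr_gt0 // => /(_ isT).
by rewrite leNgt ltr_pdivrMr // mulr_natr mulr2n ltrDl x0.
Qed.

End One.

Lemma nmZ (V : normedModType K) (a : K) (x : V) : nm (a *: x) = nm a * nm x.
Proof.
by have := normrZ a x; rewrite !nmE -rmorphM => /complexI.
Qed.

Lemma nmM (a b : K) : nm (a * b) = nm a * nm b.
Proof. exact: (nmZ a (b : K)). Qed.

Lemma nm1 : nm (1 : K) = 1.
Proof. by rewrite /nm normr1. Qed.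

Lemma nmX (a : K) n : nm (a ^+ n) = nm a ^+ n.
Proof. by elim: n => [|n IH]; rewrite ?nm1 // !exprS nmM IH. Qed.

Lemma nmV (a : K) : nm (a^-1) = (nm a)^-1.
Proof.
have [->|a0] := eqVneq a 0; first by rewrite invr0 nm0 invr0.
have na : nm a != 0 by apply: contra_neq a0 => /nm0_eq0.
by apply: (mulfI na); rewrite -nmM !divff // nm1.
Qed.

Lemma nmR (r : R) : nm (r%:C : K) = `|r|.
Proof. by rewrite /nm /= expr0n /= addr0 sqrtr_sqr. Qed.

Lemma nm_nat n : nm (n%:R : K) = n%:R.
Proof. by rewrite -[n%:R](rmorph_nat (real_complex R)) nmR ger0_norm. Qed.

Lemma nm_Re (a : K) : `|complex.Re a| <= nm a.
Proof.
case: a => u v; rewrite /nm /= -sqrtr_sqr ler_wsqrtr // lerDl sqr_ge0 //.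
Qed.

Lemma nm_Im (a : K) : `|complex.Im a| <= nm a.
Proof.
case: a => u v; rewrite /nm /= -sqrtr_sqr ler_wsqrtr // lerDr sqr_ge0 //.
Qed.

Lemma nm_sum (V : normedModType K) I (r : seq I) (P : pred I) (F : I -> V) :
  nm (\sum_(i <- r | P i) F i) <= \sum_(i <- r | P i) nm (F i).
Proof.
elim/big_rec2: _ => [|i y x _ h]; first by rewrite nm0.
by apply: le_trans (nmD _ _) _; rewrite lerD2l.
Qed.

Lemma continuous_nmP (V W : normedModType K) (f : V -> W) x :
  {for x, continuous f} <->
  forall e : R, 0 < e -> exists2 d : R, 0 < d &
    forall y, nm (y - x) < d -> nm (f y - f x) < e.
Proof.
split=> h.
  move=> e e0; apply/nbhs_nmP.
  have /h : nbhs (f x) [set z | nm (z - f x) < e] by apply/nbhs_nmP; exists e.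
  by [].
move=> A /nbhs_nmP[e e0 eA]; apply/nbhs_nmP.
have [d d0 dA] := h e e0.
by exists d => // y /dA /eA.
Qed.

Lemma differentiable_nm (V W : normedModType K) (f : V -> W) x :
  differentiable f x ->
  forall e : R, 0 < e -> exists2 d : R, 0 < d &
    forall h, nm h < d -> nm (f (x + h) - f x - 'd f x h) <= e * nm h.
Proof.
move=> /diff_locallyP[_ /eqaddoP df] e e0.
have /df/nbhs_nmP[d d0 H] : 0 < e%:C by rewrite ltcR.
exists d => // h hd; have := H h; rewrite subr0 => /(_ hd) /=.
by rewrite !fctE !nmE -rmorphM lecR opprD addrA [h + x]addrC.
Qed.

Lemma nm_differentiable (V W : normedModType K) (f : V -> W) x
  (L : {linear V -> W}) :
  continuous L ->
  (forall e : R, 0 < e -> exists2 d : R, 0 < d &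
    forall h, nm h < d -> nm (f (x + h) - f x - L h) <= e * nm h) ->
  differentiable f x /\ 'd f x = L :> (V -> W).
Proof.
move=> Lc H.
have E : f \o shift x = cst (f x) + L +o_ 0 id.
  apply/eqaddoP => e e0.
  have e0' : 0 < complex.Re e by move: e0; rewrite ltcE => /andP[].
  have [d d0 dA] := H _ e0'.
  have eE : e = (complex.Re e)%:C.
    by move: e0; case: (e) => u v; rewrite ltcE /= => /andP[/eqP ->].
  apply/nbhs_nmP; exists d => // h; rewrite subr0 => /dA.
  by rewrite /= !fctE !nmE eE -rmorphM lecR opprD addrA [h + x]addrC.
have dE := diff_unique Lc E.
by split => //; apply/diff_locallyP; rewrite dE.
Qed.

End RealNorm.

Section Seq.
Context {R : realType}.
Notation K := R[i].

Lemma nm_le_ReIm (a : K) : nm a <= `|complex.Re a| + `|complex.Im a|.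
Proof.
case: a => u v; rewrite /nm /=.
rewrite -[leRHS]ger0_norm ?addr_ge0 // -sqrtr_sqr ler_wsqrtr //.
rewrite -(real_normK (num_real u)) -(real_normK (num_real v)) sqrrD.
by rewrite lerD2r lerDl mulrn_wge0 // mulr_ge0.
Qed.

Lemma scaleKE (a b : K) : a *: b = a * b.
Proof. by []. Qed.

Definition tends (V : normedModType K) (u : nat -> V) (l : V) :=
  forall e : R, 0 < e -> exists N, forall n, (N <= n)%N -> nm (u n - l) <= e.

Lemma tends_unique (V : normedModType K) (u : nat -> V) l l' :
  tends u l -> tends u l' -> l = l'.
Proof.
move=> h h'; apply/eqP; rewrite -subr_eq0; apply/eqP/nm_eps0 => e e0.
have e2 : 0 < e / 2 by rewrite divr_gt0.
have [N HN] := h _ e2; have [N' HN'] := h' _ e2.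
apply: le_trans (nm_tri (u (maxn N N')) _ _) _.
rewrite nmB [e]splitr lerD ?HN ?HN' ?leq_maxl ?leq_maxr //.
Qed.

Lemma tends_cst (V : normedModType K) (l : V) : tends (fun=> l) l.
Proof. by move=> e e0; exists 0%N => n _; rewrite subrr nm0 ltW. Qed.

Lemma tendsD (V : normedModType K) (u v : nat -> V) l l' :
  tends u l -> tends v l' -> tends (fun n => u n + v n) (l + l').
Proof.
move=> h h' e e0; have e2 : 0 < e / 2 by rewrite divr_gt0.
have [N HN] := h _ e2; have [N' HN'] := h' _ e2.
exists (maxn N N') => n; rewrite geq_max => /andP[nN nN'].
rewrite opprD addrACA; apply: le_trans (nmD _ _) _.
by rewrite [e]splitr lerD ?HN ?HN'.
Qed.

Lemma tendsZ (V : normedModType K) (u : nat -> V) l (a : K) :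
  tends u l -> tends (fun n => a *: u n) (a *: l).
Proof.
move=> h e e0; have d0 : 0 < e / (nm a + 1).
  by rewrite divr_gt0 // ltr_wpDl // nm_ge0.
have [N HN] := h _ d0; exists N => n /HN H.
rewrite -scalerBr nmZ; apply: le_trans (ler_wpM2l (nm_ge0 _) H) _.
rewrite mulrA ler_pdivrMr ?ltr_wpDl ?nm_ge0 // mulrC ler_wpM2l ?lerDl //.
exact: ltW.
Qed.

Lemma tendsN (V : normedModType K) (u : nat -> V) l :
  tends u l -> tends (fun n => - u n) (- l).
Proof.
by move=> h e e0; have [N HN] := h _ e0; exists N => n /HN; rewrite -opprD nmN.
Qed.

Lemma tendsB (V : normedModType K) (u v : nat -> V) l l' :
  tends u l -> tends v l' -> tends (fun n => u n - v n) (l - l').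
Proof. by move=> h /tendsN; exact: tendsD. Qed.

Lemma tends_le (V : normedModType K) (u : nat -> V) l (B : R) :
  tends u l -> (exists N, forall n, (N <= n)%N -> nm (u n) <= B) -> nm l <= B.
Proof.
move=> h [N' HB]; apply/ler_addgt0Pr => e e0; have [N HN] := h _ e0.
rewrite -[l](subrK (u (maxn N N'))) addrC; apply: le_trans (nmD _ _) _.
by rewrite nmB lerD ?HB ?HN ?leq_maxl ?leq_maxr.
Qed.

(** Completeness is taken from [R] separately for the real and imaginary parts. The rate [e] is kept
    in the conclusion: Goursat's theorem needs the distance from the limit point to each nested
    rectangle. *)
Lemma cauchy_limit (u : nat -> K) (e : nat -> R) (N : nat) :
  (forall n m, (N <= n <= m)%N -> nm (u m - u n) <= e n) ->
  e @ \oo --> 0 ->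
  exists2 l, tends u l & forall n, (N <= n)%N -> nm (l - u n) <= e n.
Proof.
move=> H e0.
have aux (p : K -> R) : (forall a b, p (a - b) = p a - p b) ->
    (forall a, `|p a| <= nm a) -> exists l : R, (p \o u) @ \oo --> l.
  move=> pB ple; exists (lim ((p \o u) @ \oo)).
  apply: cauchy_cvg; apply/cauchy_exP => d d0.
  have /cvgrPdist_lt/(_ _ d0)[M _ HM] := e0.
  exists (p (u (maxn M N))); exists (maxn M N) => // m /= hm.
  rewrite -ball_normE /= distrC -pB; apply: le_lt_trans (ple _) _.
  have := HM (maxn M N); rewrite /= leq_maxl sub0r normrN => /(_ isT).
  by apply: le_lt_trans; apply: le_trans (ler_norm _); rewrite H // leq_maxr.
have [] := aux (@complex.Re R); [by case=> ? ? [? ?]|exact: nm_Re|move=> l1 h1].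
have [] := aux (@complex.Im R); [by case=> ? ? [? ?]|exact: nm_Im|move=> l2 h2].
have tl : tends u (l1 +i* l2).
  move=> d d0; have d2 : 0 < d / 2 by rewrite divr_gt0.
  have /cvgrPdist_le/(_ _ d2)[N1 _ H1] := h1.
  have /cvgrPdist_le/(_ _ d2)[N2 _ H2] := h2.
  exists (maxn N1 N2) => n; rewrite geq_max => /andP[n1 n2].
  apply: le_trans (nm_le_ReIm _) _.
  have := H1 _ n1; have := H2 _ n2; rewrite /= [`|l1 - _|]distrC [`|l2 - _|]distrC.
  by case: (u n) => a b /= ha hb; rewrite [d]splitr lerD.
exists (l1 +i* l2) => // n nN.
have tn : tends (fun m => u m - u n) (l1 +i* l2 - u n).
  by apply: tendsB => //; exact: tends_cst.
by apply: (tends_le tn); exists n => m nm_; rewrite H // nN.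
Qed.

Lemma geom_half_cvg (c : R) : (fun n => c * (2 ^+ n)^-1) @ \oo --> 0.
Proof.
have -> : (fun n => c * (2 ^+ n)^-1) = geometric c (2^-1 : R).
  by apply/funext => n; rewrite /geometric /= exprVn.
by apply: cvg_geometric; rewrite ger0_norm ?invr_ge0 // invf_lt1 // ltr1n.
Qed.

Lemma pow2_small (c e : R) : 0 < e -> exists N, forall n, (N <= n)%N ->
  c * (2 ^+ n)^-1 <= e.
Proof.
move=> e0; have /cvgrPdist_le/(_ _ e0)[N _ HN] := geom_half_cvg c.
exists N => n /HN /=; rewrite sub0r normrN; exact/le_trans/ler_norm.
Qed.

End Seq.

Section RealArith.
Variable R : realFieldType.
Implicit Types a b c : R.

Lemma half_lt c : 0 < c -> c / 2 < c.
Proof. lra. Qed.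

Lemma le_half_eq0 a : 0 <= a -> a <= 2^-1 * a -> a = 0.
Proof. lra. Qed.

Lemma lt_halfD a b c : a < c / 2 -> b <= c / 2 -> a + b < c.
Proof. lra. Qed.

Lemma half_quarterD a b c (d : R) : a <= 2^-1 * b -> b <= d / 2 -> c <= d / 4 -> a + c <= d / 2.
Proof. lra. Qed.

Lemma picard_gap a b c (d x e : R) : 0 <= b -> a <= 2^-1 * b -> c <= d * (2^-1 * x) -> b <= d * x ->
  2 * d * x <= e -> a + c <= e.
Proof. by rewrite [d * (_ * x)]mulrCA -[2 * d * x]mulrA; move: (d * x) => y; lra. Qed.
End RealArith.

Section QuasiAffine.
Context {R : realType}.
Notation K := R[i].
Variable V : normedModType K.

(* A derivative-free form of complex differentiability: it passes to pointwise
   limits and to integrals. *)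
Definition quasi_affine (f : V -> K) (p : V) (r B C : R) :=
  (forall h, nm h < r -> nm (f (p + h)) <= B) /\
  (forall h k a b, nm h < r -> nm k < r -> nm (a *: h + b *: k) < r ->
    nm (f (p + (a *: h + b *: k)) - f p
        - a * (f (p + h) - f p) - b * (f (p + k) - f p)) <=
    C * (nm (a *: h + b *: k) ^+ 2 + nm a * nm h ^+ 2 + nm b * nm k ^+ 2)).

Section QA.
Variables (f : V -> K) (p : V) (r B C : R).
Hypotheses (r0 : 0 < r) (B0 : 0 <= B) (C0 : 0 <= C) (H : quasi_affine f p r B C).

Let u (h : V) n : K := 2 ^+ n * (f (p + (2 ^+ n)^-1 *: h) - f p).

Let nm2n n : nm (2 ^+ n : K) = 2 ^+ n.
Proof. by rewrite nmX nm_nat. Qed.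

Let nmz (h : V) n : nm ((2 ^+ n : K)^-1 *: h) = (2 ^+ n)^-1 * nm h.
Proof. by rewrite nmZ nmV nm2n. Qed.

Let pow_gt0 n : 0 < (2 ^+ n : R).
Proof. by rewrite exprn_gt0. Qed.

Let smallN (h : V) : exists N, forall n, (N <= n)%N -> nm ((2 ^+ n : K)^-1 *: h) < r.
Proof.
have [N HN] := pow2_small (nm h) (divr_gt0 r0 (@ltr0Sn R 1)).
exists N => n /HN hn; rewrite nmz mulrC; apply: le_lt_trans hn _.
by rewrite ltr_pdivrMr // mulr_natr mulr2n ltrDl.
Qed.

(** With [b = 0] and [k = 0] the quasi-affine inequality compares the increments at the scales 2^-n
    and 2^-m; its quadratic right-hand side leaves a factor 2^-n after division by the scale. *)
Let uC (h : V) n m : nm ((2 ^+ n : K)^-1 *: h) < r -> (n <= m)%N ->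
  nm (u h m - u h n) <= (2 * C * nm h ^+ 2) * (2 ^+ n)^-1.
Proof.
move=> hn nm_; set H' := (2 ^+ n)^-1 *: h.
pose a : K := (2 ^+ (m - n))^-1.
have aE : a * (2 ^+ n)^-1 = (2 ^+ m)^-1 by rewrite /a -invfM -exprD subnK.
have nma : nm a = (2 ^+ (m - n))^-1 by rewrite nmV nm2n.
have a1 : nm a <= 1 by rewrite nma invf_le1 // exprn_ege1 // ler1n.
have aH : nm (a *: H' + 0 *: 0) < r.
  rewrite scale0r addr0 nmZ; apply: le_lt_trans hn.
  by rewrite ler_piMl // nm_ge0.
have := H.2 H' 0 a 0 hn; rewrite nm0 r0 aH => /(_ isT isT).
rewrite !(scale0r, mul0r, addr0, subr0) scalerA aE expr0n /= mulr0 => h1.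
have -> : u h m - u h n = 2 ^+ m * (f (p + (2 ^+ m)^-1 *: h) - f p - a * (f (p + H') - f p)).
  rewrite mulrBr mulrA; congr (_ - _ * _).
  have -> : 2 ^+ m = 2 ^+ (m - n) * 2 ^+ n :> K by rewrite -exprD subnK.
  by rewrite /a mulrAC divff ?mul1r // expf_neq0.
rewrite nmM nm2n; apply: le_trans (ler_wpM2l _ h1) _; first exact: ltW.
rewrite !nmz nma.
have -> : 2 ^+ m = 2 ^+ (m - n) * 2 ^+ n :> R by rewrite -exprD subnK.
have x1 : 1 <= 2 ^+ (m - n) :> R by rewrite exprn_ege1 // ler1n.
have y0 := pow_gt0 n.
set x := 2 ^+ (m - n) in x1 *; set y := 2 ^+ n in y0 *.
have x0 : 0 < x by apply: lt_le_trans x1.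
have hh := nm_ge0 h; set z := nm h in hh *.
have -> : x * y * (C * (((x * y)^-1 * z) ^+ 2 + x^-1 * (y^-1 * z) ^+ 2 + 0)) =
  C * z ^+ 2 * y^-1 * (x^-1 + 1) by field; rewrite !gt_eqF.
have -> : 2 * C * z ^+ 2 * y^-1 = C * z ^+ 2 * y^-1 * (1 + 1) by ring.
apply: ler_wpM2l; first by rewrite !mulr_ge0 ?invr_ge0 ?exprn_ge0 // ltW.
by rewrite lerD2r invf_le1.
Qed.

(** The dyadic difference quotients [u h n] converge. The limit is linear in [h] because the defect
    at scale 2^-n is quadratic in that scale, and bounded because [f] is. One sequence of scales
    suffices: the estimate at [n = 0] already compares the increment of [f] at [h] with the
    limit. *)
Lemma quasi_affine_diff : differentiable f p /\
  forall h, nm h < r -> nm (f (p + h) - f p - 'd f p h) <= 2 * C * nm h ^+ 2.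
Proof.
have ex h : exists l, tends (u h) l /\ forall n, nm ((2 ^+ n : K)^-1 *: h) < r ->
    nm (l - u h n) <= (2 * C * nm h ^+ 2) * (2 ^+ n)^-1.
  have [N HN] := smallN h.
  have [n m /andP[Nn nm_]|l tl Hl] := cauchy_limit _ (geom_half_cvg (2 * C * nm h ^+ 2)) (u := u h) (N := N).
    by apply: uC => //; exact: HN.
  exists l; split=> // n hn.
  apply: (@tends_le _ _ (fun m => u h m - u h n)); first by apply: tendsB => //; exact: tends_cst.
  by exists n => m; exact: uC.
pose L0 h := sval (cid (ex h)).
have L0t h : tends (u h) (L0 h) by rewrite /L0; case: cid => l [].
have L0e h n : nm ((2 ^+ n : K)^-1 *: h) < r ->
    nm (L0 h - u h n) <= (2 * C * nm h ^+ 2) * (2 ^+ n)^-1.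
  by move=> hn; rewrite /L0; case: cid => l [/= _]; apply.
have lin : linear L0.
  move=> a h k.
  have t1 : tends (fun n => u (a *: h + k) n - (a *: u h n + u k n)) (L0 (a *: h + k) - (a *: L0 h + L0 k)).
    by apply: tendsB => //; apply: tendsD => //; apply: tendsZ.
  have t2 : tends (fun n => u (a *: h + k) n - (a *: u h n + u k n)) 0.
    move=> e e0.
    have [N1 HN1] := smallN h; have [N2 HN2] := smallN k.
    have [N3 HN3] := smallN (a *: h + k).
    have [N4 HN4] := pow2_small (C * (nm (a *: h + k) ^+ 2 + nm a * nm h ^+ 2 + nm k ^+ 2)) e0.
    exists (maxn (maxn N1 N2) (maxn N3 N4)) => n.
    rewrite !geq_max => /andP[/andP[n1 n2] /andP[n3 n4]].
    apply: le_trans (HN4 n n4).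
    set s : K := (2 ^+ n)^-1.
    have E : a *: (s *: h) + 1 *: (s *: k) = s *: (a *: h + k).
      by rewrite scale1r scalerDr !scalerA mulrC.
    have := H.2 (s *: h) (s *: k) a 1 (HN1 _ n1) (HN2 _ n2).
    rewrite E => /(_ (HN3 _ n3)) h1.
    have -> : u (a *: h + k) n - (a *: u h n + u k n) - 0 = 2 ^+ n *
      (f (p + s *: (a *: h + k)) - f p - a * (f (p + s *: h) - f p) - 1 * (f (p + s *: k) - f p)).
      rewrite /u -/s scaleKE; ring.
    rewrite nmM nm2n; apply: le_trans (ler_wpM2l _ h1) _; first exact: ltW.
    rewrite !nmz nm1 le_eqVlt; apply/orP; left; apply/eqP.
    by field; rewrite gt_eqF.
  by apply/eqP; rewrite -subr_eq0; apply/eqP; exact: (tends_unique t1 t2).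
pose L : {linear V -> K} := HB.pack L0 (GRing.isLinear.Build K V K *:%R L0 lin).
have Lq h : nm h < r -> nm (f (p + h) - f p - L h) <= 2 * C * nm h ^+ 2.
  move=> hr; have := L0e h 0%N; rewrite nmz expr0 invr1 mul1r mulr1 /u expr0 invr1 scale1r mul1r.
  by move=> /(_ hr); rewrite nmB.
(* [L] is bounded by evaluating it on a multiple of [h] of norm r / 2, where the increment of [f] is
   at most 2 B and the error at most 2 C r^2. *)
pose M := (2 * B + 2 * C * r ^+ 2) * (2 / r).
have M0 : 0 <= M by rewrite !mulr_ge0 ?addr_ge0 ?mulr_ge0 ?invr_ge0 ?exprn_ge0 // ltW.
have LM h : nm (L h) <= M * nm h.
  have [->|h0] := eqVneq h 0; first by rewrite linear0 !nm0 mulr0.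
  have nh : 0 < nm h.
    by rewrite lt_neqAle nm_ge0 andbT eq_sym; apply: contra_neq h0 => /nm0_eq0.
  pose t : R := r / (2 * nm h).
  have t0 : 0 < t by rewrite divr_gt0 // mulr_gt0.
  have ntC : nm (t%:C : K) = t by rewrite nmR ger0_norm // ltW.
  have nth : nm (t%:C *: h) = r / 2.
    by rewrite nmZ ntC /t; field; rewrite gt_eqF.
  have ntr : nm (t%:C *: h) < r by rewrite nth ltr_pdivrMr // mulr_natr mulr2n ltrDl.
  have h1 := Lq _ ntr.
  have fB : nm (f p) <= B by rewrite -[p]addr0; apply: H.1; rewrite nm0.
  have h2 : nm (L (t%:C *: h)) <= 2 * B + 2 * C * r ^+ 2.
    have -> : L (t%:C *: h) = (f (p + t%:C *: h) - f p) - (f (p + t%:C *: h) - f p - L (t%:C *: h)) by ring.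
    apply: le_trans (nm_triB _ _) _; apply: lerD.
      apply: le_trans (nm_triB _ _) _.
      by rewrite mulr_natl mulr2n lerD // H.1.
    apply: le_trans h1 _; apply: ler_wpM2l; first by rewrite mulr_ge0.
    by rewrite lerXn2r ?nnegrE ?nm_ge0 // ?ltW.
  move: h2; rewrite linearZ /= -[_ *: _]/(_ * _) nmM ntC /M => h2.
  have -> : (2 * B + 2 * C * r ^+ 2) * (2 / r) * nm h = (2 * B + 2 * C * r ^+ 2) / t.
    by rewrite /t; field; rewrite !gt_eqF.
  by rewrite ler_pdivlMr // mulrC.
have Lc : continuous L.
  move=> x; apply/continuous_nmP => e e0.
  exists (e / (M + 1)); first by rewrite divr_gt0 // ltr_wpDl.
  move=> y; rewrite -linearB => hy; apply: le_lt_trans (LM _) _.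
  have M1 : 0 < M + 1 by rewrite ltr_wpDl.
  apply: (@le_lt_trans _ _ ((M + 1) * nm (y - x))).
    by rewrite ler_wpM2r ?nm_ge0 // lerDl.
  by move: hy; rewrite ltr_pdivlMr // mulrC.
have [|dd dE] := nm_differentiable (f := f) (x := p) Lc.
  move=> e e0.
  exists (Num.min r (e / (2 * C + 1))).
    by rewrite lt_min r0 divr_gt0 // ltr_wpDl // mulr_ge0.
  move=> h; rewrite lt_min => /andP[hr he]; apply: le_trans (Lq _ hr) _.
  rewrite expr2 mulrA ler_wpM2r ?nm_ge0 //.
  move: he; rewrite ltr_pdivlMr ?ltr_wpDl ?mulr_ge0 // => he.
  apply: le_trans (ltW he); rewrite mulrC ler_wpM2l ?nm_ge0 ?lerDl //.
split=> // h hr; rewrite dE; exact: Lq.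
Qed.
End QA.

Lemma quasi_affine_lim (u : nat -> V -> K) f p r B C :
  (forall n, quasi_affine (u n) p r B C) ->
  (forall h, nm h < r -> tends (u ^~ (p + h)) (f (p + h))) -> 0 < r ->
  quasi_affine f p r B C.
Proof.
move=> H t r0; have t0 : tends (u ^~ p) (f p).
  by have := t 0; rewrite nm0 addr0; exact.
split=> [h hr|h k a b hr kr hkr].
  by apply: (tends_le (t _ hr)); exists 0%N => n _; exact: (H n).1.
have tt : tends (fun n => u n (p + (a *: h + b *: k)) - u n p
        - a *: (u n (p + h) - u n p) - b *: (u n (p + k) - u n p)) 
  (f (p + (a *: h + b *: k)) - f p
        - a *: (f (p + h) - f p) - b *: (f (p + k) - f p)).
  apply: tendsB; last by apply: tendsZ; apply: tendsB => //; exact: t.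
  apply: tendsB; last by apply: tendsZ; apply: tendsB => //; exact: t.
  by apply: tendsB => //; exact: t.
by apply: (tends_le tt); exists 0%N => n _; exact: (H n).2.
Qed.

End QuasiAffine.

(** * Integrals of complex-valued functions of a real variable *)

Section Integral.
Context {R : realType}.
Notation K := R[i].
Notation mu := (@lebesgue_measure R).

Definition cint (a b : R) (f : R -> K) : K :=
  (\int[mu]_(t in `[a, b]) complex.Re (f t))%R +i*
  (\int[mu]_(t in `[a, b]) complex.Im (f t))%R.

(** The point [s] ranges over all of [R], also at the endpoints: the integrands are compositions
    with functions continuous at the points of a path, and this form needs no subspace topology. *)
Definition ccont (a b : R) (f : R -> K) := forall t, a <= t <= b ->
  forall e : R, 0 < e -> exists2 d : R, 0 < d &
    forall s, `|s - t| < d -> nm (f s - f t) < e.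

Lemma real_cont (a b : R) (f : R -> R) : (forall t, a <= t <= b ->
  forall e : R, 0 < e -> exists2 d : R, 0 < d &
    forall s, `|s - t| < d -> `|f s - f t| < e) ->
  {within `[a, b], continuous f}.
Proof.
move=> H; apply: continuous_in_subspaceT => t.
rewrite inE /= in_itv /= => tab.
apply/cvgrPdist_lt => e e0; have [d d0 hd] := H t tab e e0.
near=> s; rewrite distrC; apply: hd; rewrite distrC.
by near: s; apply: (@cvgr_dist_lt _ _ _ (nbhs t) _ id t).
Unshelve. all: by end_near. Qed.

Lemma real_cont_integrable (a b : R) (f : R -> R) :
  {within `[a, b], continuous f} -> mu.-integrable `[a, b] (EFin \o f).
Proof. by move=> fc; apply: continuous_compact_integrable => //; exact: segment_compact. Qed.

Lemma ccont_Re a b f : ccont a b f ->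
  {within `[a, b], continuous (fun t => complex.Re (f t))}.
Proof.
move=> fc; apply: real_cont => t tab e e0; have [d d0 hd] := fc t tab e e0.
exists d => // s /hd; apply: le_lt_trans; apply: le_trans (nm_Re _).
by rewrite raddfB.
Qed.

Lemma ccont_Im a b f : ccont a b f ->
  {within `[a, b], continuous (fun t => complex.Im (f t))}.
Proof.
move=> fc; apply: real_cont => t tab e e0; have [d d0 hd] := fc t tab e e0.
exists d => // s /hd; apply: le_lt_trans; apply: le_trans (nm_Im _).
by rewrite raddfB.
Qed.

Lemma cint_ext a b f g : (forall t, a <= t <= b -> f t = g t) ->
  cint a b f = cint a b g.
Proof.
move=> fg; rewrite /cint; congr (_ +i* _); apply: eq_Rintegral => t;
  by rewrite inE /= in_itv /= => /fg ->.
Qed.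

Lemma cintD a b f g : ccont a b f -> ccont a b g ->
  cint a b (fun t => f t + g t) = cint a b f + cint a b g.
Proof.
move=> fc gc; rewrite /cint.
under eq_Rintegral do rewrite raddfD.
under [X in _ +i* X]eq_Rintegral do rewrite raddfD.
rewrite !RintegralD //; apply: real_cont_integrable;
  by [exact: ccont_Re|exact: ccont_Im].
Qed.

Lemma cintZ a b c f : ccont a b f -> cint a b (fun t => c * f t) = c * cint a b f.
Proof.
move=> fc; rewrite /cint.
have fr := real_cont_integrable (ccont_Re fc).
have fi := real_cont_integrable (ccont_Im fc).
case: c => u v.
have E1 t : complex.Re ((u +i* v) * f t) = u * complex.Re (f t) - v * complex.Im (f t).
  by case: (f t).
have E2 t : complex.Im ((u +i* v) * f t) = u * complex.Im (f t) + v * complex.Re (f t).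
  by case: (f t).
under eq_Rintegral do rewrite E1.
under [X in _ +i* X]eq_Rintegral do rewrite E2.
have i (w : R) (h : R -> R) : mu.-integrable `[a, b] (EFin \o h) ->
    mu.-integrable `[a, b] (EFin \o (fun t => w * h t)).
  by move=> ih; apply: eq_integrable (integrableZl _ w ih) => //.
rewrite RintegralB ?RintegralD ?RintegralZl //; first exact: i.
- exact: i.
- exact: i.
- exact: i.
Qed.

Lemma ccontD a b f g : ccont a b f -> ccont a b g -> ccont a b (fun t => f t + g t).
Proof.
move=> fc gc t tab e e0; have e2 : 0 < e / 2 by rewrite divr_gt0.
have [d d0 hd] := fc t tab _ e2; have [d' d0' hd'] := gc t tab _ e2.
exists (Num.min d d'); first by rewrite lt_min d0.
move=> s; rewrite lt_min => /andP[/hd h /hd' h'].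
rewrite opprD addrACA; apply: le_lt_trans (nmD _ _) _.
by rewrite [e]splitr ltrD.
Qed.

Lemma ccont_cst a b c : ccont a b (fun=> c).
Proof. by move=> t _ e e0; exists 1 => // s _; rewrite subrr nm0. Qed.

Lemma ccontM a b f g : ccont a b f -> ccont a b g -> ccont a b (fun t => f t * g t).
Proof.
move=> fc gc t tab e e0.
pose M := nm (f t) + nm (g t) + 1.
have M0 : 0 < M by rewrite ltr_wpDl // addr_ge0 // nm_ge0.
have e1 : 0 < Num.min 1 (e / (2 * M)) by rewrite lt_min ltr01 divr_gt0 // mulr_gt0.
have [d d0 hd] := fc t tab _ e1; have [d' d0' hd'] := gc t tab _ e1.
exists (Num.min d d'); first by rewrite lt_min d0.
move=> s; rewrite lt_min => /andP[/hd h /hd' h'].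
have -> : f s * g s - f t * g t = (f s - f t) * (g s - g t) + f t * (g s - g t) + g t * (f s - f t) by ring.
move: h h'; rewrite !lt_min => /andP[h1 h] /andP[_ h'].
apply: le_lt_trans (nmD _ _) _; rewrite nmM.
apply: (@le_lt_trans _ _ (nm (g s - g t) * (1 + nm (f t)) + nm (g t) * nm (f s - f t))).
  rewrite lerD2r; apply: le_trans (nmD _ _) _; rewrite !nmM mulrDr mulr1 [nm (f t) * _]mulrC lerD2r.
  by rewrite ler_piMl ?nm_ge0 // ltW.
set x := nm (g s - g t) in h' *; set y := nm (f s - f t) in h *.
have e2 : e = e / (2 * M) * M + e / (2 * M) * M by field; rewrite gt_eqF.
have hf := nm_ge0 (f t); have hg := nm_ge0 (g t).
have q0 : 0 < e / (2 * M) by rewrite divr_gt0 // mulr_gt0.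
apply: (@le_lt_trans _ _ (e / (2 * M) * (1 + nm (f t)) + e / (2 * M) * nm (g t))).
  apply: lerD; first by apply: ler_wpM2r; [lra|exact: ltW].
  by rewrite mulrC; apply: ler_wpM2r => //; exact: ltW.
rewrite -mulrDr [ltRHS]e2 -mulrDr ltr_pM2l // /M; lra.
Qed.

Lemma ccontN a b f : ccont a b f -> ccont a b (fun t => - f t).
Proof.
move=> fc t tab e e0; have [d d0 hd] := fc t tab e e0.
by exists d => // s /hd; rewrite -opprD nmN.
Qed.

Lemma ccontB a b f g : ccont a b f -> ccont a b g -> ccont a b (fun t => f t - g t).
Proof. by move=> fc /ccontN; exact: ccontD. Qed.

Lemma cintN a b f : ccont a b f -> cint a b (fun t => - f t) = - cint a b f.
Proof.
move=> fc; rewrite -mulN1r -cintZ //.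
by apply: cint_ext => t _; rewrite mulN1r.
Qed.

Lemma cintB a b f g : ccont a b f -> ccont a b g ->
  cint a b (fun t => f t - g t) = cint a b f - cint a b g.
Proof. by move=> fc gc; rewrite cintD ?cintN //; exact: ccontN. Qed.

Lemma cint_split a c b f : a <= c -> c <= b -> ccont a b f ->
  cint a b f = cint a c f + cint c b f.
Proof.
move=> ac cb fc.
have aux (h : R -> R) : {within `[a, b], continuous h} ->
  (\int[mu]_(t in `[a, b]) h t = \int[mu]_(t in `[a, c]) h t + \int[mu]_(t in `[c, b]) h t)%R.
  move=> hc; have hi := real_cont_integrable hc.
  rewrite addrC; apply/eqP; rewrite -subr_eq; apply/eqP.
  rewrite Rintegral_itvB // Rintegral_itv_obnd_cbnd //.
  apply: integrableS hi => //; apply: subset_itv; rewrite bnd_simp //.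
by rewrite /cint !aux //; [exact: ccont_Im|exact: ccont_Re].
Qed.

Lemma le_cint a b f (g : R -> R) : ccont a b f -> {within `[a, b], continuous g} ->
  (forall t, a <= t <= b -> nm (f t) <= g t) ->
  nm (cint a b f) <= (\int[mu]_(t in `[a, b]) g t)%R.
Proof.
move=> fc gc fg; have gi := real_cont_integrable gc.
have [z0|z0] := eqVneq (cint a b f) 0.
  rewrite z0 nm0; apply: Rintegral_ge0 => t /=; rewrite in_itv /= => /fg.
  exact/le_trans/nm_ge0.
set z := cint a b f in z0 *.
have nz : nm z != 0 by apply: contra_neq z0 => /nm0_eq0.
(* Rotation by the unimodular [u] makes the integral real and nonnegative, so that comparing real
   parts loses nothing. *)
pose u := conjc z / (nm z)%:C.
have nu : nm u = 1.
  rewrite nmM nmV nmR ger0_norm ?nm_ge0 //.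
  have -> : nm (conjc z) = nm z by case: (z) => x y; rewrite /nm /= sqrrN.
  by rewrite divff.
have uz : u * z = (nm z)%:C.
  rewrite /u mulrAC; apply: (canLR (mulfK _)); first by apply: contra_neq nz => /(congr1 (@complex.Re R)).
  rewrite -rmorphM /nm; case: (z) => x y /=; rewrite -expr2 sqr_sqrtr ?addr_ge0 ?sqr_ge0 //.
  by apply/eqP; rewrite eq_complex /=; apply/andP; split; apply/eqP; ring.
have := cintZ u fc; rewrite -/z uz => /(congr1 (@complex.Re R)) /= <-.
apply: le_Rintegral => //.
  by apply: real_cont_integrable; apply: ccont_Re; apply: ccontM => //; exact: ccont_cst.
move=> t /=; rewrite in_itv /= => /fg; apply: le_trans.
by apply: le_trans (ler_norm _) _; apply: le_trans (nm_Re _) _; rewrite nmM nu mul1r.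
Qed.

Lemma le_cint_cst a b f (M : R) : a <= b -> ccont a b f ->
  (forall t, a <= t <= b -> nm (f t) <= M) -> nm (cint a b f) <= M * (b - a).
Proof.
move=> ab fc fM; apply: le_trans (le_cint fc _ fM) _.
  by apply: continuous_subspaceT => t; exact: cvg_cst.
rewrite Rintegral_cst //= lebesgue_measure_itv /= lte_fin.
move: ab; rewrite le_eqVlt => /predU1P[->|->] //; by rewrite ltxx subrr /= mulr0.
Qed.


Lemma real_deriv (G : R -> R) t g : (forall e : R, 0 < e -> exists2 d : R, 0 < d &
    forall s, `|s| < d -> `|G (t + s) - G t - s * g| <= e * `|s|) -> is_derive t 1 G g.
Proof.
move=> H.
have C : (fun h : R => h^-1 *: (G (h *: (1 : R) + t) - G t)) @ 0^' --> g.
  apply/cvgrPdist_le => e e0; have [d d0 hd] := H e e0.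
  near=> h.
  have h0 : h != 0 by near: h; exact: nbhs_dnbhs_neq.
  have hh : `|h| < d by near: h; apply: dnbhs0_lt.
  have := hd _ hh; rewrite [h *: 1]mulr1 addrC => h1.
  have nh : 0 < `|h| by rewrite normr_gt0.
  rewrite distrC -(ler_pM2r nh); apply: le_trans h1.
  rewrite -normrM le_eqVlt; apply/orP; left; apply/eqP; congr `|_|.
  have sE (x : R) : h^-1 *: x = h^-1 * x by [].
  by rewrite sE [h + t]addrC; field.
have D : derivable G t 1 by apply/cvg_ex; exists g.
by apply: DeriveDef => //; exact: cvg_lim C.
Unshelve. all: by end_near. Qed.

Lemma real_FTC a b (G g : R -> R) : a <= b -> {within `[a, b], continuous g} ->
  (forall t, a <= t <= b -> is_derive t 1 G (g t)) ->
  (\int[mu]_(t in `[a, b]) g t)%R = G b - G a.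
Proof.
move=> ab gc dG; have [aeb|altb] := eqVneq a b.
  by rewrite aeb set_itv1 Rintegral_set1 subrr.
have {altb}ab' : a < b by rewrite lt_neqAle altb.
rewrite /Rintegral (@continuous_FTC2 _ g G) //.
- have cG t : a <= t <= b -> {for t, continuous G}.
    by move=> /dG [/derivable1_diffP/differentiable_continuous].
  split.
  + move=> t; rewrite in_itv /= => /andP[a_t t_b].
    by have [] := dG t; rewrite ?(ltW a_t) ?(ltW t_b).
  + by apply: cvg_at_right_filter; apply: cG; rewrite lexx.
  + by apply: cvg_at_left_filter; apply: cG; rewrite lexx ltW.
- move=> t; rewrite in_itv /= => /andP[a_t t_b].
  have [] := dG t; rewrite ?(ltW a_t) ?(ltW t_b) // => _ <-.
  by rewrite derive1E.
Qed.

(** The bound comes with an explicit primitive [G]; this is the form in which the convolution of two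
    weights is estimated. *)
Lemma le_cint_FTC a b f (g G : R -> R) : a <= b -> ccont a b f ->
  {within `[a, b], continuous g} -> (forall t, a <= t <= b -> is_derive t 1 G (g t)) ->
  (forall t, a <= t <= b -> nm (f t) <= g t) ->
  nm (cint a b f) <= G b - G a.
Proof. by move=> ab fc gc dG fg; rewrite -(real_FTC ab gc dG); exact: le_cint. Qed.

Lemma cint_FTC a b (F f : R -> K) : a <= b -> ccont a b f ->
  (forall t, a <= t <= b -> forall e : R, 0 < e -> exists2 d : R, 0 < d &
    forall s, `|s| < d -> nm (F (t + s) - F t - s%:C * f t) <= e * `|s|) ->
  cint a b f = F b - F a.
Proof.
move=> ab fc H; rewrite /cint.
have -> : (\int[mu]_(t in `[a, b]) complex.Re (f t))%R = complex.Re (F b) - complex.Re (F a).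
  apply: (real_FTC (G := fun t => complex.Re (F t)) ab (ccont_Re fc)).
  move=> t tab; apply: real_deriv => e e0; have [d d0 hd] := H t tab e e0.
  exists d => // s /hd; apply: le_trans; apply: le_trans (nm_Re _).
  rewrite !raddfB /= le_eqVlt; apply/orP; left; apply/eqP; congr `|_ - _|.
  by case: (f t) => x y /=; rewrite mul0r subr0.
have -> : (\int[mu]_(t in `[a, b]) complex.Im (f t))%R = complex.Im (F b) - complex.Im (F a).
  apply: (real_FTC (G := fun t => complex.Im (F t)) ab (ccont_Im fc)).
  move=> t tab; apply: real_deriv => e e0; have [d d0 hd] := H t tab e e0.
  exists d => // s /hd; apply: le_trans; apply: le_trans (nm_Im _).
  rewrite !raddfB /= le_eqVlt; apply/orP; left; apply/eqP; congr `|_ - _|.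
  by case: (f t) => x y /=; rewrite mul0r addr0.
by case: (F b) => ? ?; case: (F a).
Qed.

End Integral.

Section QAInt.
Context {R : realType}.
Notation K := R[i].

(** Both quasi-affine inequalities bound expressions that are linear in the function, so they
    survive integration over [0, 1]. This replaces differentiation under the integral sign. *)
Lemma quasi_affine_cint (V : normedModType K) (G : R -> V -> K) (p : V) r B C : 0 < r ->
  (forall t, 0 <= t <= 1 -> quasi_affine (G t) p r B C) ->
  (forall h, nm h < r -> ccont 0 1 (G^~ (p + h))) ->
  quasi_affine (fun q => cint 0 1 (G^~ q)) p r B C.
Proof.
move=> r0 H Gc.
have G0 : ccont 0 1 (G^~ p) by have := Gc 0; rewrite addr0 nm0; exact.
split=> [h hr|h k a b hr kr hkr].
  rewrite -[B]mulr1 -[X in _ * X]subr0; apply: le_cint_cst => //; first exact: Gc.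
  by move=> t /H[h1 _]; exact: h1.
have c1 := Gc _ hkr; have c2 := Gc _ hr; have c3 := Gc _ kr.
have cz f u : ccont 0 1 f -> ccont (R:=R) 0 1 (fun t => u * f t).
  by move=> fc; apply: ccontM => //; exact: ccont_cst.
have b1 := ccontB c1 G0; have b2 := ccontB c2 G0; have b3 := ccontB c3 G0.
rewrite -(cintB c1 G0) -(cintB c2 G0) -(cintB c3 G0).
rewrite -(cintZ a b2) -(cintZ b b3) -(cintB b1 (cz _ a b2)).
rewrite -(cintB (ccontB b1 (cz _ a b2)) (cz _ b b3)).
rewrite -[leRHS]mulr1 -[X in _ * X]subr0; apply: le_cint_cst => //.
  by apply: ccontB; [apply: ccontB|]; rewrite //; apply: cz.
by move=> t /H[_ h1]; exact: h1.
Qed.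
End QAInt.

Section DiffRules.
Context {R : realType}.
Notation K := R[i].
Variable V : normedModType K.
Implicit Types (f g : V -> K) (z : V).

Lemma dfM f g z : differentiable f z -> differentiable g z ->
  differentiable (fun x => f x * g x) z.
Proof. by move=> *; exact: differentiableM. Qed.

Lemma dfD f g z : differentiable f z -> differentiable g z ->
  differentiable (fun x => f x + g x) z.
Proof. by move=> *; exact: differentiableD. Qed.

Lemma dfN f z : differentiable f z -> differentiable (fun x => - f x) z.
Proof. by move=> *; exact: differentiableN. Qed.

Lemma dfB f g z : differentiable f z -> differentiable g z ->
  differentiable (fun x => f x - g x) z.
Proof. by move=> *; exact: differentiableB. Qed.

Lemma dfC (c : K) z : differentiable (fun _ : V => c) z.
Proof. exact: differentiable_cst. Qed.

Lemma dfV f z : differentiable f z -> f z != 0 -> differentiable (fun x => (f x)^-1) z.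
Proof. by move=> *; exact: differentiableV. Qed.

Lemma df_sum I (r : seq I) (P : pred I) (f : I -> V -> K) z :
  (forall i, P i -> differentiable (f i) z) ->
  differentiable (fun x => \sum_(i <- r | P i) f i x) z.
Proof.
move=> H; elim: r => [|i r IH].
  by under eq_fun do rewrite big_nil; exact: dfC.
under eq_fun do rewrite big_cons.
case: (boolP (P i)) => Pi; last exact: IH.
by apply: dfD; [exact: H|exact: IH].
Qed.

Lemma df_prod I (r : seq I) (P : pred I) (f : I -> V -> K) z :
  (forall i, P i -> differentiable (f i) z) ->
  differentiable (fun x => \prod_(i <- r | P i) f i x) z.
Proof.
move=> H; elim: r => [|i r IH].
  by under eq_fun do rewrite big_nil; exact: dfC.
under eq_fun do rewrite big_cons.
case: (boolP (P i)) => Pi; last exact: IH.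
by apply: dfM; [exact: H|exact: IH].
Qed.

Lemma dfX f n z : differentiable f z -> differentiable (fun x => f x ^+ n) z.
Proof.
move=> df; elim: n => [|n IH]; first exact: dfC.
by under eq_fun do rewrite exprS; exact: dfM.
Qed.

Lemma df_id (z : K) : differentiable (fun x : K => x : K) z.
Proof. exact: ex_diff. Qed.

Lemma df_comp (W X : normedModType K) (f : V -> W) (g : W -> X) z :
  differentiable f z -> differentiable g (f z) -> differentiable (fun x => g (f x)) z.
Proof. by move=> *; exact: (differentiable_comp (f := f) (g := g)). Qed.

End DiffRules.

(** * Goursat's theorem and Cauchy's expansion on squares *)

Section Rect.
Context {R : realType}.
Notation K := R[i].
Notation Re := (@complex.Re R).
Notation Im := (@complex.Im R).
Implicit Types (g f F : K -> K) (z p : K) (x y : R).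

Definition inrect x1 x2 y1 y2 z := (x1 <= Re z <= x2) && (y1 <= Im z <= y2).
Definition onbnd x1 x2 y1 y2 z := inrect x1 x2 y1 y2 z &&
  [|| Re z == x1, Re z == x2, Im z == y1 | Im z == y2].

(** The counterclockwise contour integral: dz = dt on the horizontal sides and dz = i dt on the
    vertical ones. *)
Definition rint x1 x2 y1 y2 g : K :=
  cint x1 x2 (fun t => g (t +i* y1)) - cint x1 x2 (fun t => g (t +i* y2)) +
  (0 +i* 1) * (cint y1 y2 (fun t => g (x2 +i* t)) - cint y1 y2 (fun t => g (x1 +i* t))).

Lemma nm_complex x y : nm ((x +i* y) : K) = Num.sqrt (x ^+ 2 + y ^+ 2).
Proof. by []. Qed.

Lemma nmi : nm ((0 +i* 1) : K) = 1.
Proof. by rewrite nm_complex expr0n expr1n add0r sqrtr1. Qed.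

Lemma ccont_hor x1 x2 y g : (forall t, x1 <= t <= x2 -> {for t +i* y, continuous g}) ->
  ccont x1 x2 (fun t => g (t +i* y)).
Proof.
move=> H t tx e e0; have /continuous_nmP/(_ e e0)[d d0 hd] := H t tx.
exists d => // s sd; apply: hd; rewrite -[_ - _]/((s - t) +i* (y - y)) subrr.
by rewrite nm_complex expr0n addr0 sqrtr_sqr.
Qed.

Lemma ccont_ver y1 y2 x g : (forall t, y1 <= t <= y2 -> {for x +i* t, continuous g}) ->
  ccont y1 y2 (fun t => g (x +i* t)).
Proof.
move=> H t tx e e0; have /continuous_nmP/(_ e e0)[d d0 hd] := H t tx.
exists d => // s sd; apply: hd; rewrite -[_ - _]/((x - x) +i* (s - t)) subrr.
by rewrite nm_complex expr0n add0r sqrtr_sqr.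
Qed.

Section Fix.
Variables (x1 x2 y1 y2 : R).
Hypotheses (x12 : x1 <= x2) (y12 : y1 <= y2).
Let bnd := onbnd x1 x2 y1 y2.

Definition bcont g := forall z, onbnd x1 x2 y1 y2 z -> {for z, continuous g}.

Lemma bcont_segs g : bcont g ->
  [/\ ccont x1 x2 (fun t => g (t +i* y1)), ccont x1 x2 (fun t => g (t +i* y2)),
      ccont y1 y2 (fun t => g (x1 +i* t)) & ccont y1 y2 (fun t => g (x2 +i* t))].
Proof.
move=> gc; split; (apply: ccont_hor || apply: ccont_ver) => t tx; apply: gc;
by rewrite /onbnd /inrect /= tx ?lexx ?x12 ?y12 ?eqxx ?orbT.
Qed.

Lemma rint_ext f g : (forall z, bnd z -> f z = g z) -> rint x1 x2 y1 y2 f = rint x1 x2 y1 y2 g.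
Proof.
move=> fg; rewrite /rint; congr (_ - _ + _ * (_ - _)); apply: cint_ext => t tx; apply: fg;
by rewrite /bnd /onbnd /inrect /= tx ?lexx ?x12 ?y12 ?eqxx ?orbT.
Qed.

Lemma rintD f g : bcont f -> bcont g ->
  rint x1 x2 y1 y2 (fun z => f z + g z) = rint x1 x2 y1 y2 f + rint x1 x2 y1 y2 g.
Proof.
move=> /bcont_segs[? ? ? ?] /bcont_segs[? ? ? ?].
by rewrite /rint !cintD //; ring.
Qed.

Lemma rintZ c f : bcont f ->
  rint x1 x2 y1 y2 (fun z => c * f z) = c * rint x1 x2 y1 y2 f.
Proof.
move=> /bcont_segs[? ? ? ?].
by rewrite /rint !cintZ //; ring.
Qed.

Lemma rint_bound g M : bcont g -> (forall z, bnd z -> nm (g z) <= M) ->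
  nm (rint x1 x2 y1 y2 g) <= M * (2 * ((x2 - x1) + (y2 - y1))).
Proof.
move=> /bcont_segs[c1 c2 c3 c4] gM.
have h1 : nm (cint x1 x2 (fun t => g (t +i* y1))) <= M * (x2 - x1).
  apply: le_cint_cst => // t tx; apply: gM; by rewrite /bnd /onbnd /inrect /= tx ?lexx ?x12 ?y12 ?eqxx ?orbT.
have h2 : nm (cint x1 x2 (fun t => g (t +i* y2))) <= M * (x2 - x1).
  apply: le_cint_cst => // t tx; apply: gM; by rewrite /bnd /onbnd /inrect /= tx ?lexx ?x12 ?y12 ?eqxx ?orbT.
have h3 : nm (cint y1 y2 (fun t => g (x1 +i* t))) <= M * (y2 - y1).
  apply: le_cint_cst => // t tx; apply: gM; by rewrite /bnd /onbnd /inrect /= tx ?lexx ?x12 ?y12 ?eqxx ?orbT.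
have h4 : nm (cint y1 y2 (fun t => g (x2 +i* t))) <= M * (y2 - y1).
  apply: le_cint_cst => // t tx; apply: gM; by rewrite /bnd /onbnd /inrect /= tx ?lexx ?x12 ?y12 ?eqxx ?orbT.
apply: le_trans (nmD _ _) _; rewrite nmM nmi mul1r.
have := nm_triB (cint x1 x2 (fun t => g (t +i* y1))) (cint x1 x2 (fun t => g (t +i* y2))).
have := nm_triB (cint y1 y2 (fun t => g (x2 +i* t))) (cint y1 y2 (fun t => g (x1 +i* t))).
lra.
Qed.

Lemma rint_splitx c g : bcont g -> x1 <= c <= x2 ->
  rint x1 x2 y1 y2 g = rint x1 c y1 y2 g + rint c x2 y1 y2 g.
Proof.
move=> /bcont_segs[? ? ? ?] /andP[? ?].
by rewrite /rint (@cint_split _ x1 c x2 (fun t => g (t +i* y1))) // (@cint_split _ x1 c x2 (fun t => g (t +i* y2))) //; ring.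
Qed.

Lemma rint_splity c g : bcont g -> y1 <= c <= y2 ->
  rint x1 x2 y1 y2 g = rint x1 x2 y1 c g + rint x1 x2 c y2 g.
Proof.
move=> /bcont_segs[? ? ? ?] /andP[? ?].
by rewrite /rint (@cint_split _ y1 c y2 (fun t => g (x1 +i* t))) // (@cint_split _ y1 c y2 (fun t => g (x2 +i* t))) //; ring.
Qed.

Definition cder F z (l : K) := forall e : R, 0 < e -> exists2 d : R, 0 < d &
    forall h, nm h < d -> nm (F (z + h) - F z - h * l) <= e * nm h.

(** The derivative of [F] is required only on the boundary, so [F] may be singular inside; negative
    powers of z are integrated around 0 this way. *)
Lemma rint_primitive F g : bcont g -> (forall z, bnd z -> cder F z (g z)) ->
  rint x1 x2 y1 y2 g = 0.
Proof.
move=> /bcont_segs[c1 c2 c3 c4] dF.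
have H y : y = y1 \/ y = y2 -> ccont x1 x2 (fun t => g (t +i* y)) ->
   cint x1 x2 (fun t => g (t +i* y)) = F (x2 +i* y) - F (x1 +i* y).
  move=> yy gc; apply: (cint_FTC (F := fun t => F (t +i* y)) x12 gc) => t tx e e0.
  have [|d d0 hd] := dF (t +i* y) _ e e0.
    rewrite /bnd /onbnd /inrect /= tx; case: yy => ->; by rewrite ?lexx ?x12 ?y12 ?eqxx ?orbT.
  exists d => // s sd; have := hd s%:C; rewrite nmR => /(_ sd).
  by rewrite -[t +i* y + s%:C]/((t + s) +i* (y + 0)) addr0.
have V x : x = x1 \/ x = x2 -> ccont y1 y2 (fun t => g (x +i* t)) ->
   (0 +i* 1) * cint y1 y2 (fun t => g (x +i* t)) = F (x +i* y2) - F (x +i* y1).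
  move=> xx gc; rewrite -cintZ //.
  apply: (cint_FTC (F := fun t => F (x +i* t)) y12) => [|t tx e e0].
    apply: ccontM => //; exact: ccont_cst.
  have [|d d0 hd] := dF (x +i* t) _ e e0.
    rewrite /bnd /onbnd /inrect /= tx; case: xx => ->; by rewrite ?lexx ?x12 ?y12 ?eqxx ?orbT.
  exists d => // s sd; have := hd (s%:C * (0 +i* 1)); rewrite nmM nmi nmR mulr1 => /(_ sd).
  have -> : s%:C * (0 +i* 1) = 0 +i* s by rewrite /= /GRing.mul /=; congr (_ +i* _); ring.
  rewrite -[x +i* t + (0 +i* s)]/((x + 0) +i* (t + s)) addr0.
  have -> : (0 +i* s) * g (x +i* t) = s%:C * ((0 +i* 1) * g (x +i* t)) :> K.
    by rewrite mulrA; congr (_ * _); rewrite /= /GRing.mul /=; congr (_ +i* _); ring.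
  by [].
rewrite /rint mulrBr (V _ _ c3) ?(V _ _ c4) ?(H _ _ c1) ?(H _ _ c2); try by [left|right].
ring.
Qed.
End Fix.

Lemma differentiable_cder f z : differentiable f z -> cder f z ('d f z 1).
Proof.
move=> df e e0; have [d d0 hd] := differentiable_nm df e0.
exists d => // h /hd; suff -> : 'd f z h = h * 'd f z 1 by [].
by rewrite -[h in LHS]mulr1 -[h * 1]scaleKE linearZ.
Qed.

End Rect.

Section Goursat.
Context {R : realType}.
Notation K := R[i].
Notation Re := (@complex.Re R).
Notation Im := (@complex.Im R).
Implicit Types (g f F : K -> K) (z p : K) (x y : R).

Lemma onbnd_inrect (x1 x2 y1 y2 : R) z : onbnd x1 x2 y1 y2 z -> inrect x1 x2 y1 y2 z.
Proof. by case/andP. Qed.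

Lemma nm_four (A B C D : K) : 4 * nm A < nm (A + B + (C + D)) ->
  4 * nm B < nm (A + B + (C + D)) -> 4 * nm C < nm (A + B + (C + D)) ->
  4 * nm D < nm (A + B + (C + D)) -> False.
Proof. by have := nmD (A + B) (C + D); have := nmD A B; have := nmD C D; lra. Qed.

Lemma inrectW (x1 x2 y1 y2 u1 u2 v1 v2 : R) z : x1 <= u1 -> u2 <= x2 -> y1 <= v1 -> v2 <= y2 ->
  inrect u1 u2 v1 v2 z -> inrect x1 x2 y1 y2 z.
Proof.
move=> a b c d /andP[/andP[e f] /andP[g h]]; apply/andP; split; apply/andP; split.
- exact: le_trans a e.
- exact: le_trans f b.
- exact: le_trans c g.
- exact: le_trans h d.
Qed.

Lemma differentiable_bcont (x1 x2 y1 y2 : R) g :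
  (forall z, inrect x1 x2 y1 y2 z -> differentiable g z) -> bcont x1 x2 y1 y2 g.
Proof. by move=> dg z /onbnd_inrect /dg /differentiable_continuous. Qed.

Section Nested.
Variables (x1 x2 y1 y2 : R) (g : K -> K).
Hypotheses (x12 : x1 <= x2) (y12 : y1 <= y2).
Hypothesis dg : forall z, inrect x1 x2 y1 y2 z -> differentiable g z.

Let w n := (x2 - x1) / 2 ^+ n.
Let h n := (y2 - y1) / 2 ^+ n.
Let I n (a b : R) := nm (rint a (a + w n) b (b + h n) g).
Let quad n (a b : R) (i : bool * bool) : R * R :=
  (a + (if i.1 then w n.+1 else 0), b + (if i.2 then h n.+1 else 0)).
(** A quarter carrying at least a fourth of the integral in norm. [I_step] shows that one exists, so
    the default of [odflt] never matters. *)
Let choice n (a b : R) : bool * bool :=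
  odflt (false, false) [pick i | I n a b <= 4 * I n.+1 (quad n a b i).1 (quad n a b i).2].
Let corner := fix corner n : R * R := if n is m.+1 then
  quad m (corner m).1 (corner m).2 (choice m (corner m).1 (corner m).2) else (x1, y1).

Let cornerS n : corner n.+1 =
  quad n (corner n).1 (corner n).2 (choice n (corner n).1 (corner n).2).
Proof. by []. Qed.

Let w2 n : w n = w n.+1 + w n.+1.
Proof. by rewrite /w exprS; field; rewrite expf_neq0. Qed.
Let h2 n : h n = h n.+1 + h n.+1.
Proof. by rewrite /h exprS; field; rewrite expf_neq0. Qed.
Let w0 n : 0 <= w n.
Proof. by rewrite divr_ge0 ?subr_ge0 // exprn_ge0. Qed.
Let h0 n : 0 <= h n.
Proof. by rewrite divr_ge0 ?subr_ge0 // exprn_ge0. Qed.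

Let corner_in n : [/\ x1 <= (corner n).1, (corner n).1 + w n <= x2,
  y1 <= (corner n).2 & (corner n).2 + h n <= y2].
Proof.
elim: n => [|n [a1 a2 b1 b2]]; first by rewrite /w /h !expr0 !divr1 !subrKC.
rewrite cornerS /quad.
have := w0 n.+1; have := h0 n.+1; move: a2 b2; rewrite w2 h2.
by case: choice => [[] []] /= *; split; lra.
Qed.

Let corner_sub n m : (n <= m)%N ->
  [/\ (corner n).1 <= (corner m).1, (corner m).1 + w m <= (corner n).1 + w n,
  (corner n).2 <= (corner m).2 & (corner m).2 + h m <= (corner n).2 + h n].
Proof.
elim: m => [|m IH]; first by rewrite leqn0 => /eqP ->.
rewrite leq_eqVlt => /predU1P[->//|]; rewrite ltnS => /IH[a1 a2 b1 b2]; rewrite cornerS /quad.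
have := w0 m.+1; have := h0 m.+1; move: a2 b2; rewrite (w2 m) (h2 m).
by case: choice => [[] []] /= *; split; lra.
Qed.

Let I_step n : I n (corner n).1 (corner n).2 <= 4 * I n.+1 (corner n.+1).1 (corner n.+1).2.
Proof.
rewrite cornerS; set a := (corner n).1; set b := (corner n).2; rewrite /choice.
case: pickP => [i //|no]; exfalso.
have [ca cb cc cd] := corner_in n; rewrite -/a -/b in ca cb cc cd.
have W := w0 n.+1; have H := h0 n.+1; have W2 := w2 n; have H2 := h2 n.
have sub u1 u2 v1 v2 : a <= u1 -> u2 <= a + w n -> b <= v1 -> v2 <= b + h n -> bcont u1 u2 v1 v2 g.
  move=> s1 s2 s3 s4; apply: differentiable_bcont => z zi; apply: dg; move: zi.
  by apply: inrectW; [exact: le_trans ca s1|exact: le_trans s2 cb|exact: le_trans cc s3|exact: le_trans s4 cd].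
have E : rint a (a + w n) b (b + h n) g =
   rint a (a + w n.+1) b (b + h n.+1) g + rint a (a + w n.+1) (b + h n.+1) (b + h n.+1 + h n.+1) g
 + (rint (a + w n.+1) (a + w n.+1 + w n.+1) b (b + h n.+1) g
  + rint (a + w n.+1) (a + w n.+1 + w n.+1) (b + h n.+1) (b + h n.+1 + h n.+1) g).
  have i1 : a <= a + w n by lra.
  have i2 : b <= b + h n by lra.
  have i3 : a <= a + w n.+1 <= a + w n by apply/andP; split; lra.
  have i4 : b <= b + h n.+1 <= b + h n by apply/andP; split; lra.
  have i5 : a <= a + w n.+1 by lra.
  have i6 : a + w n.+1 <= a + w n by lra.
  have b1 : bcont a (a + w n) b (b + h n) g by apply: sub; lra.
  have b2 : bcont a (a + w n.+1) b (b + h n) g by apply: sub; lra.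
  have b3 : bcont (a + w n.+1) (a + w n) b (b + h n) g by apply: sub; lra.
  rewrite (rint_splitx i1 i2 b1 i3) (rint_splity i5 i2 b2 i4) (rint_splity i6 i2 b3 i4).
  by rewrite W2 H2 !(addrA a) !(addrA b).
have no' i := negbT (no i).
have := no' (false, false); have := no' (false, true).
have := no' (true, false); have := no' (true, true).
rewrite /I E /quad /= ?addr0 -!ltNge => i1 i2 i3 i4; exact: nm_four i4 i3 i2 i1.
Qed.

Lemma goursat : rint x1 x2 y1 y2 g = 0.
Proof.
apply/nm0_eq0/eqP; rewrite eq_le nm_ge0 andbT leNgt; apply/negP => A0.
set A := nm _ in A0.
have AI n : A <= 4 ^+ n * I n (corner n).1 (corner n).2.
  elim: n => [|n IH]; first by rewrite mul1r /I /= /w /h !expr0 !divr1 !subrKC.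
  by apply: le_trans IH _; rewrite exprSr -mulrA ler_pM2l ?exprn_gt0 // I_step.
pose u n : K := (corner n).1 +i* (corner n).2.
pose S := (x2 - x1) + (y2 - y1).
have S0 : 0 <= S by rewrite addr_ge0 ?subr_ge0.
have near_corner n z : inrect (corner n).1 ((corner n).1 + w n) (corner n).2 ((corner n).2 + h n) z ->
    nm (z - u n) <= S * (2 ^+ n)^-1.
  case: z => zx zy /andP[/= /andP[i1 i2] /andP[i3 i4]].
  apply: le_trans (nm_le_ReIm _) _; rewrite /= !ger0_norm ?subr_ge0 //.
  have -> : S * (2 ^+ n)^-1 = w n + h n by rewrite /S mulrDl.
  lra.
have in_corner n m : (n <= m)%N ->
  inrect (corner n).1 ((corner n).1 + w n) (corner n).2 ((corner n).2 + h n) (u m).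
  move=> /corner_sub[? ? ? ?]; have := w0 m; have := h0 m => *.
  by apply/andP; split; apply/andP; split => /=; lra.
have [n m /andP[_ nm_]|p tp Hp] := cauchy_limit _ (geom_half_cvg S) (u := u) (N := 0%N).
  by apply: near_corner; exact: in_corner.
have pin : inrect x1 x2 y1 y2 p.
  have aux (e : R) : 0 < e -> exists n, nm (p - u n) <= e.
    by move=> e0; have [N HN] := tp _ e0; exists N; rewrite nmB HN.
  have RR n : `|Re p - (corner n).1| <= nm (p - u n).
    by apply: le_trans (nm_Re _); rewrite raddfB.
  have II n : `|Im p - (corner n).2| <= nm (p - u n).
    by apply: le_trans (nm_Im _); rewrite raddfB.
  have [le1 le2 le3 le4] : [/\ forall e, 0 < e -> x1 <= Re p + e, forall e, 0 < e -> Re p <= x2 + e,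
      forall e, 0 < e -> y1 <= Im p + e & forall e, 0 < e -> Im p <= y2 + e].
    split=> e /aux[n hn]; have := le_trans (RR n) hn; have := le_trans (II n) hn; rewrite !ler_norml;
    have := corner_in n; have := w0 n; have := h0 n; move: (w n) (h n) (corner n) (Re p) (Im p);
    clear; move=> ? ? [a b] ? ? ? ? [/= ? ? ? ?] /andP[? ?] /andP[? ?]; lra.
  by apply/andP; split; apply/andP; split; apply/ler_addgt0Pr.
have S1 : 0 < 8 * (S ^+ 2 + 1) by rewrite mulr_gt0 // ltr_wpDl // sqr_ge0.
(* With this [e] the final bound is A S^2 / (2 (S^2 + 1)), which is less than A. *)
have e0 : 0 < A / (8 * (S ^+ 2 + 1)) by rewrite divr_gt0.
have [d d0 hd] := differentiable_cder (dg pin) e0.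
set l := 'd g p 1 in hd; set e := A / _ in hd e0.
have [n hn] := pow2_small (2 * S) (divr_gt0 d0 (@ltr0Sn R 1)).
have {hn} hn := hn n (leqnn n).
have [c1 c2 c3 c4] := corner_in n.
set a := (corner n).1 in c1 c2; set b := (corner n).2 in c3 c4.
have gc : bcont a (a + w n) b (b + h n) g.
  by apply: differentiable_bcont => z zi; apply: dg; move: zi; exact: inrectW.
(* [T] is minus the affine approximation of [g] at [p]. It has a primitive, so adding it leaves the
   integral unchanged, and the integrand becomes at most [e] times the distance to [p]. *)
pose T (z : K) : K := - (g p + (z - p) * l).
have dT z : differentiable T z.
  by apply/dfN/dfD; [exact: dfC|apply: dfM; [apply: dfB; [exact: df_id|]|]; exact: dfC].
have Tc : bcont a (a + w n) b (b + h n) T by apply: differentiable_bcont.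
have aw : a <= a + w n by rewrite lerDl.
have bh : b <= b + h n by rewrite lerDl.
have T0 : rint a (a + w n) b (b + h n) T = 0.
  apply: (@rint_primitive _ _ _ _ _ aw bh (fun z => - (g p * z + 2^-1 * l * (z - p) ^+ 2))) => // z _ d1 d10.
  exists (d1 / (nm l + 1)); first by rewrite divr_gt0 // ltr_wpDl // nm_ge0.
  move=> k; rewrite ltr_pdivlMr ?ltr_wpDl ?nm_ge0 // => kd.
  have -> : - (g p * (z + k) + 2^-1 * l * (z + k - p) ^+ 2) - - (g p * z + 2^-1 * l * (z - p) ^+ 2) - k * T z
    = - (2^-1 * l * k * k) by rewrite /T; field.
  rewrite nmN nmM ler_wpM2r ?nm_ge0 //; apply: le_trans (ltW kd).
  rewrite !nmM nmV nm_nat.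
  have := nm_ge0 l; have := nm_ge0 k; set X := nm k; set Y := nm l => X0 Y0.
  have XY : 0 <= X * Y by rewrite mulr_ge0.
  lra.
have := AI n; rewrite /I -/a -/b leNgt => /negP; apply.
have -> : rint a (a + w n) b (b + h n) g = rint a (a + w n) b (b + h n) (fun z => g z + T z).
  by rewrite rintD // T0 addr0.
have tc : bcont a (a + w n) b (b + h n) (fun z => g z + T z).
  move=> z zb; apply: (@differentiable_continuous _ K K); apply: dfD => //.
  by apply: dg; move: zb => /onbnd_inrect; exact: inrectW.
have P0 : 0 < (2 ^+ n : R) by rewrite exprn_gt0.
have bd : nm (rint a (a + w n) b (b + h n) (fun z => g z + T z)) <= (e * (2 * S / 2 ^+ n)) * (2 * ((a + w n - a) + (b + h n - b))).
  apply: rint_bound => // z /onbnd_inrect /near_corner zn.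
  have zp : nm (z - p) <= 2 * S / 2 ^+ n.
    apply: le_trans (nm_tri (u n) _ _) _; rewrite [nm (u n - p)]nmB.
    have := Hp n isT; lra.
  have := hd (z - p); rewrite subrKC /T opprD addrA => H.
  apply: le_trans (H _) _.
    by apply: le_lt_trans zp _; apply: le_lt_trans hn _; lra.
  by rewrite ler_pM2l.
have SE : a + w n - a + (b + h n - b) = S / 2 ^+ n.
  by rewrite /w /h /S; field; rewrite gt_eqF.
rewrite SE in bd.
have P4 : 4 ^+ n = 2 ^+ n * 2 ^+ n :> R by rewrite -exprMn -natrM.
apply: (@le_lt_trans _ _ (4 ^+ n * (e * (2 * S / 2 ^+ n) * (2 * (S / 2 ^+ n))))).
  by rewrite ler_pM2l // exprn_gt0.
rewrite P4 /e.
have -> : 2 ^+ n * 2 ^+ n * (A / (8 * (S ^+ 2 + 1)) * (2 * S / 2 ^+ n) * (2 * (S / 2 ^+ n))) =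
  A * (S ^+ 2 / (2 * (S ^+ 2 + 1))).
  have s1 : S ^+ 2 + 1 != 0 by rewrite gt_eqF // ltr_wpDl // sqr_ge0.
  by field; rewrite s1 gt_eqF.
rewrite gtr_pMr // ltr_pdivrMr ?mul1r; last by rewrite mulr_gt0 // ltr_wpDl // sqr_ge0.
have := sqr_ge0 S; lra.
Qed.
End Nested.

(** The rectangle minus a square of half-side [d] around [p] splits into four rectangles to which
    [goursat] applies, and the square contributes at most 8 M d. The integrand is not controlled at
    [p] itself: it will be a difference quotient, whose value there is a mere convention. *)
Lemma goursat_except (x1 x2 y1 y2 : R) p g (M : R) :
  x1 < Re p < x2 -> y1 < Im p < y2 ->
  (forall z, inrect x1 x2 y1 y2 z -> z != p -> differentiable g z) ->
  (forall z, inrect x1 x2 y1 y2 z -> z != p -> nm (g z) <= M) ->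
  rint x1 x2 y1 y2 g = 0.
Proof.
case: p => px py /= /andP[x1p px2] /andP[y1p py2] dg gM.
have M0 : 0 <= M.
  apply: le_trans (gM (x1 +i* y1) _ _); first exact: nm_ge0.
    by rewrite /inrect /=; apply/andP; split; apply/andP; split; lra.
  by rewrite eq_complex /= negb_and lt_eqF.
apply: nm_eps0 => e e0.
pose m := Num.min (Num.min (px - x1) (x2 - px)) (Num.min (py - y1) (y2 - py)).
(* [m] is the distance from [p] to the nearest side, so half of it keeps the square inside; the
   other bound gives 8 M d <= e. *)
pose d := Num.min (m / 2) (e / (8 * (M + 1))).
have m0 : 0 < m by rewrite !lt_min !subr_gt0 x1p px2 y1p py2.
have d0 : 0 < d by rewrite lt_min !divr_gt0 // mulr_gt0 // ltr_wpDl.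
have dm : d < m by rewrite gt_min; apply/orP; left; lra.
have [d1 d2 d3 d4] : [/\ x1 + d < px, px + d < x2, y1 + d < py & py + d < y2].
  by move: dm; rewrite !lt_min => /andP[/andP[? ?] /andP[? ?]]; split; lra.
have de : 8 * M * d <= e.
  have : d <= e / (8 * (M + 1)) by rewrite ge_min lexx orbT.
  rewrite ler_pdivlMr; last by rewrite mulr_gt0 // ltr_wpDl.
  have : 0 <= d * M by rewrite mulr_ge0 // ltW.
  lra.
clearbody d; clear m m0 dm.
have off u1 u2 v1 v2 : x1 <= u1 -> u2 <= x2 -> y1 <= v1 -> v2 <= y2 ->
  px < u1 \/ u2 < px \/ py < v1 \/ v2 < py ->
  forall z, inrect u1 u2 v1 v2 z -> differentiable g z.
  move=> s1 s2 s3 s4 H z zi; apply: dg; first exact: inrectW zi.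
  apply/eqP => zE; move: zi; rewrite zE => /andP[/= /andP[a b] /andP[c e']].
  by case: H => [|[|[|]]]; rewrite ltNge ?a ?b ?c ?e'.
have offb u1 u2 v1 v2 : x1 <= u1 -> u2 <= x2 -> y1 <= v1 -> v2 <= y2 ->
  u1 < px -> px < u2 -> v1 < py -> py < v2 -> bcont u1 u2 v1 v2 g.
  move=> s1 s2 s3 s4 t1 t2 t3 t4 z /andP[zi zb].
  apply: (@differentiable_continuous _ K K); apply: dg; first exact: inrectW zi.
  by apply/eqP => zE; move: zb; rewrite zE /= !(gt_eqF t1) !(gt_eqF t3) !(lt_eqF t2) !(lt_eqF t4).
have [e1 [e2 [e3 e4]]] : px - d < px /\ px < px + d /\ py - d < py /\ py < py + d.
  by clear -d0; repeat split; lra.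
have f1 : x1 <= px - d by clear -d1; lra.
have f2 : px + d <= x2 by clear -d2; lra.
have f3 : y1 <= py - d by clear -d3; lra.
have f4 : py + d <= y2 by clear -d4; lra.
have l1 : x1 <= x2 by rewrite ltW // (lt_trans x1p).
have l2 : y1 <= y2 by rewrite ltW // (lt_trans y1p).
have l4 : px - d <= px + d by rewrite ltW // (lt_trans e1).
have l6 : py - d <= py + d by rewrite ltW // (lt_trans e3).
have l3 : px - d <= x2 := le_trans l4 f2.
have l5 : py - d <= y2 := le_trans l6 f4.
have m1 : x1 <= px - d <= x2 by rewrite f1.
have m2 : px - d <= px + d <= x2 by rewrite l4.
have m3 : y1 <= py - d <= y2 by rewrite f3.
have m4 : py - d <= py + d <= y2 by rewrite l6.
have b1 : bcont x1 x2 y1 y2 g by apply: offb.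
have b2 : bcont (px - d) x2 y1 y2 g by apply: offb.
have b3 : bcont (px - d) (px + d) y1 y2 g by apply: offb.
have b4 : bcont (px - d) (px + d) (py - d) y2 g by apply: offb.
have b5 : bcont (px - d) (px + d) (py - d) (py + d) g by apply: offb.
rewrite (rint_splitx l1 l2 b1 m1) (@goursat x1 (px - d)) //; last first.
  by apply: off => //; right; left.
rewrite add0r (rint_splitx l3 l2 b2 m2) (@goursat (px + d) x2) //; last first.
  by apply: off => //; [exact: le_trans l4|left].
rewrite addr0 (rint_splity l4 l2 b3 m3) (@goursat (px - d) (px + d) y1) //; last first.
  by apply: off => //; right; right; right.
rewrite add0r (rint_splity l4 l5 b4 m4) (@goursat (px - d) (px + d) (py + d)) //; last first.
  by apply: off => //; [exact: le_trans l6|right; right; left].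
rewrite addr0; apply: le_trans (rint_bound (M := M) l4 l6 b5 _) _; last by clear -de; lra.
move=> z /andP[zi zb]; apply: gM; first exact: inrectW zi.
by apply/eqP => zE; move: zb; rewrite zE /= !(gt_eqF e1) !(gt_eqF e3) !(lt_eqF e2) !(lt_eqF e4).
Qed.
End Goursat.

Section NumField.
Variable K : numFieldType.

Lemma dprod_numField (f g : K -> K) z : differentiable f z -> differentiable g z ->
  'd (fun x => f x * g x) z 1 = f z * 'd g z 1 + g z * 'd f z 1 :> K.
Proof. by move=> df dg; rewrite (diffM df dg). Qed.

Lemma dinvX_numField n (z : K) : z != 0 ->
  differentiable (fun z : K => z^-1 ^+ n.+1) z /\
  'd (fun z : K => z^-1 ^+ n.+1) z 1 = - n.+1%:R * z^-1 ^+ n.+2 :> K.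
Proof.
move=> z0; have dz : differentiable (fun z : K => z^-1) z by exact: differentiableV.
have dz1 : 'd (fun z : K => z^-1) z 1 = - z^-1 ^+ 2 :> K.
  by rewrite (diff_Rinv z0) exprVn; exact: mulr1.
elim: n => [|n [IH1 IH2]].
  have -> : (fun z : K => z^-1 ^+ 1) = (fun z => z^-1) by apply/funext => ?; rewrite expr1.
  by rewrite dz1 mulN1r.
have -> : (fun z : K => z^-1 ^+ n.+2) = (fun z => z^-1 * z^-1 ^+ n.+1).
  by apply/funext => ?; rewrite exprS.
split; first exact: (differentiableM dz IH1).
rewrite (dprod_numField dz IH1) IH2 dz1 -[n.+2%:R]natr1 !exprS; ring.
Qed.

Lemma primitive_invX n (z : K) : z != 0 ->
  differentiable (fun z : K => - n.+1%:R^-1 * z^-1 ^+ n.+1) z /\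
  'd (fun z : K => - n.+1%:R^-1 * z^-1 ^+ n.+1) z 1 = z^-1 ^+ n.+2 :> K.
Proof.
move=> /(dinvX_numField n)[d1 d2].
have dc : differentiable (fun=> - n.+1%:R^-1 : K) (z : K) by exact: differentiable_cst.
split; first exact: (differentiableM dc d1).
rewrite (dprod_numField dc d1) d2 (diff_cst (- n.+1%:R^-1 : K) z) mulr0 addr0.
by rewrite mulrA mulrNN mulVf ?mul1r // pnatr_eq0.
Qed.
End NumField.

Section Cauchy.
Context {R : realType}.
Notation K := R[i].
Notation Re := (@complex.Re R).
Notation Im := (@complex.Im R).
Notation mu := (@lebesgue_measure R).

Lemma ge_cint_Re a b (f : R -> K) (m : R) : a <= b -> ccont a b f ->
  (forall t, a <= t <= b -> m <= Re (f t)) -> m * (b - a) <= Re (cint a b f).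
Proof.
move=> ab fc fm; rewrite /cint /=.
have dm t : a <= t <= b -> is_derive t (1:R) (fun t : R => m * t) m.
  by move=> _; apply: real_deriv => e e0; exists 1 => // s _; rewrite [_ - _](_ : _ = 0) ?normr0 ?mulr_ge0 // ?ltW //; ring.
have mc : {within `[a, b], continuous (fun=> m : R)}.
  by apply: continuous_subspaceT => t; exact: cvg_cst.
have := @real_FTC _ a b (fun t => m * t) (fun=> m) ab mc dm.
rewrite -mulrBr => <-; apply: le_Rintegral => //.
- exact: real_cont_integrable.
- by apply: real_cont_integrable; exact: ccont_Re.
Qed.

Section Square.
Variable s : R.
Hypothesis s0 : 0 < s.
Let ss : - s <= s. Proof. by rewrite ge0_cp // ltW. Qed.

Definition sq (g : K -> K) := rint (- s) s (- s) s g.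
Definition sqb (z : K) := onbnd (- s) s (- s) s z.

Lemma sqb_le z : sqb z -> nm z <= 2 * s.
Proof.
case: z => x y /onbnd_inrect/andP[/= xs ys].
apply: le_trans (nm_le_ReIm _) _ => /=.
by rewrite mulr_natl mulr2n lerD // ler_norml.
Qed.

Lemma sqb_ge z : sqb z -> s <= nm z.
Proof.
case: z => x y /andP[_ /or4P[]/eqP /= ->].
- by apply: le_trans (nm_Re _); rewrite /= normrN ler_norm.
- by apply: le_trans (nm_Re _); rewrite /= ler_norm.
- by apply: le_trans (nm_Im _); rewrite /= normrN ler_norm.
- by apply: le_trans (nm_Im _); rewrite /= ler_norm.
Qed.

Lemma nm_neq0 (z : K) : 0 < nm z -> z != 0.
Proof. by apply: contraTneq => ->; rewrite nm0 ltxx. Qed.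

Lemma sqb_neq0 z : sqb z -> z != 0.
Proof. by move=> /sqb_ge h; apply: nm_neq0; exact: lt_le_trans s0 h. Qed.

Lemma inv_bcont : bcont (- s) s (- s) s (fun z : K => z^-1).
Proof.
move=> z /sqb_neq0 z0; apply: (@differentiable_continuous _ K K).
by apply: dfV => //; exact: df_id.
Qed.

Let inv2s t : - s <= t <= s -> (2 * s)^-1 <= s / (s ^+ 2 + t ^+ 2).
Proof.
move=> ts; have t2 : t ^+ 2 <= s ^+ 2 by rewrite -[t ^+ 2]real_normK ?num_real // lerXn2r ?nnegrE // ?ler_norml // ltW.
have p : 0 < s ^+ 2 + t ^+ 2 by rewrite ltr_pwDl ?sqr_ge0 // exprn_gt0.
rewrite ler_pdivlMr // mulrC ler_pdivrMr ?mulr_gt0 //.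
have -> : s * (2 * s) = s ^+ 2 + s ^+ 2 by ring.
by rewrite lerD2l.
Qed.

Lemma sq_inv_ge : 4 <= nm (sq (fun z => z^-1)).
Proof.
have [c1 c2 c3 c4] := bcont_segs ss ss inv_bcont.
apply: le_trans (le_trans (ler_norm _) (nm_Im _)).
have E (a b c d : K) : Im (a - b + (0 +i* 1) * (c - d)) = Re ((0 -i* 1) * a) + Re ((0 +i* 1) * b) + Re c + Re ((-1) * d).
  by case: a => ? ?; case: b => ? ?; case: c => ? ?; case: d => ? ?; rewrite /=; ring.
rewrite /sq /rint E -!cintZ //.
have cz c f : ccont (- s) s f -> ccont (- s) s (fun t => c * f t : K).
  by apply: ccontM; exact: ccont_cst.
have one : (2 * s)^-1 * (s - - s) = 1 by field; rewrite gt_eqF.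
have A g : ccont (- s) s g -> (forall t, - s <= t <= s -> (2 * s)^-1 <= Re (g t)) -> 1 <= Re (cint (- s) s g).
  by move=> gc gm; rewrite -one; exact: ge_cint_Re.
have -> : (4 : R) = 1 + 1 + 1 + 1 by ring.
apply: lerD; [apply: lerD; [apply: lerD|]|]; apply: A => //; try exact: cz.
- move=> t /inv2s /le_trans -> //; rewrite le_eqVlt; apply/orP; left; apply/eqP => /=.
  by rewrite sqrrN [t ^+ 2 + _]addrC; ring.
- move=> t /inv2s /le_trans -> //; rewrite le_eqVlt; apply/orP; left; apply/eqP => /=.
  by rewrite [t ^+ 2 + _]addrC; ring.
- move=> t /inv2s /le_trans -> //; rewrite le_eqVlt; apply/orP; left; apply/eqP => /=.
  by rewrite ?sqrrN; ring.
Qed.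

Lemma dinvX n (z : K) : z != 0 ->
  differentiable (fun z : K => z^-1 ^+ n.+1) z /\
  'd (fun z : K => z^-1 ^+ n.+1) z 1 = - n.+1%:R * z^-1 ^+ n.+2 :> K.
Proof. exact: dinvX_numField. Qed.

Lemma sq_invX n : sq (fun z => z^-1 ^+ n.+2) = 0.
Proof.
apply: (@rint_primitive _ _ _ _ _ ss ss (fun z => - n.+1%:R^-1 * z^-1 ^+ n.+1)).
  move=> z /sqb_neq0 z0; apply: (@differentiable_continuous _ K K).
  by have [] := dinvX n.+1 z0.
move=> z /sqb_neq0 z0.
have [d1 d2] : differentiable (fun z : K => - n.+1%:R^-1 * z^-1 ^+ n.+1) z /\
  'd (fun z : K => - n.+1%:R^-1 * z^-1 ^+ n.+1) z 1 = z^-1 ^+ n.+2 :> K.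
  exact: primitive_invX.
by rewrite -d2; exact: differentiable_cder.
Qed.

(* Dividing by the integral of [1 / z] over the same square avoids computing it. *)
Definition cco (f : K -> K) n : K :=
  (sq (fun z => z^-1))^-1 * sq (fun z => f z * z^-1 ^+ n.+1).

Section F.
Variables (f : K -> K) (B : R).
Hypotheses (df : forall z, nm z <= 2 * s -> differentiable f z)
  (fB : forall z, nm z <= 2 * s -> nm (f z) <= B).

Let B0 : 0 <= B.
Proof. by apply: le_trans (fB (z := 0) _); rewrite ?nm_ge0 // nm0 mulr_ge0 // ltW. Qed.

Lemma sq_bound (g : K -> K) M : bcont (- s) s (- s) s g ->
  (forall z, sqb z -> nm (g z) <= M) -> nm (sq g) <= 8 * s * M.
Proof.
move=> gc gM; apply: le_trans (rint_bound (M := M) ss ss gc gM) _.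
by rewrite le_eqVlt; apply/orP; left; apply/eqP; ring.
Qed.

Let fc : forall z, sqb z -> differentiable f z.
Proof. by move=> z /sqb_le; exact: df. Qed.

Let nmin : 0 < nm (sq (fun z => z^-1)).
Proof. by apply: lt_le_trans sq_inv_ge. Qed.

(** The perimeter 8 s times B / s^(n+1), divided by the lower bound 4 of [sq_inv_ge]. *)
Lemma cco_bound n : nm (cco f n) <= 2 * B / s ^+ n.
Proof.
rewrite /cco nmM nmV mulrC ler_pdivrMr //.
apply: le_trans (sq_bound (M := B / s ^+ n.+1) _ _) _.
- move=> z zb; apply: (@differentiable_continuous _ K K); apply: dfM; first exact: fc.
  by have [] := dinvX n (sqb_neq0 zb).
- move=> z zb; rewrite nmM nmX nmV; apply: ler_pM; rewrite ?nm_ge0 ?exprn_ge0 ?invr_ge0 ?nm_ge0 //.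
    by apply: fB; exact: sqb_le.
  rewrite -exprVn lerXn2r ?nnegrE ?invr_ge0 ?nm_ge0 ?(ltW s0) //.
  by rewrite lef_pV2 ?posrE // ?sqb_ge // (lt_le_trans s0) // sqb_ge.
have sn : 0 < s ^+ n by rewrite exprn_gt0.
have -> : 8 * s * (B / s ^+ n.+1) = 2 * B / s ^+ n * 4 by rewrite exprS; field; rewrite !gt_eqF.
by rewrite ler_wpM2l ?sq_inv_ge // divr_ge0 // ?mulr_ge0 // ltW.
Qed.

Section B.
Variable b : K.
Hypothesis bs : nm b <= s / 2.

Let zb_ge z : sqb z -> s / 2 <= nm (z - b).
Proof.
move=> /sqb_ge zs; have := nm_tri b z 0; rewrite !subr0; move: bs zs; lra.
Qed.

Let zb_neq z : sqb z -> z - b != 0.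
Proof. by move=> /zb_ge h; apply: nm_neq0; apply: lt_le_trans h; rewrite divr_gt0. Qed.

(** The remainder of order [m] in the geometric expansion of the Cauchy kernel: (b/z)^m / (z - b) =
    b^m / z^(m+1) + (b/z)^(m+1) / (z - b). *)
Let E (g : K -> K) m z := g z * (b * z^-1) ^+ m * (z - b)^-1.

Let dE g m z : (forall z, sqb z -> differentiable g z) -> sqb z -> differentiable (E g m) z.
Proof.
move=> dg zb; apply: dfM; first apply: dfM; first exact: dg.
  apply: dfX; apply: dfM; first exact: dfC.
  by apply: dfV; [exact: df_id|exact: sqb_neq0].
by apply: dfV; [apply: dfB; [exact: df_id|exact: dfC]|exact: zb_neq].
Qed.

Let sqE g m : (forall z, sqb z -> differentiable g z) ->
  sq (E g m) = b ^+ m * sq (fun z => g z * z^-1 ^+ m.+1) + sq (E g m.+1).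
Proof.
move=> dg.
have d1 z : sqb z -> differentiable (fun z => g z * z^-1 ^+ m.+1) z.
  by move=> zb; apply: dfM; [exact: dg|have [] := dinvX m (sqb_neq0 zb)].
rewrite /sq -rintZ //; last by move=> z /d1; exact: (@differentiable_continuous _ K K).
rewrite -rintD //.
- apply: rint_ext => // z zb; rewrite /E !exprS exprMn.
  have z0 := sqb_neq0 zb; have z1 := zb_neq zb.
  by field; rewrite z1.
- move=> z zb; apply: (@differentiable_continuous _ K K); apply: dfM; [exact: dfC|exact: d1].
- by move=> z zb; apply: (@differentiable_continuous _ K K); exact: dE.
Qed.

Let sqEn g m : (forall z, sqb z -> differentiable g z) ->
  sq (E g 0) = \sum_(n < m) b ^+ n * sq (fun z => g z * z^-1 ^+ n.+1) + sq (E g m).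
Proof.
move=> dg; elim: m => [|m IH]; first by rewrite big_ord0 add0r.
by rewrite big_ord_recr /= -addrA -sqE.
Qed.

Let sqE_le g m M : 0 <= M -> (forall z, sqb z -> differentiable g z) -> (forall z, sqb z -> nm (g z) <= M) ->
  nm (sq (E g m)) <= 16 * M * (nm b / s) ^+ m.
Proof.
move=> M0 dg gM; have -> : 16 * M * (nm b / s) ^+ m = 8 * s * (M * (nm b / s) ^+ m * (s / 2)^-1).
  by field; rewrite gt_eqF.
apply: sq_bound; first by move=> z zb; apply: (@differentiable_continuous _ K K); exact: dE.
move=> z zb; have zs := sqb_ge zb; have zbs := zb_ge zb.
have s2 : 0 < s / 2 by rewrite divr_gt0.
rewrite /E !nmM nmX nmM !nmV; apply: ler_pM; rewrite ?invr_ge0 ?nm_ge0 //.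
- by rewrite !mulr_ge0 ?nm_ge0 // exprn_ge0 // mulr_ge0 ?invr_ge0 ?nm_ge0.
- apply: ler_pM; rewrite ?nm_ge0 ?gM ?exprn_ge0 ?mulr_ge0 ?invr_ge0 ?nm_ge0 //.
  rewrite lerXn2r ?nnegrE ?mulr_ge0 ?invr_ge0 ?nm_ge0 // ?(ltW s0) //.
  by rewrite ler_wpM2l ?nm_ge0 // lef_pV2 ?posrE // (lt_le_trans s0).
- by rewrite lef_pV2 ?posrE // (lt_le_trans s2).
Qed.

(** For the constant 1 only the term in 1 / z survives, since the higher negative powers integrate
    to 0, and the remainder tends to 0 because |b| <= s / 2. *)
Let sq_kernel : sq (E (fun=> 1) 0) = sq (fun z => z^-1).
Proof.
have d1 z : sqb z -> differentiable (fun=> 1 : K) (z : K) by move=> _; exact: dfC.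
apply/eqP; rewrite -subr_eq0; apply/eqP/nm_eps0 => e e0.
have E1 k : (fun z : K => 1 * z^-1 ^+ k) = (fun z => z^-1 ^+ k).
  by apply/funext => z; rewrite mul1r.
have [N HN] := pow2_small 16 e0; have := HN N.+1 (leqnSn N); apply: le_trans.
rewrite (sqEn N.+1 d1) big_ord_recl /= expr0 mul1r big1 => [|n _]; last first.
  by rewrite E1 /bump /= add1n sq_invX mulr0.
have E2 : (fun z : K => z^-1 ^+ 1) = (fun z => z^-1) by apply/funext => z; rewrite expr1.
rewrite addr0 E1 E2.
rewrite addrAC subrr add0r; apply: le_trans (sqE_le _ (M := 1) _ _ _) _ => //.
  by move=> z _; rewrite nm1.
rewrite mulr1 ler_wpM2l // -exprVn lerXn2r ?nnegrE ?divr_ge0 ?nm_ge0 ?invr_ge0 ?(ltW s0) //.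
by rewrite ler_pdivrMr // mulrC.
Qed.

Let cauchy_formula : sq (E f 0) = f b * sq (fun z => z^-1).
Proof.
have d1 z : sqb z -> differentiable (fun=> 1 : K) (z : K) by move=> _; exact: dfC.
have bb : nm b <= 2 * s by apply: le_trans bs _; move: s0; lra.
pose g z := (f z - f b) * (z - b)^-1.
have dg z : nm z <= 2 * s -> z != b -> differentiable g z.
  move=> zs zb; apply: dfM; first by apply: dfB; [exact: df|exact: dfC].
  by apply: dfV; [apply: dfB; [exact: df_id|exact: dfC]|rewrite subr_eq0].
have inr z : inrect (- s) s (- s) s z -> nm z <= 2 * s.
  case: z => x y /andP[/= xs ys].
  apply: le_trans (nm_le_ReIm _) _ => /=.
  by rewrite mulr_natl mulr2n lerD // ler_norml.
have [d d0 hd] := differentiable_cder (df bb) ltr01.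
set l := 'd f b 1 in hd.
(* Differentiability at [b] bounds the quotient by |l| + 1 at distance less than [d], and [fB]
   bounds it by 2 B / d farther away; boundedness is all that [goursat_except] asks near [b]. *)
have g0 : sq g = 0.
  apply: (@goursat_except _ _ _ _ _ b g (nm l + 1 + 2 * B / d)).
  - have := le_trans (nm_Re b) bs; rewrite ler_norml => /andP[i1 i2]; apply/andP; split; [apply: lt_le_trans i1|apply: le_lt_trans i2 _]; move: s0; lra.
  - have := le_trans (nm_Im b) bs; rewrite ler_norml => /andP[i1 i2]; apply/andP; split; [apply: lt_le_trans i1|apply: le_lt_trans i2 _]; move: s0; lra.
  - by move=> z /inr; exact: dg.
  - move=> z /inr zs zb; have nzb : 0 < nm (z - b).
      rewrite lt_neqAle nm_ge0 andbT eq_sym; apply: contra_neq zb => /nm0_eq0 /eqP.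
      by rewrite subr_eq0 => /eqP.
    have l0 := nm_ge0 l.
    rewrite /g nmM nmV ler_pdivrMr //.
    have [zd|dz] := ltP (nm (z - b)) d.
      have := hd _ zd; rewrite subrKC mul1r => h1.
      apply: (@le_trans _ _ ((nm l + 1) * nm (z - b))).
        rewrite -[f z - f b](subrK ((z - b) * l)); apply: le_trans (nmD _ _) _.
        by rewrite nmM [leRHS]mulrDl mul1r addrC lerD // mulrC.
      by rewrite ler_wpM2r ?nm_ge0 // lerDl divr_ge0 ?mulr_ge0 // ltW.
    apply: le_trans (nm_triB _ _) _.
    apply: (@le_trans _ _ (2 * B)).
      by rewrite mulr_natl mulr2n lerD // fB.
    apply: (@le_trans _ _ (2 * B / d * nm (z - b))).
      by rewrite mulrAC ler_pdivlMr // ler_wpM2l // mulr_ge0.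
    by rewrite ler_wpM2r ?nm_ge0 // lerDr addr_ge0.
have c1 : bcont (- s) s (- s) s g.
  move=> z zb; apply: (@differentiable_continuous _ K K); apply: dg; first exact: sqb_le.
  by rewrite -subr_eq0; exact: zb_neq.
have c2 : bcont (- s) s (- s) s (E (fun=> 1) 0).
  by move=> z zb; apply: (@differentiable_continuous _ K K); exact: dE.
have c3 : bcont (- s) s (- s) s (fun z => f b * E (fun=> 1) 0 z).
  by move=> z zb; apply: (@differentiable_continuous _ K K); apply: dfM; [exact: dfC|exact: dE].
have -> : sq (E f 0) = rint (- s) s (- s) s (fun z => g z + f b * E (fun=> 1) 0 z).
  by apply: rint_ext => // z zb; rewrite /E /g !expr0; ring.
by rewrite (rintD ss ss c1 c3) (rintZ ss ss _ c2) -/(sq g) -/(sq _) g0 add0r sq_kernel.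
Qed.

(** The kernel is expanded [m] times in the integral formula; the 16 of [sqE_le] divided by the
    lower bound 4 gives the constant. Holomorphic functions are expanded only in this finite form
    with remainder. *)
Lemma cauchy_expansion m :
  nm (f b - \sum_(n < m) cco f n * b ^+ n) <= 4 * B * (nm b / s) ^+ m.
Proof.
set c := sq (fun z => z^-1).
have c0 : c != 0 by apply: nm_neq0.
have -> : f b - \sum_(n < m) cco f n * b ^+ n = c^-1 * sq (E f m).
  have := sqEn m fc; rewrite cauchy_formula -/c => /(congr1 (fun x => c^-1 * x)).
  rewrite mulrCA mulVf // mulr1 => ->; rewrite mulrDr.
  rewrite mulr_sumr addrAC -sumrB big1 ?add0r // => n _.
  by rewrite /cco -/c; ring.
rewrite nmM nmV mulrC ler_pdivrMr //; apply: le_trans (sqE_le m B0 fc _) _.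
  by move=> z /sqb_le; exact: fB.
have -> : 16 * B * (nm b / s) ^+ m = 4 * B * (nm b / s) ^+ m * 4 by ring.
by rewrite ler_wpM2l ?sq_inv_ge // !mulr_ge0 // exprn_ge0 // divr_ge0 ?nm_ge0 // ltW.
Qed.

End B.
End F.
End Square.
End Cauchy.

(** * Holomorphic functions on normed spaces *)

Section Lines.
Context {R : realType}.
Notation K := R[i].

Lemma nm_gt0 (V : normedModType K) (x : V) : x != 0 -> 0 < nm x.
Proof.
by move=> x0; rewrite lt_neqAle nm_ge0 andbT eq_sym; apply: contra_neq x0 => /nm0_eq0.
Qed.

Lemma diffZv (V : normedModType K) (f : V -> K) p (a : K) h :
  'd f p (a *: h) = a * 'd f p h.
Proof. exact: linearZ. Qed.

Lemma differentiable_line (V : normedModType K) (f : V -> K) (p v : V) (t : K) :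
  differentiable f (p + t *: v) -> differentiable (fun t : K => f (p + t *: v)) t.
Proof.
move=> df; have da : differentiable (fun t : K => p + t *: v) t by exact: ex_diff.
exact: (differentiable_comp da df).
Qed.

Lemma cco0 (s : R) (g : K -> K) B : 0 < s -> (forall z, nm z <= 2 * s -> differentiable g z) ->
  (forall z, nm z <= 2 * s -> nm (g z) <= B) -> cco s g 0 = g 0.
Proof.
move=> s0 dg gB.
have b0 : nm (0 : K) <= s / 2 by rewrite nm0 divr_ge0 // ltW.
have := cauchy_expansion s0 dg gB b0 1; rewrite big_ord1 expr0 mulr1 nm0 mul0r expr1 mulr0 => h.
apply/eqP; rewrite eq_sym -subr_eq0; apply/eqP/nm0_eq0/eqP.
by rewrite eq_le nm_ge0 h.
Qed.

Section Bounded.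
Variables (V : normedModType K) (f : V -> K) (p : V) (r B : R).
Hypotheses (r0 : 0 < r) (df : forall q, nm (q - p) < r -> differentiable f q)
  (fB : forall q, nm (q - p) < r -> nm (f q) <= B).

Section Dir.
Variables (v : V) (s : R).
Hypotheses (s0 : 0 < s) (sv : 2 * s * nm v < r).

Let small (t : K) : nm t <= 2 * s -> nm (p + t *: v - p) < r.
Proof.
by move=> ts; rewrite addrAC subrr add0r nmZ; apply: le_lt_trans sv; rewrite ler_wpM2r ?nm_ge0.
Qed.

Lemma dir_diff (t : K) : nm t <= 2 * s -> differentiable (fun t : K => f (p + t *: v)) t.
Proof. by move=> /small /df; exact: differentiable_line. Qed.

Lemma dir_bound (t : K) : nm t <= 2 * s -> nm (f (p + t *: v)) <= B.
Proof. by move=> /small /fB. Qed.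

Lemma dir_cco0 : cco s (fun t => f (p + t *: v)) 0 = f p.
Proof. by rewrite (cco0 s0 dir_diff dir_bound) scale0r addr0. Qed.

(** The second order Cauchy expansion along the line and differentiability at [p] both describe f (p
    + t v) - f p for small t, so their linear terms agree. *)
Lemma dir_cco1 : cco s (fun t => f (p + t *: v)) 1 = 'd f p v.
Proof.
have fp : differentiable f p by apply: df; rewrite subrr nm0.
apply/eqP; rewrite -subr_eq0; apply/eqP/nm_eps0 => e e0.
have B0 : 0 <= B by apply: le_trans (fB (q := p) _); rewrite ?nm_ge0 // subrr nm0.
have e2 : 0 < e / (2 * (nm v + 1)) by rewrite divr_gt0 // mulr_gt0 // ltr_wpDl // nm_ge0.
have [d d0 hd] := differentiable_nm fp e2.
pose C := 4 * B / s ^+ 2.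
have C0 : 0 <= C by rewrite divr_ge0 ?mulr_ge0 ?exprn_ge0 // ltW.
(* The three bounds serve the Cauchy expansion, the differentiability estimate, and the inequality C
   t^2 <= (e / 2) t. *)
pose t := Num.min (s / 2) (Num.min (d / (2 * (nm v + 1))) (e / (2 * (C + 1)))).
have v1 : 0 < nm v + 1 by rewrite ltr_wpDl // nm_ge0.
have C1 : 0 < C + 1 by rewrite ltr_wpDl.
have t0 : 0 < t by rewrite !lt_min !divr_gt0 // mulr_gt0.
have nt : nm (t%:C : K) = t by rewrite nmR ger0_norm // ltW.
have ts : nm (t%:C : K) <= s / 2 by rewrite nt ge_min lexx.
have := cauchy_expansion s0 dir_diff dir_bound ts 2.
rewrite big_ord_recr big_ord1 /= expr0 mulr1 expr1 dir_cco0 nt => h1.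
have td : nm (t%:C *: v) < d.
  rewrite nmZ nt; have : t <= d / (2 * (nm v + 1)) by rewrite !ge_min lexx orbT.
  rewrite ler_pdivlMr ?mulr_gt0 // => h2.
  have : 0 <= t * nm v by rewrite mulr_ge0 ?nm_ge0 // ltW.
  move: h2 t0 d0; lra.
have := hd _ td; rewrite diffZv nmZ nt => h2.
set c1 := cco _ _ _ in h1 *; set l := 'd f p v in h2 *.
have E : t%:C * (c1 - l) = (f (p + t%:C *: v) - f p - t%:C * l) - (f (p + t%:C *: v) - (f p + c1 * t%:C)) by ring.
have : nm (t%:C * (c1 - l)) <= e * t.
  rewrite E; apply: le_trans (nm_triB _ _) _.
  apply: (@le_trans _ _ (e / 2 * t + e / 2 * t)); last by rewrite -mulrDl -splitr.
  apply: lerD.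
    apply: le_trans h2 _; rewrite mulrCA mulrC; apply: ler_wpM2r; first exact: ltW.
    have -> : e / (2 * (nm v + 1)) * nm v = e / 2 * (nm v / (nm v + 1)) by field; rewrite gt_eqF.
    by rewrite ler_piMr ?divr_ge0 // ?ltW // ltr_pdivrMr // mul1r ltrDl.
  apply: le_trans h1 _; rewrite expr_div_n.
  have -> : 4 * B * (t ^+ 2 / s ^+ 2) = C * t * t by rewrite /C; ring.
  rewrite ler_wpM2r ?ltW //.
  have : t <= e / (2 * (C + 1)) by rewrite !ge_min lexx !orbT.
  rewrite ler_pdivlMr ?mulr_gt0 // => h3; have : 0 <= t * C by rewrite mulr_ge0 // ltW.
  move: h3 t0; lra.
by rewrite nmM nt mulrC ler_pM2r.
Qed.
End Dir.

Let B0 : 0 <= B.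
Proof. by apply: le_trans (fB (q := p) _); rewrite ?nm_ge0 // subrr nm0. Qed.

Lemma holo_lipschitz h : nm h < r -> nm (f (p + h) - f p) <= 16 * B * nm h / r.
Proof.
move=> hr; have [->|h0] := eqVneq h 0; first by rewrite addr0 subrr !nm0 mulr0 mul0r.
have nh := nm_gt0 h0.
have [h8|h8] := leP (nm h) (r / 8).
  (* In the direction [h] the disc of radius 2 s reaches distance r / 2, inside the ball, and the
     point t = 1 satisfies 1 <= s / 2 exactly when |h| <= r / 8. *)
  pose s := r / (4 * nm h).
  have s0 : 0 < s by rewrite divr_gt0 // mulr_gt0.
  have sv : 2 * s * nm h < r.
    have -> : 2 * s * nm h = r / 2 by rewrite /s; field; rewrite gt_eqF.
    by rewrite ltr_pdivrMr // mulr_natr mulr2n ltrDl.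
  have s2 : nm (1 : K) <= s / 2.
    by rewrite nm1 /s invfM !mulrA ler_pdivlMr // mul1r ler_pdivlMr //; move: h8; lra.
  have := cauchy_expansion s0 (dir_diff sv) (dir_bound sv) s2 1.
  rewrite big_ord1 dir_cco0 // expr0 mulr1 scale1r nm1 expr1 => /le_trans -> //.
  by rewrite le_eqVlt; apply/orP; left; apply/eqP; rewrite /s; field; rewrite !gt_eqF.
apply: (@le_trans _ _ (2 * B)).
  apply: le_trans (nm_triB _ _) _; rewrite mulr_natl mulr2n lerD // fB //.
    by rewrite addrAC subrr add0r.
  by rewrite subrr nm0.
have -> : 16 * B * nm h / r = (2 * B) * (nm h / (r / 8)) by field; rewrite gt_eqF.
by rewrite ler_peMr ?mulr_ge0 // ler_pdivlMr ?divr_gt0 // mul1r ltW.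
Qed.

Lemma holo_remainder h : nm h <= r / 8 ->
  nm (f (p + h) - f p - 'd f p h) <= 64 * B / r ^+ 2 * nm h ^+ 2.
Proof.
move=> h8; have [->|h0] := eqVneq h 0.
  by rewrite addr0 subrr linear0 subrr !nm0 expr0n mulr0.
have nh := nm_gt0 h0.
pose s := r / (4 * nm h).
have s0 : 0 < s by rewrite divr_gt0 // mulr_gt0.
have sv : 2 * s * nm h < r.
  have -> : 2 * s * nm h = r / 2 by rewrite /s; field; rewrite gt_eqF.
  by rewrite ltr_pdivrMr // mulr_natr mulr2n ltrDl.
have s2 : nm (1 : K) <= s / 2.
  by rewrite nm1 /s invfM !mulrA ler_pdivlMr // mul1r ler_pdivlMr //; move: h8; lra.
have := cauchy_expansion s0 (dir_diff sv) (dir_bound sv) s2 2.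
rewrite big_ord_recr big_ord1 /= dir_cco0 // dir_cco1 // expr0 expr1 !mulr1 scale1r nm1.
rewrite opprD addrA => /le_trans -> //.
by rewrite le_eqVlt; apply/orP; left; apply/eqP; rewrite /s; field; rewrite !gt_eqF.
Qed.

(** The linear parts cancel in the quasi-affine combination and leave three second order
    remainders. *)
Lemma holo_quasi_affine : quasi_affine f p (r / 8) B (64 * B / r ^+ 2).
Proof.
split=> [h hr|h k a b hr kr hkr].
  apply: fB; rewrite addrAC subrr add0r; apply: lt_trans hr _.
  by rewrite ltr_pdivrMr // ltr_pMr // ltr1n.
have E : f (p + (a *: h + b *: k)) - f p - a * (f (p + h) - f p) - b * (f (p + k) - f p) =
  (f (p + (a *: h + b *: k)) - f p - 'd f p (a *: h + b *: k)) 
  - a * (f (p + h) - f p - 'd f p h) - b * (f (p + k) - f p - 'd f p k).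
  by rewrite linearD !diffZv; ring.
rewrite E; set C := 64 * B / r ^+ 2.
apply: le_trans (nm_triB _ _) _; rewrite nmM.
apply: le_trans (lerD (nm_triB _ _) (lexx _)) _; rewrite nmM !mulrDr.
have a0 := nm_ge0 a; have b0 := nm_ge0 b.
apply: lerD; first apply: lerD.
- exact: holo_remainder (ltW hkr).
- by rewrite mulrCA ler_wpM2l // holo_remainder // ltW.
- by rewrite mulrCA ler_wpM2l // holo_remainder // ltW.
Qed.

Lemma holo_diff_bound v : nm ('d f p v) <= 8 * B * nm v / r.
Proof.
have [->|v0] := eqVneq v 0; first by rewrite linear0 !nm0 mulr0 mul0r.
have nv := nm_gt0 v0; pose s := r / (4 * nm v).
have s0 : 0 < s by rewrite divr_gt0 // mulr_gt0.
have sv : 2 * s * nm v < r.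
  have -> : 2 * s * nm v = r / 2 by rewrite /s; field; rewrite gt_eqF.
  by rewrite ltr_pdivrMr // mulr_natr mulr2n ltrDl.
have := cco_bound s0 (dir_diff sv) (dir_bound sv) 1; rewrite dir_cco1 // expr1.
by move=> /le_trans -> //; rewrite le_eqVlt; apply/orP; left; apply/eqP; rewrite /s; field; rewrite !gt_eqF.
Qed.
End Bounded.

(** Pointwise convergence under a common bound is enough: the quasi-affine constants depend only on
    [r] and [B], and the inequalities pass to pointwise limits. *)
Lemma holo_lim (V : normedModType K) (u : nat -> V -> K) (f : V -> K) (p : V) (r B : R) :
  0 < r -> (forall n q, nm (q - p) < r -> differentiable (u n) q) ->
  (forall n q, nm (q - p) < r -> nm (u n q) <= B) ->
  (forall q, nm (q - p) < r -> tends (u ^~ q) (f q)) -> differentiable f p.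
Proof.
move=> r0 du uB uf; have r8 : 0 < r / 8 by rewrite divr_gt0.
have r8r : r / 8 < r by rewrite ltr_pdivrMr // ltr_pMr // ltr1n.
have B0 : 0 <= B by apply: le_trans (uB 0%N p _); rewrite ?nm_ge0 // subrr nm0.
have C0 : 0 <= 64 * B / r ^+ 2 by rewrite divr_ge0 ?mulr_ge0 ?exprn_ge0 // ltW.
have H n := holo_quasi_affine r0 (du n) (uB n).
apply: (proj1 (quasi_affine_diff r8 B0 C0 (quasi_affine_lim H _ r8))).
by move=> h hr; apply: uf; rewrite addrAC subrr add0r; exact: lt_trans r8r.
Qed.

Lemma diff_loc_bounded (V : normedModType K) (f : V -> K) p : differentiable f p ->
  exists r : R, 0 < r /\ forall q, nm (q - p) < r -> nm (f q) <= nm (f p) + 1.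
Proof.
move=> /differentiable_continuous/continuous_nmP/(_ _ ltr01)[r r0 hr].
exists r; split=> // q /hr h; rewrite -[f q](subrK (f p)) addrC.
by apply: le_trans (nmD _ _) _; rewrite lerD2l ltW.
Qed.

(** The derivative is the limit of the difference quotients at dyadic steps, which are holomorphic
    and uniformly bounded by [holo_lipschitz]; [holo_lim] then applies. *)
Lemma holo_derive_near (V : normedModType K) (f : V -> K) p (v : V) (r B : R) : 0 < r ->
  (forall q, nm (q - p) < r -> differentiable f q) ->
  (forall q, nm (q - p) < r -> nm (f q) <= B) ->
  differentiable (fun q => 'D_v f q) p.
Proof.
move=> r0 df fB; have r2 : 0 < r / 2 by rewrite divr_gt0.
(* The steps are kept below r / 16, an eighth of the radius r / 2, as [holo_remainder] demands. *)
have [N HN] := pow2_small (nm v) (divr_gt0 r0 (@ltr0Sn R 15)).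
pose h n : V := (2 ^+ (N + n) : K)^-1 *: v.
have hE n : nm (h n) = nm v * (2 ^+ (N + n))^-1.
  by rewrite nmZ nmV nmX nm_nat mulrC.
have h16 n : nm (h n) <= r / 16 by rewrite hE HN // leq_addr.
have h2 n : nm (h n) < r / 2 by apply: le_lt_trans (h16 n) _; move: r0; lra.
have half q q' : nm (q - p) < r / 2 -> nm (q' - q) < r / 2 -> nm (q' - p) < r.
  by move=> a b; apply: le_lt_trans (nm_tri q _ _) _; move: a b; lra.
have dq q : nm (q - p) < r / 2 -> forall q', nm (q' - q) < r / 2 -> differentiable f q'.
  by move=> a q' b; apply: df; exact: half b.
have bq q : nm (q - p) < r / 2 -> forall q', nm (q' - q) < r / 2 -> nm (f q') <= B.
  by move=> a q' b; apply: fB; exact: half b.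
have B0 : 0 <= B by apply: le_trans (fB p _); rewrite ?nm_ge0 // subrr nm0.
have P0 n : 0 < (2 ^+ n : R) by rewrite exprn_gt0.
apply: (@holo_lim _ (fun n q => 2 ^+ (N + n) * (f (q + h n) - f q)) _ _ (r / 2) (32 * B * nm v / r)); first exact: r2.
- move=> n q qr; apply: dfM; first exact: dfC.
  apply: dfB; last by apply: (dq _ qr); rewrite subrr nm0.
  have da : differentiable (fun q : V => q + h n) q by exact: ex_diff.
  apply: (differentiable_comp da); apply: (dq _ qr).
  by rewrite addrAC subrr add0r.
- move=> n q qr; rewrite nmM nmX nm_nat.
  apply: (@le_trans _ _ (2 ^+ (N + n) * (16 * B * nm (h n) / (r / 2)))).
    by rewrite ler_pM2l //; apply: (holo_lipschitz r2 (dq _ qr) (bq _ qr)).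
  by rewrite hE le_eqVlt; apply/orP; left; apply/eqP; field; rewrite !gt_eqF.
- move=> q qr; rewrite deriveE; last by apply: (dq _ qr); rewrite subrr nm0.
  move=> e e0; pose C := 64 * B / (r / 2) ^+ 2 * nm v ^+ 2.
  have [M HM] := pow2_small C e0; exists M => n Mn.
  apply: le_trans (HM _ (leq_trans Mn (leq_addl N n))).
  have -> : 2 ^+ (N + n) * (f (q + h n) - f q) - 'd f q v =
            2 ^+ (N + n) * (f (q + h n) - f q - 'd f q (h n)).
    by rewrite /h diffZv [RHS]mulrBr mulrA divff ?mul1r // expf_neq0.
  rewrite nmM nmX nm_nat.
  apply: (@le_trans _ _ (2 ^+ (N + n) * (64 * B / (r / 2) ^+ 2 * nm (h n) ^+ 2))).
    rewrite ler_pM2l //; apply: (holo_remainder r2 (dq _ qr) (bq _ qr)).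
    by apply: le_trans (h16 n) _; move: r0; lra.
  rewrite hE /C le_eqVlt; apply/orP; left; apply/eqP.
  by field; rewrite !gt_eqF.
Qed.

Lemma holo_derive (V : normedModType K) (D : set V) (f : V -> K) (v : V) :
  open D -> holomorphic D f -> holomorphic D (fun q => 'D_v f q).
Proof.
move=> oD df p Dp; have [r1 [r10 fb]] := diff_loc_bounded (df p Dp).
have /nbhs_nmP[r2 r20 hD] : nbhs p D by exact: open_nbhs_nbhs.
apply: (@holo_derive_near _ _ _ _ (Num.min r1 r2) (nm (f p) + 1)).
- by rewrite lt_min r10.
- by move=> q; rewrite lt_min => /andP[_ /hD /df].
- by move=> q; rewrite lt_min => /andP[/fb].
Qed.

End Lines.

Lemma diff_prod_invX (K : numFieldType) (g : K -> K) n (z : K) : z != 0 -> differentiable g z ->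
  'd (fun x => g x * x^-1 ^+ n.+1) z 1 =
  'D_1 g z * z^-1 ^+ n.+1 + - n.+1%:R * (g z * z^-1 ^+ n.+2) :> K.
Proof.
move=> /(dinvX_numField n)[d1 d2] dg.
by rewrite (dprod_numField dg d1) d2 deriveE //; ring.
Qed.

(** * Iterated derivatives and asymptotic expansions *)

Section Iterated.
Context {R : realType}.
Notation K := R[i].

Lemma open_ball_nm (V : normedModType K) (p : V) (r : R) : open [set q | nm (q - p) < r].
Proof.
rewrite openE => q /= qr; apply/nbhs_nmP; exists (r - nm (q - p)); first by rewrite subr_gt0.
by move=> y yq /=; apply: le_lt_trans (nm_tri q _ _) _; rewrite -ltrBrDr.
Qed.

(** Integration by parts: the function g z^-(n+1) is a primitive, near the square, of the sum of the
    two integrands. *)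
Lemma cco_derive (s r : R) (g : K -> K) n : 0 < s -> 2 * s < r ->
  (forall z, nm z < r -> differentiable g z) ->
  cco s (fun z => 'D_1 g z) n = n.+1%:R * cco s g n.+1.
Proof.
move=> s0 sr dg.
have ss : - s <= s by rewrite ge0_cp // ltW.
have dg' z : nm z < r -> differentiable (fun z => 'D_1 g z) z.
  move=> zr; apply: (@holo_derive _ _ [set z : K | nm z < r] g 1) => //.
  by have := @open_ball_nm K 0 r; under eq_set do rewrite subr0.
have bd z : sqb s z -> nm z < r by move=> /(sqb_le) h; apply: le_lt_trans sr.
have dX k z : sqb s z -> differentiable (fun z : K => z^-1 ^+ k.+1) z.
  by move=> /(sqb_neq0 s0) z0; have [] := dinvX k z0.
have c1 : bcont (- s) s (- s) s (fun z => 'D_1 g z * z^-1 ^+ n.+1).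
  move=> z zb; apply: (@differentiable_continuous _ K K); apply: dfM; [exact: dg' (bd _ zb)|exact: dX].
have c2 : bcont (- s) s (- s) s (fun z => g z * z^-1 ^+ n.+2).
  move=> z zb; apply: (@differentiable_continuous _ K K); apply: dfM; [exact: dg (bd _ zb)|exact: dX].
have c3 : bcont (- s) s (- s) s (fun z => - n.+1%:R * (g z * z^-1 ^+ n.+2)).
  move=> z zb; apply: (@differentiable_continuous _ K K); apply: dfM; first exact: dfC.
  apply: dfM; [exact: dg (bd _ zb)|exact: dX].
rewrite /cco mulrCA; congr (_ * _); apply/eqP; rewrite -subr_eq0 -mulNr; apply/eqP.
rewrite /sq -(rintZ ss ss _ c2) -(rintD ss ss c1 c3).
apply: (rint_primitive ss ss (F := fun z => g z * z^-1 ^+ n.+1)).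
  move=> z zb; apply: (@differentiable_continuous _ K K); apply: dfD.
    apply: dfM; [exact: dg' (bd _ zb)|exact: dX].
  apply: dfM; first exact: dfC.
  by apply: dfM; [exact: dg (bd _ zb)|exact: dX].
move=> z zb; have z0 := sqb_neq0 s0 zb.
have [d1 _] := dinvX n z0; have dgz := dg _ (bd _ zb).
have -> : 'D_1 g z * z^-1 ^+ n.+1 + - n.+1%:R * (g z * z^-1 ^+ n.+2) =
   'd (fun x => g x * x^-1 ^+ n.+1) z 1.
  by apply/esym; exact: diff_prod_invX.
by apply: differentiable_cder; exact: dfM.
Qed.

Definition nderive (V W : normedModType K) (v : V) n (f : V -> W) : V -> W :=
  iter n (fun h => 'D_v h) f.

(** The two difference quotients are literally the same function of [h]; the identity holds whether
    or not the limits exist. *)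
Lemma derive_affine (V V' W : normedModType K) (io : V' -> V) (v' : V') (v : V) (g : V -> W) z :
  (forall h, io (h *: v' + z) = h *: v + io z) ->
  'D_v' (fun z => g (io z)) z = 'D_v g (io z).
Proof.
move=> H; rewrite /derive.
set F := (X in X @ _); set G := (X in _ = lim (X @ _)).
suff -> : F = G by [].
by apply/funext => h; rewrite /F /G /= H.
Qed.

Lemma nderive_affine (V V' W : normedModType K) (io : V' -> V) (v' : V') (v : V) (g : V -> W) n :
  (forall h z, io (h *: v' + z) = h *: v + io z) ->
  nderive v' n (fun z => g (io z)) = fun z => nderive v n g (io z).
Proof.
move=> H; elim: n => // n IH; rewrite /nderive iterS -/(nderive _ _ _) IH.
by apply/funext => z; apply: derive_affine.
Qed.

Lemma nderive_holo (V : normedModType K) (D : set V) (v : V) n (f : V -> K) :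
  open D -> holomorphic D f -> holomorphic D (nderive v n f).
Proof. by move=> oD hf; elim: n => //= n IH; exact: holo_derive. Qed.


Lemma cco_nderive (s r : R) (g : K -> K) n B : 0 < s -> 2 * s < r ->
  (forall z, nm z < r -> differentiable g z) ->
  (forall z, nm z < r -> nm (g z) <= B) ->
  n`!%:R * cco s g n = nderive (1 : K) n g 0.
Proof.
move=> s0; elim: n r g B => [|n IH] r g B sr dg gB.
  rewrite mul1r; apply: (cco0 (B := B)) => // z zs; [apply: dg|apply: gB]; exact: le_lt_trans sr.
have oD : open [set z : K | nm z < r].
  by have := @open_ball_nm K 0 r; under eq_set do rewrite subr0.
have r0 : 0 < r by apply: lt_trans sr; rewrite mulr_gt0.
(* The derivative is bounded only at a distance from the boundary, so the induction passes to the
   midpoint of 2 s and r, where Cauchy's estimate on balls of radius (r - 2 s) / 2 gives the new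
   bound. *)
rewrite /nderive iterSr -/(nderive _ _ _) -(IH ((2 * s + r) / 2) _ (8 * B / ((r - 2 * s) / 2))).
- by rewrite (cco_derive _ s0 sr dg) factS natrM; ring.
- by rewrite ltr_pdivlMr // mulr_natr mulr2n ltrD2l.
- move=> z zr; apply: (@holo_derive _ _ [set z : K | nm z < r] g 1) => //=.
  by apply: lt_trans zr _; rewrite ltr_pdivrMr // mulr_natr mulr2n ltrD2r.
- move=> z zr.
  have rz q : nm (q - z) < (r - 2 * s) / 2 -> nm q < r.
    move=> qz; have := nm_tri z q 0; rewrite !subr0; move: qz zr; lra.
  have rs : 0 < (r - 2 * s) / 2 by rewrite divr_gt0 // subr_gt0.
  have dgz : differentiable g z by apply: dg; apply: (rz z); rewrite subrr nm0.
  rewrite deriveE //; have := holo_diff_bound rs (fun q h => dg q (rz q h)) (fun q h => gB q (rz q h)) 1.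
  by rewrite nm1 mulr1.
Qed.

Lemma nderive_expansion (V : normedModType K) (f : V -> K) (p v : V) (r B s : R) :
  0 < s -> 2 * s < r -> nm v <= 1 ->
  (forall q, nm (q - p) < r -> differentiable f q) ->
  (forall q, nm (q - p) < r -> nm (f q) <= B) ->
  (forall n, nm (nderive v n f p) <= n`!%:R * (2 * B / s ^+ n)) /\
  forall m (t : K), nm t <= s / 2 ->
    nm (f (p + t *: v) - \sum_(n < m) (n`!%:R^-1 * nderive v n f p) * t ^+ n) <=
    4 * B * (nm t / s) ^+ m.
Proof.
move=> s0 sr v1 df fB.
have r0 : 0 < r by apply: lt_trans sr; rewrite mulr_gt0.
pose g (t : K) := f (p + t *: v).
have small (t : K) : nm t < r -> nm (p + t *: v - p) < r.
  move=> tr; rewrite addrAC subrr add0r nmZ; apply: le_lt_trans tr.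
  by rewrite ler_piMr ?nm_ge0.
have dg t : nm t < r -> differentiable g t.
  by move=> /small/df; exact: differentiable_line.
have gB t : nm t < r -> nm (g t) <= B by move=> /small/fB.
have E n : n`!%:R * cco s g n = nderive v n f p.
  rewrite (cco_nderive _ s0 sr dg gB) /g.
  rewrite (@nderive_affine V K K (fun t : K => p + t *: v) 1 v f n) ?scale0r ?addr0 //.
  by move=> h z; rewrite [h *: 1]mulr1 scalerDl addrCA.
have f0 n : (n`!%:R : K) != 0 by rewrite pnatr_eq0 -lt0n fact_gt0.
have dg2 t : nm t <= 2 * s -> differentiable g t by move=> ts; apply: dg; exact: le_lt_trans sr.
have gB2 t : nm t <= 2 * s -> nm (g t) <= B by move=> ts; apply: gB; exact: le_lt_trans sr.
split=> [n|m t ts].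
  rewrite -E nmM nm_nat ler_wpM2l //; exact: cco_bound dg2 gB2 n.
under eq_bigr => n _ do rewrite -E mulKf //.
exact: cauchy_expansion dg2 gB2 _ ts m.
Qed.

(** An expansion at 0 that mentions neither derivatives nor convergence. It determines the
    coefficients of index below [m] ([asym_unique]) and is stable under sums and convolutions, where
    Taylor coefficients would require derivatives of integrals. *)
Definition asym (g : K -> K) (c : nat -> K) m := exists C d : R, [/\ 0 <= C, 0 < d &
  forall z, nm z < d -> nm (g z - \sum_(n < m) c n * z ^+ n) <= C * nm z ^+ m].

Lemma asym_unique g c c' m : asym g c m -> asym g c' m -> forall k, (k < m)%N -> c k = c' k.
Proof.
move=> [C [d [C0 d0 H]]] [C' [d' [C0' d0' H']]].
pose a n := c n - c' n.
pose e := Num.min 1 (Num.min d d').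
have e0 : 0 < e by rewrite !lt_min ltr01 d0.
have Ha (z : K) : nm z < e -> nm (\sum_(n < m) a n * z ^+ n) <= (C + C') * nm z ^+ m.
  rewrite !lt_min => /andP[_ /andP[zd zd']].
  have -> : \sum_(n < m) a n * z ^+ n = (g z - \sum_(n < m) c' n * z ^+ n) - (g z - \sum_(n < m) c n * z ^+ n).
    rewrite /a; under eq_bigr do rewrite mulrBl.
    by rewrite sumrB; move: (\sum_(i < m) _) (\sum_(i < m) _) => x y; ring.
  by apply: le_trans (nm_triB _ _) _; rewrite mulrDl addrC lerD ?H ?H'.
suff A k : (k <= m)%N -> forall i, (i < k)%N -> a i = 0.
  by move=> k km; apply/eqP; rewrite -subr_eq0; apply/eqP; exact: A km.
elim: k => // k IH km i; rewrite ltnS leq_eqVlt => /predU1P[->|]; last by apply: IH; exact: ltnW.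
have {}IH := IH (ltnW km).
apply: nm_eps0 => eps eps0.
pose M := \sum_(n < m) nm (a n).
have M0 : 0 <= M by apply: sumr_ge0 => j _; exact: nm_ge0.
have T0 : 0 < C + C' + M + 1 by rewrite ltr_wpDl // !addr_ge0.
pose t := Num.min (e / 2) (eps / (C + C' + M + 1)).
have t0 : 0 < t by rewrite lt_min !divr_gt0.
have te : t < e by rewrite gt_min; apply/orP; left; move: e0; lra.
have t1 : t <= 1 by apply: ltW; apply: lt_le_trans te _; rewrite ge_min lexx.
have nt : nm (t%:C : K) = t by rewrite nmR ger0_norm // ltW.
have := Ha t%:C; rewrite nt => /(_ te) h.
have tk : 0 < t ^+ k by rewrite exprn_gt0.
have key : nm (a k) * t ^+ k <= (C + C') * t ^+ m + M * t ^+ k.+1.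
  have -> : nm (a k) * t ^+ k = nm (a k * t%:C ^+ k) by rewrite nmM nmX nt.
  have -> : a k * t%:C ^+ k = \sum_(n < m) a n * t%:C ^+ n - \sum_(n < m | (n != Ordinal km) && (k < n)%N) a n * t%:C ^+ n.
    rewrite (bigD1 (Ordinal km)) //= [X in _ = _ + X - _](bigID (fun n : 'I_m => (k < n)%N)) /=.
    rewrite [X in _ = _ + (_ + X) - _]big1 ?addr0 ?addrK // => n /andP[nk].
    rewrite -leqNgt leq_eqVlt => /predU1P[nE|nk']; last by rewrite IH // mul0r.
    by case/eqP: nk; apply/val_inj.
  apply: le_trans (nm_triB _ _) _; apply: lerD => //.
  apply: le_trans (nm_sum _ _ _) _.
  rewrite /M mulr_suml big_mkcond /=; apply: ler_sum => n _.
  case: ifP => [/andP[_ kn]|_]; last by rewrite mulr_ge0 ?nm_ge0 // exprn_ge0 // ltW.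
  rewrite nmM nmX nt ler_wpM2l ?nm_ge0 //; by apply: ler_wiXn2l => //; exact: ltW.
have : nm (a k) * t ^+ k <= (C + C' + M) * t * t ^+ k.
  apply: le_trans key _; rewrite -mulrA -exprS [leRHS]mulrDl lerD2r ler_wpM2l ?addr_ge0 //.
  by apply: ler_wiXn2l => //; exact: ltW.
rewrite ler_pM2r // => /le_trans -> //.
apply: (@le_trans _ _ ((C + C' + M + 1) * t)); first by rewrite ler_wpM2r ?lerDl // ltW.
have : t <= eps / (C + C' + M + 1) by rewrite ge_min lexx orbT.
by rewrite ler_pdivlMr // mulrC.
Qed.

End Iterated.

Section RowsNumField.
Variables (K : numFieldType) (V : normedModType K) (n : nat).
Implicit Types (G : V -> 'rV[K]_n) (q v : V).

Lemma differentiable_rV_num G q :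
  (forall i, differentiable (fun q => G q 0 i) q) -> differentiable G q.
Proof.
move=> dG; have -> : G = \sum_(i < n) (fun q => G q 0 i *: (delta_mx 0 i : 'rV[K]_n)).
  by apply/funext => x; rewrite fct_sumE [LHS]row_sum_delta.
by apply: differentiable_sum => i; apply: differentiableZl.
Qed.

Lemma derive_coord_num G q v i : differentiable G q ->
  'D_v (fun q => G q 0 i) q = 'D_v G q 0 i.
Proof.
move=> dG.
have lin : linear (fun M : 'rV[K]_n => M 0 i : K^o) by move=> a u w; rewrite !mxE.
pose L : {linear 'rV[K]_n -> K^o} := HB.pack (fun M : 'rV[K]_n => M 0 i : K^o) (GRing.isLinear.Build _ _ _ _ _ lin).
have Lc : continuous L by move=> M; exact: coord_continuous.
have dc : differentiable L (G q) by exact: linear_differentiable.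
rewrite (deriveE _ dG) deriveE; last exact: (differentiable_comp dG dc).
by rewrite (diff_comp dG dc) /= (diff_lin _ Lc).
Qed.

Lemma derive_lincomb_num (f1 f2 : V -> K) (c : K) q v : differentiable f1 q -> differentiable f2 q ->
  'D_v (fun q => f1 q + c * f2 q) q = 'D_v f1 q + c * 'D_v f2 q.
Proof.
move=> d1 d2; have d3 : differentiable (c *: f2) q by exact: differentiableZ.
rewrite [LHS](deriveE _ (differentiableD d1 d3)) (diffD d1 d3) (diffZ _ d2) !deriveE //.
Qed.
End RowsNumField.

Section Multi.
Context {R : realType}.
Notation K := R[i].

Lemma differentiable_rV (V : normedModType K) n (G : V -> 'rV[K]_n) q :
  (forall i, differentiable (fun q => G q 0 i) q) -> differentiable G q.
Proof. exact: differentiable_rV_num. Qed.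

Lemma derive_coord (V : normedModType K) n (G : V -> 'rV[K]_n) q v i : differentiable G q ->
  'D_v (fun q => G q 0 i) q = 'D_v G q 0 i.
Proof. exact: derive_coord_num. Qed.

Lemma derive_eq_on (V W : normedModType K) (D : set V) (f g : V -> W) v :
  open D -> (forall q, D q -> f q = g q) -> forall q, D q -> 'D_v f q = 'D_v g q.
Proof.
move=> oD fg q Dq; apply: near_eq_derive.
by apply: filterS (open_nbhs_nbhs (conj oD Dq)) => x /fg.
Qed.

Lemma differentiable_eq_on (V W : normedModType K) (D : set V) (f g : V -> W) :
  open D -> (forall q, D q -> f q = g q) ->
  forall q, D q -> differentiable f q -> differentiable g q.
Proof.
move=> oD fg q Dq df; have /nbhs_nmP[r r0 hr] : nbhs q D by exact: open_nbhs_nbhs.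
apply: (proj1 (nm_differentiable (L := 'd f q) (diff_continuous df) _)) => e e0.
have [d d0 hd] := differentiable_nm df e0.
exists (Num.min d r); first by rewrite lt_min d0.
move=> h; rewrite lt_min => /andP[/hd h1 h2].
by rewrite -!fg //; apply: hr; rewrite addrAC subrr add0r.
Qed.

Lemma derive_lincomb (V : normedModType K) (f1 f2 : V -> K) (c : K) q v :
  differentiable f1 q -> differentiable f2 q ->
  'D_v (fun q => f1 q + c * f2 q) q = 'D_v f1 q + c * 'D_v f2 q.
Proof. exact: derive_lincomb_num. Qed.

Section Mder.
Variables (N : nat).
Implicit Types (alpha : 'I_N -> nat).

(** The list of directions is an argument so that proofs can proceed by induction on it, and the
    vectors [e j] are arbitrary so that derivatives in [z] can be taken on a product space. At
    [enum 'I_N] and the unit vectors this is [partial] by conversion. *)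
Definition mder_seq (V W : normedModType K) (e : 'I_N -> V) alpha (g : V -> W) (l : seq 'I_N) : V -> W :=
  foldr (fun j => nderive (e j) (alpha j)) g l.

Definition mder (V W : normedModType K) (e : 'I_N -> V) alpha (g : V -> W) : V -> W :=
  mder_seq e alpha g (enum 'I_N).

Lemma partialE (W : normedModType K) alpha (g : 'rV[K]_N -> W) :
  partial alpha g = mder (fun j => delta_mx 0 j) alpha g.
Proof. by []. Qed.

Lemma mder_seq_holo (V : normedModType K) (D : set V) (e : 'I_N -> V) alpha (g : V -> K) l :
  open D -> holomorphic D g -> holomorphic D (mder_seq e alpha g l).
Proof. by move=> oD hg; elim: l => //= j l IH; exact: nderive_holo. Qed.

Lemma mder_holo (V : normedModType K) (D : set V) (e : 'I_N -> V) alpha (g : V -> K) :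
  open D -> holomorphic D g -> holomorphic D (mder e alpha g).
Proof. exact: mder_seq_holo. Qed.

(** Turns derivatives in [z] at a frozen parameter into directional derivatives on the product
    space, where joint holomorphy is available. *)
Lemma mder_affine (V V' W : normedModType K) (io : V' -> V) (e' : 'I_N -> V') (e : 'I_N -> V)
  alpha (g : V -> W) :
  (forall j h z, io (h *: e' j + z) = h *: e j + io z) ->
  mder e' alpha (fun z => g (io z)) = fun z => mder e alpha g (io z).
Proof.
move=> H; rewrite /mder; elim: (enum _) => //= j l ->.
by apply: nderive_affine => h z; exact: H.
Qed.

Lemma mder_linear (V : normedModType K) (D : set V) (e : 'I_N -> V) alpha (f f1 f2 : V -> K) (c : K) :
  open D -> holomorphic D f1 -> holomorphic D f2 ->
  (forall q, D q -> f q = f1 q + c * f2 q) ->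
  forall q, D q -> mder e alpha f q = mder e alpha f1 q + c * mder e alpha f2 q.
Proof.
move=> oD; rewrite /mder; elim: (enum _) => [//|j l IH] h1 h2 H /=.
have := IH h1 h2 H; have := mder_seq_holo e alpha l oD h1; have := mder_seq_holo e alpha l oD h2.
move: (mder_seq e alpha f l) (mder_seq e alpha f1 l) (mder_seq e alpha f2 l) => g g1 g2 k2 k1 E.
elim: (alpha j) => //= k IHk q Dq.
have d1 := nderive_holo (e j) k oD k1 Dq; have d2 := nderive_holo (e j) k oD k2 Dq.
rewrite (derive_eq_on (e j) oD IHk Dq).
exact: derive_lincomb.
Qed.

Lemma mder_seq_coord (V : normedModType K) (D : set V) (e : 'I_N -> V) alpha n
  (G : V -> 'rV[K]_n) (g : 'I_n -> V -> K) l : open D ->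
  (forall i, holomorphic D (g i)) -> (forall q i, D q -> G q 0 i = g i q) ->
  forall q i, D q -> mder_seq e alpha G l q 0 i = mder_seq e alpha (g i) l q.
Proof.
move=> oD hg; elim: l => [//|j l IH] H /=.
have := IH H; have := fun i => mder_seq_holo e alpha l oD (hg i).
move: (mder_seq e alpha G l) => F1.
set f := fun i => mder_seq e alpha (g i) l => hf E.
suff : forall k q i, D q -> nderive (e j) k F1 q 0 i = nderive (e j) k (f i) q.
  by move=> A q i Dq; rewrite A.
elim=> [|k IHk] q i Dq; first exact: E.
have dk i' x : D x -> differentiable (fun q => nderive (e j) k F1 q 0 i') x.
  move=> Dx; apply: (differentiable_eq_on oD _ Dx) (nderive_holo (e j) k oD (hf i') Dx).
  by move=> y Dy; rewrite IHk.
rewrite /nderive !iterS -/(nderive _ _ _) -/(nderive _ _ _) -derive_coord.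
  by apply: (derive_eq_on _ oD) => // y Dy; exact: IHk.
by apply: differentiable_rV => i'; exact: dk.
Qed.

Lemma mder_coord (V : normedModType K) (D : set V) (e : 'I_N -> V) alpha n
  (G : V -> 'rV[K]_n) : open D -> (forall i, holomorphic D (fun q => G q 0 i)) ->
  forall q i, D q -> mder e alpha G q 0 i = mder e alpha (fun q => G q 0 i) q.
Proof.
by move=> oD hG q i Dq; exact: (@mder_seq_coord V D e alpha n G (fun i q => G q 0 i) (enum 'I_N) oD).
Qed.

(** One Cauchy estimate per direction: each costs 4 s of the radius, a factor 2, and a factor
    s^-(alpha j). *)
Lemma mder_seq_bound (V : normedModType K) (p : V) (e : 'I_N -> V) alpha (g : V -> K) l (r B s : R) :
  (forall j, nm (e j) <= 1) -> 0 < s -> 0 <= B ->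
  (forall q, nm (q - p) < r -> differentiable g q) ->
  (forall q, nm (q - p) < r -> nm (g q) <= B) ->
  forall q, nm (q - p) < r - 4 * s * (size l)%:R ->
  nm (mder_seq e alpha g l q) <= (\prod_(j <- l) (alpha j)`!)%N%:R * (2 ^+ size l * B / s ^+ (\sum_(j <- l) alpha j)).
Proof.
move=> e1 s0 B0 dg gB; elim: l => [|j l IH] q /=.
  by rewrite big_nil expr0 mulr0 subr0 !mul1r big_nil expr0 divr1; exact: gB.
rewrite -[(size l).+1%:R]natr1 mulrDr mulr1 opprD addrA => qr.
have sub x : nm (x - q) < 4 * s -> nm (x - p) < r - 4 * s * (size l)%:R.
  by move=> xq; apply: le_lt_trans (nm_tri q _ _) _; move: xq qr; lra.
have s4 : 2 * s < 4 * s by move: s0; lra.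
have dl x : nm (x - q) < 4 * s -> differentiable (mder_seq e alpha g l) x.
  move=> /sub xp; have sl : 0 <= 4 * s * (size l)%:R by rewrite mulr_ge0 // mulr_ge0 // ltW.
  apply: (mder_seq_holo _ _ _ (@open_ball_nm _ _ p r) (g := g)) => //=.
  by apply: lt_le_trans xp _; rewrite gerBl.
have [h _] := nderive_expansion s0 s4 (e1 j) dl (fun x xq => IH x (sub x xq)).
apply: le_trans (h (alpha j)) _.
rewrite !big_cons natrM exprD exprS le_eqVlt; apply/orP; left; apply/eqP.
by field; rewrite !expf_neq0 // gt_eqF.
Qed.

Lemma mder_bound (V : normedModType K) (p : V) (e : 'I_N -> V) alpha (g : V -> K) (r B : R) :
  (forall j, nm (e j) <= 1) -> 0 < r -> 0 <= B ->
  (forall q, nm (q - p) < r -> differentiable g q) ->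
  (forall q, nm (q - p) < r -> nm (g q) <= B) ->
  forall q, nm (q - p) < r / 2 ->
  nm (mder e alpha g q) <=
    (\prod_(j < N) (alpha j)`!)%N%:R * (2 ^+ N * B / (r / (8 * N.+1%:R)) ^+ (\sum_(j < N) alpha j)).
Proof.
(* This value of [s] makes the N losses of 4 s amount to less than r / 2. *)
move=> e1 r0 B0 dg gB q qr; have s0 : 0 < r / (8 * N.+1%:R) by rewrite divr_gt0 // mulr_gt0.
have := mder_seq_bound alpha (l := enum 'I_N) e1 s0 B0 dg gB.
rewrite -/(mder e alpha g) size_enum_ord !big_enum /= => H; apply: H.
apply: lt_le_trans qr _.
have -> : 4 * (r / (8 * N.+1%:R)) * N%:R = r / 2 * (N%:R / N.+1%:R) by field; rewrite addrC natr1 pnatr_eq0.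
rewrite lerBrDr -lerBrDl.
have -> : r - r / 2 = r / 2 by field.
by rewrite ler_piMr ?divr_ge0 // ?ltW // ltr_pdivrMr // mul1r ltr_nat.
Qed.
End Mder.
End Multi.

(** * Convolution *)

Section ConvBasics.
Context {R : realType}.
Notation K := R[i].
Notation mu := (@lebesgue_measure R).

Lemma cint0 (a b : R) : cint a b (fun=> 0 : K) = 0.
Proof. by rewrite /cint /= !Rintegral_cst // mul0r. Qed.

Lemma ccont_ext (a b : R) (f g : R -> K) : (forall t, f t = g t) -> ccont a b f -> ccont a b g.
Proof. by move=> /funext ->. Qed.

Lemma cint_beta i j : cint 0 1 (fun t : R => (t%:C ^+ i * (1 - t)%:C ^+ j : K)) =
  i`!%:R * j`!%:R / (i + j).+1`!%:R.
Proof.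
have E (t : R) : (t%:C ^+ i * (1 - t)%:C ^+ j : K) = (XMonemX i j t)%:C.
  by rewrite -!rmorphXn -rmorphM.
rewrite (cint_ext (g := fun t => (XMonemX i j t)%:C)); last by move=> t _; exact: E.
rewrite /cint /= Rintegral_cst // mul0r.
have -> : (\int[mu]_(t in `[0%R, 1%R]) XMonemX i j t)%R = (i`! * j`!)%:R / (i + j).+1`!%:R :> R.
  by rewrite -beta_fun_fact /beta_fun /= Rintegral_mkcond.
rewrite -[LHS]/((_ / _)%:C) rmorphM fmorphV !rmorph_nat natrM //.
Qed.

Lemma ccont_seg (f : K -> K) (a b : R) (z : K) :
  (forall t, 0 <= t <= 1 -> {for (a + b * t)%:C * z, continuous f}) ->
  ccont 0 1 (fun t => f ((a + b * t)%:C * z)).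
Proof.
move=> fc t t01 e e0; have /continuous_nmP/(_ e e0)[d d0 hd] := fc t t01.
pose M := `|b| * nm z + 1.
have M0 : 0 < M by rewrite ltr_wpDl // mulr_ge0 // nm_ge0.
exists (d / M); first by rewrite divr_gt0.
move=> s; rewrite ltr_pdivlMr // => st; apply: hd.
rewrite -mulrBl -rmorphB nmM nmR.
have -> : a + b * s - (a + b * t) = (s - t) * b by ring.
rewrite normrM; apply: le_lt_trans st.
by rewrite -mulrA ler_wpM2l // lerDl.
Qed.

Lemma ccont01 (f : K -> K) z : (forall t : R, 0 <= t <= 1 -> {for t%:C * z, continuous f}) ->
  ccont 0 1 (fun t => f (t%:C * z)) /\ ccont 0 1 (fun t => f ((1 - t)%:C * z)).
Proof.
move=> fc; split=> t t01 e e0.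
  have [|d d0 hd] := @ccont_seg f 0 1 z _ t t01 e e0.
    by move=> s s01; rewrite add0r mul1r; exact: fc.
  by exists d => // s /hd; rewrite !add0r !mul1r.
have [|d d0 hd] := @ccont_seg f 1 (-1) z _ t t01 e e0.
  move=> s /andP[s0 s1]; rewrite mulN1r; apply: fc; apply/andP; split; lra.
by exists d => // s /hd; rewrite !mulN1r.
Qed.

(** The integral of f (w) g (z - w) over the segment from 0 to [z], with w = t z; after this
    substitution the domain of integration no longer depends on [z]. *)
Definition bconv (f g : K -> K) (z : K) : K :=
  z * cint 0 1 (fun t => f (t%:C * z) * g ((1 - t)%:C * z)).

Definition cseg (f : K -> K) z := forall t : R, 0 <= t <= 1 -> {for t%:C * z, continuous f}.

Lemma cseg_ccont f g z : cseg f z -> cseg g z ->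
  ccont 0 1 (fun t => f (t%:C * z) * g ((1 - t)%:C * z)).
Proof. by move=> /ccont01[? _] /ccont01[_ ?]; exact: ccontM. Qed.

Lemma bconv_ext f f' g g' z : (forall t : R, 0 <= t <= 1 -> f (t%:C * z) = f' (t%:C * z)) ->
  (forall t : R, 0 <= t <= 1 -> g (t%:C * z) = g' (t%:C * z)) -> bconv f g z = bconv f' g' z.
Proof.
move=> ff gg; rewrite /bconv; congr (_ * _); apply: cint_ext => t t01; rewrite ff // gg //.
by move: t01 => /andP[? ?]; apply/andP; split; lra.
Qed.

Lemma bconvDl f f' g z : cseg f z -> cseg f' z -> cseg g z ->
  bconv (fun z => f z + f' z) g z = bconv f g z + bconv f' g z.
Proof.
move=> fc fc' gc; rewrite /bconv -mulrDr -cintD; try exact: cseg_ccont.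
by congr (_ * _); apply: cint_ext => t _; rewrite mulrDl.
Qed.

Lemma bconvDr f g g' z : cseg f z -> cseg g z -> cseg g' z ->
  bconv f (fun z => g z + g' z) z = bconv f g z + bconv f g' z.
Proof.
move=> fc fc' gc; rewrite /bconv -mulrDr -cintD; try exact: cseg_ccont.
by congr (_ * _); apply: cint_ext => t _; rewrite mulrDr.
Qed.

Lemma bconvZl f g c z : cseg f z -> cseg g z ->
  bconv (fun z => c * f z) g z = c * bconv f g z.
Proof.
move=> fc gc; rewrite /bconv [RHS]mulrCA -(cintZ _ (cseg_ccont fc gc)).
by congr (_ * _); apply: cint_ext => t _; rewrite mulrA.
Qed.

Lemma bconvZr f g c z : cseg f z -> cseg g z ->
  bconv f (fun z => c * g z) z = c * bconv f g z.
Proof.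
move=> fc gc; rewrite /bconv [RHS]mulrCA -(cintZ _ (cseg_ccont fc gc)).
by congr (_ * _); apply: cint_ext => t _; rewrite mulrCA.
Qed.

Lemma csegD f g z : cseg f z -> cseg g z -> cseg (fun z => f z + g z) z.
Proof.
move=> fc gc t t01; have := fc t t01; have := gc t t01.
move=> /continuous_nmP h1 /continuous_nmP h2; apply/continuous_nmP => e e0.
have e2 : 0 < e / 2 by rewrite divr_gt0.
have [d d0 hd] := h1 _ e2; have [d' d0' hd'] := h2 _ e2.
exists (Num.min d d'); first by rewrite lt_min d0.
move=> s; rewrite lt_min => /andP[/hd h /hd' h'].
by rewrite opprD addrACA; apply: le_lt_trans (nmD _ _) _; rewrite [e]splitr ltrD.
Qed.

Lemma diff_cseg f z : (forall t : R, 0 <= t <= 1 -> differentiable f (t%:C * z)) -> cseg f z.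
Proof. by move=> df t /df; exact: (@differentiable_continuous _ K K). Qed.

Lemma csegN f z : cseg f z -> cseg (fun z => - f z) z.
Proof.
move=> fc t t01; have /continuous_nmP h1 := fc t t01; apply/continuous_nmP => e e0.
by have [d d0 hd] := h1 _ e0; exists d => // s /hd; rewrite -opprD nmN.
Qed.

Lemma cseg_sum n (F : 'I_n -> K -> K) z : (forall i, cseg (F i) z) -> cseg (fun z => \sum_i F i z) z.
Proof.
elim: n F => [|n IH] F Fc.
  by under eq_fun do rewrite big_ord0; apply: diff_cseg => t _; exact: dfC.
by under eq_fun do rewrite big_ord_recr; apply: csegD => //; apply: IH.
Qed.

Lemma bconv_suml n (F : 'I_n -> K -> K) g z : (forall i, cseg (F i) z) -> cseg g z ->
  bconv (fun z => \sum_i F i z) g z = \sum_i bconv (F i) g z.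
Proof.
move=> Fc gc; elim: n F Fc => [|n IH] F Fc.
  rewrite big_ord0 /bconv (cint_ext (g := fun=> 0)) ?cint0 ?mulr0 // => t _.
  by rewrite big_ord0 mul0r.
have Fc' i : cseg (F (widen_ord (leqnSn n) i)) z by exact: Fc.
rewrite [RHS]big_ord_recr.
apply: etrans (etrans (bconvDl (cseg_sum Fc') (Fc ord_max) gc) _).
  by apply: bconv_ext => // t _; rewrite big_ord_recr.
by congr (_ + _); exact: IH.
Qed.

Lemma bconv_sumr n (F : 'I_n -> K -> K) g z : (forall i, cseg (F i) z) -> cseg g z ->
  bconv g (fun z => \sum_i F i z) z = \sum_i bconv g (F i) z.
Proof.
move=> Fc gc; elim: n F Fc => [|n IH] F Fc.
  rewrite big_ord0 /bconv (cint_ext (g := fun=> 0)) ?cint0 ?mulr0 // => t _.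
  by rewrite big_ord0 mulr0.
have Fc' i : cseg (F (widen_ord (leqnSn n) i)) z by exact: Fc.
rewrite [RHS]big_ord_recr.
apply: etrans (etrans (bconvDr gc (cseg_sum Fc') (Fc ord_max)) _).
  by apply: bconv_ext => // t _; rewrite big_ord_recr.
by congr (_ + _); exact: IH.
Qed.

(** The Borel transform of hbar^(i+1); [bconv_bmono] is then the statement that products become
    convolutions, on monomials. *)
Definition bmono i (z : K) : K := z ^+ i / i`!%:R.

Lemma bmono_diff i z : differentiable (bmono i) z.
Proof. by apply: dfM; [apply: dfX; exact: df_id|exact: dfC]. Qed.

Lemma bconv_bmono i j z : bconv (bmono i) (bmono j) z = bmono (i + j).+1 z.
Proof.
have f0 k : (k`!%:R : K) != 0 by rewrite pnatr_eq0 -lt0n fact_gt0.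
rewrite /bconv (cint_ext (g := fun t => (z ^+ (i + j) / (i`!%:R * j`!%:R)) * (t%:C ^+ i * (1 - t)%:C ^+ j))); last first.
  by move=> t _; rewrite /bmono !exprMn exprD; field; rewrite !f0.
rewrite cintZ; last first.
  have h1 k : cseg (fun z => z ^+ k) (1 : K).
    by apply: diff_cseg => t _; apply: dfX; exact: df_id.
  apply: ccont_ext (cseg_ccont (h1 i) (h1 j)) => t.
  by rewrite (mulr1 (t%:C : K)) (mulr1 ((1 - t)%:C : K)).
by rewrite cint_beta /bmono exprS; field; rewrite !f0.
Qed.

(* The Taylor coefficients at 0 are those of the Borel transform of the
   formal series [P], up to order m. *)
Definition jet (f : K -> K) (P : {poly K}) m := asym f (fun k => P`_k.+1 / k`!%:R) m.

Lemma jetD f g P Q m : jet f P m -> jet g Q m -> jet (fun z => f z + g z) (P + Q) m.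
Proof.
move=> [C [d [C0 d0 H]]] [C' [d' [C0' d0' H']]].
exists (C + C'), (Num.min d d'); split; first exact: addr_ge0.
  by rewrite lt_min d0.
move=> z; rewrite lt_min => /andP[/H h /H' h'].
under eq_bigr do rewrite coefD !mulrDl.
rewrite big_split /= opprD addrACA mulrDl; apply: le_trans (nmD _ _) _.
exact: lerD.
Qed.

Lemma jetZ f P c m : jet f P m -> jet (fun z => c * f z) (c *: P) m.
Proof.
move=> [C [d [C0 d0 H]]]; exists (nm c * C), d; split=> //; first by rewrite mulr_ge0 // nm_ge0.
move=> z /H h; under eq_bigr do rewrite coefZ -!mulrA.
rewrite -mulr_sumr -mulrBr nmM -mulrA ler_wpM2l ?nm_ge0 //.
by under eq_bigr do rewrite mulrA.
Qed.

Lemma jetN f P m : jet f P m -> jet (fun z => - f z) (- P) m.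
Proof. by move=> /(jetZ (-1)); under eq_fun do rewrite mulN1r; rewrite scaleN1r. Qed.

Lemma jet0 m : jet (fun=> 0) 0 m.
Proof.
exists 0, 1; split=> // z _; rewrite mul0r big1 ?subrr ?nm0 // => i _.
by rewrite coef0 !mul0r.
Qed.

Lemma jet_sum I (r : seq I) (p : pred I) (f : I -> K -> K) (P : I -> {poly K}) m :
  (forall i, p i -> jet (f i) (P i) m) ->
  jet (fun z => \sum_(i <- r | p i) f i z) (\sum_(i <- r | p i) P i) m.
Proof.
move=> H; elim: r => [|i r IH].
  by under eq_fun do rewrite big_nil; rewrite big_nil; exact: jet0.
under eq_fun do rewrite big_cons; rewrite big_cons.
by case: (boolP (p i)) => pi //; apply: jetD => //; exact: H.
Qed.

Lemma jet_eq f (P Q : {poly K}) m : (forall n, (n <= m)%N -> P`_n = Q`_n) -> jet f P m -> jet f Q m.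
Proof.
move=> E [C [d [C0 d0 H]]]; exists C, d; split=> // z /H.
by under eq_bigr => k _ do rewrite E //.
Qed.

Lemma jet_bmono k m : jet (bmono k) ('X^(k.+1)) m.
Proof.
have f0 i : (i`!%:R : K) != 0 by rewrite pnatr_eq0 -lt0n fact_gt0.
exists 1, 1; split=> // z z1; have [km|mk] := ltnP k m.
  rewrite (bigD1 (Ordinal km)) //= coefXn eqxx big1 ?addr0; last first.
    move=> i ik; rewrite coefXn eqSS; case: eqP => [ik'|]; last by rewrite !mul0r.
    by case/eqP: ik; exact/val_inj.
  by rewrite /bmono div1r mulrC subrr nm0 mulr_ge0 // exprn_ge0 // nm_ge0.
rewrite big1 ?subr0; last first.
  move=> i _; rewrite coefXn eqSS; case: eqP => [ik'|]; last by rewrite !mul0r.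
  by have := ltn_ord i; rewrite ik' ltnNge mk.
rewrite /bmono nmM nmV nm_nat nmX mul1r.
apply: (@le_trans _ _ (nm z ^+ k)).
  by rewrite ler_pdivrMr ?ler_peMr ?exprn_ge0 ?nm_ge0 ?ler1n ?fact_gt0 // ltr0n fact_gt0.
by apply: ler_wiXn2l => //; [exact: nm_ge0|exact: ltW].
Qed.

Lemma bconv_le f g z (a b : R) : 0 <= a -> 0 <= b -> cseg f z -> cseg g z ->
  (forall t : R, 0 <= t <= 1 -> nm (f (t%:C * z)) <= a) ->
  (forall t : R, 0 <= t <= 1 -> nm (g (t%:C * z)) <= b) -> nm (bconv f g z) <= nm z * (a * b).
Proof.
move=> a0 b0 fc gc fa gb; rewrite /bconv nmM ler_wpM2l ?nm_ge0 //.
rewrite -[leRHS]mulr1 -[X in _ <= _ * X]subr0; apply: le_cint_cst => //; first exact: cseg_ccont.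
move=> t t01; rewrite nmM; apply: ler_pM; rewrite ?nm_ge0 ?fa ?gb //.
by move: t01 => /andP[? ?]; apply/andP; split; lra.
Qed.

Lemma nm_shrink (t : R) (z : K) : 0 <= t <= 1 -> nm (t%:C * z) <= nm z.
Proof. by move=> /andP[t0 t1]; rewrite nmM nmR ger0_norm // ler_piMl // nm_ge0. Qed.

(** The product rule for Borel transforms: [P] has no constant term, and the constant coefficient of
    [Q] acts as a multiple of the unit delta. Polynomial parts convolve exactly, and an error of
    order m in one factor stays of order m, since convolution only adds a factor |z|. *)
Lemma jet_bconv f g (P Q : {poly K}) m (d : R) : 0 < d -> (forall z, nm z < d -> differentiable f z) ->
  (forall z, nm z < d -> differentiable g z) ->
  P`_0 = 0 -> jet f P m -> jet g Q m ->
  jet (fun z => Q`_0 * f z + bconv f g z) (P * Q) m.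
Proof.
move=> d0 df dg P0 jf jg.
have [C [e [C0 e0 Hf]]] := jf; have [C' [e' [C0' e0' Hg]]] := jg.
pose p z : K := \sum_(k < m) P`_k.+1 * bmono k z.
pose q z : K := \sum_(k < m) Q`_k.+1 * bmono k z.
have pE z : \sum_(k < m) P`_k.+1 / k`!%:R * z ^+ k = p z.
  by apply: eq_bigr => k _; rewrite /bmono; ring.
have qE z : \sum_(k < m) Q`_k.+1 / k`!%:R * z ^+ k = q z.
  by apply: eq_bigr => k _; rewrite /bmono; ring.
have dp z : differentiable p z.
  by apply: df_sum => i _; apply: dfM; [exact: dfC|exact: bmono_diff].
have dq z : differentiable q z.
  by apply: df_sum => i _; apply: dfM; [exact: dfC|exact: bmono_diff].
have [r1 [r10 Hp]] := diff_loc_bounded (dp 0).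
have [r2 [r20 Hgb]] := diff_loc_bounded (dg 0 (eq_ind_r (fun x => x < d) d0 (nm0 K))).
set Bp := nm (p 0) + 1 in Hp; set Bg := nm (g 0) + 1 in Hgb.
have Bp0 : 0 <= Bp by rewrite addr_ge0 // nm_ge0.
have Bg0 : 0 <= Bg by rewrite addr_ge0 // nm_ge0.
pose D := Num.min (Num.min d 1) (Num.min (Num.min e e') (Num.min r1 r2)).
have D0 : 0 < D by rewrite !lt_min d0 e0 e0' r10 r20 ltr01.
have DP (z : K) : nm z < D -> [/\ nm z < d, nm z < 1, nm z < e, nm z < e' & nm z < r1 /\ nm z < r2].
  by rewrite !lt_min => /andP[/andP[? ?] /andP[/andP[? ?] /andP[? ?]]].
have sm (t : R) z : nm z < D -> 0 <= t <= 1 -> nm (t%:C * z) < D.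
  by move=> zD t01; apply: le_lt_trans zD; exact: nm_shrink.
have cf z : nm z < D -> cseg f z.
  by move=> zD; apply: diff_cseg => t t01; apply: df; have [] := DP _ (sm t z zD t01).
have cg z : nm z < D -> cseg g z.
  by move=> zD; apply: diff_cseg => t t01; apply: dg; have [] := DP _ (sm t z zD t01).
have cp z : cseg p z by apply: diff_cseg.
have cq z : cseg q z by apply: diff_cseg.
have cN (h : K -> K) z : cseg h z -> cseg (fun z => - h z) z by exact: csegN.
pose P' := \sum_(i < m) P`_i.+1 *: 'X^(i.+1).
pose Q' := \sum_(i < m) Q`_i.+1 *: 'X^(i.+1).
have P'E n : (n <= m)%N -> P'`_n = P`_n.
  rewrite /P' coef_sum; case: n => [|n] nm_.
    by rewrite big1 ?P0 // => i _; rewrite coefZ coefXn mulr0.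
  rewrite (bigD1 (Ordinal nm_)) //= coefZ coefXn eqxx mulr1 big1 ?addr0 // => i ik.
  rewrite coefZ coefXn eqSS; case: eqP => [ik'|]; last by rewrite mulr0.
  by case/eqP: ik; exact/val_inj.
have Q'E n : (n < m)%N -> Q'`_n.+1 = Q`_n.+1.
  move=> nm_; rewrite /Q' coef_sum.
  rewrite (bigD1 (Ordinal nm_)) //= coefZ coefXn eqxx mulr1 big1 ?addr0 // => i ik.
  rewrite coefZ coefXn eqSS; case: eqP => [ik'|]; last by rewrite mulr0.
  by case/eqP: ik; exact/val_inj.
have Q'0 : Q'`_0 = 0.
  by rewrite /Q' coef_sum big1 // => i _; rewrite coefZ coefXn mulr0.
(* The truncations have no constant term, so the contribution of the constant coefficient of [Q] is
   restored separately; up to order m nothing else is lost. *)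
apply: (@jet_eq _ (Q`_0 *: P + P' * Q')).
  move=> n nm_; rewrite coefD coefZ !coefM.
  rewrite [RHS]big_ord_recr /= [X in _ + X = _]big_ord_recr /= subnn Q'0 mulr0 addr0.
  rewrite addrC [Q`_0 * _]mulrC; congr (_ + _).
  apply: eq_bigr => i _; rewrite P'E ?(leq_trans (ltnW (ltn_ord i))) //.
  congr (_ * _); have i_n := ltn_ord i; rewrite -(subnSK i_n); apply: Q'E.
  by apply: leq_trans nm_; rewrite subnSK // leq_subr.
apply: jetD; first exact: jetZ.
have jpq : jet (bconv p q) (P' * Q') m.
  have -> : bconv p q = fun z => \sum_(i < m) \sum_(j < m) (P`_i.+1 * Q`_j.+1) * bmono (i + j).+1 z.
    apply/funext => z.
    have cb c k y : cseg (fun z => c * bmono k z) y.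
      by apply: diff_cseg => t _; apply: dfM; [exact: dfC|exact: bmono_diff].
    have cb' k y : cseg (bmono k) y by apply: diff_cseg => t _; exact: bmono_diff.
    rewrite /p bconv_suml //; apply: eq_bigr => i _.
    rewrite /q bconv_sumr //; apply: eq_bigr => j _.
    by rewrite bconvZl // bconvZr // bconv_bmono mulrA.
  rewrite /P' /Q' mulr_suml; apply: jet_sum => i _; rewrite mulr_sumr; apply: jet_sum => j _.
  rewrite -scalerAl -scalerAr scalerA -exprD addSn addnS.
  by apply: jetZ; exact: jet_bmono.
have [C1 [e1 [C10 e10 H1]]] := jpq.
exists (C1 + Bp * C' + C * Bg), (Num.min D e1); split.
- by rewrite !addr_ge0 // mulr_ge0.
- by rewrite lt_min D0.
move=> z; rewrite lt_min => /andP[zD /H1 h1].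
have [zd z1 ze ze' [zr1 zr2]] := DP _ zD.
(* Bilinear splitting into the convolution of the polynomial parts and two terms in which one factor
   is an error of order m. *)
have E : bconv f g z = bconv p q z + bconv p (fun z => g z - q z) z + bconv (fun z => f z - p z) g z.
  rewrite -bconvDr //; last by apply: csegD; [exact: cg|exact: cN].
  rewrite [bconv p _ z](_ : _ = bconv p g z); last first.
    by apply: bconv_ext => // t _; rewrite addrC subrK.
  rewrite -bconvDl //; [|by apply: csegD; [exact: cf|exact: cN]|exact: cg].
  by apply: bconv_ext => // t _; rewrite addrC subrK.
rewrite E; move: h1; set X := bconv p q z; set Y := bconv p _ z; set Z := bconv _ g z.
move: (\sum_(n < m) _) => S h1.
have -> : X + Y + Z - S = (X - S) + (Y + Z) by ring.
apply: le_trans (nmD _ _) _; rewrite [leRHS]mulrDl [X in _ <= X + _]mulrDl -addrA; apply: lerD => //.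
apply: le_trans (nmD _ _) _; rewrite /Y /Z.
have zm (t : R) : 0 <= t <= 1 -> nm (t%:C * z) ^+ m <= nm z ^+ m.
  by move=> t01; rewrite lerXn2r ?nnegrE ?nm_ge0 // nm_shrink.
have zz := nm_ge0 z; have zm0 : 0 <= nm z ^+ m by rewrite exprn_ge0.
apply: lerD.
  apply: le_trans (@bconv_le _ _ _ Bp (C' * nm z ^+ m) _ _ _ _ _ _) _ => //.
  - by rewrite mulr_ge0.
  - by apply: csegD; [exact: cg|exact: cN].
  - move=> t t01; apply: Hp; rewrite subr0; have [_ _ _ _ []] := DP _ (sm t z zD t01) => //.
  - move=> t t01; rewrite -qE; have [_ _ _ t4 _] := DP _ (sm t z zD t01).
    by apply: le_trans (Hg _ t4) _; rewrite ler_wpM2l // zm.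
  by rewrite -mulrA; apply: ler_piMl; [rewrite !mulr_ge0|exact: ltW].
apply: le_trans (@bconv_le _ _ _ (C * nm z ^+ m) Bg _ _ _ _ _ _) _ => //.
- by rewrite mulr_ge0.
- by apply: csegD; [exact: cf|exact: cN].
- exact: cg.
- move=> t t01; rewrite -pE; have [_ _ t4 _ _] := DP _ (sm t z zD t01).
  by apply: le_trans (Hf _ t4) _; rewrite ler_wpM2l // zm.
- move=> t t01; apply: Hgb; rewrite subr0; have [_ _ _ _ []] := DP _ (sm t z zD t01) => //.
by rewrite [leRHS]mulrAC; apply: ler_piMl; [rewrite !mulr_ge0|exact: ltW].
Qed.

End ConvBasics.

(** * Sup norms on products, the weight, and weighted spaces of holomorphic functions *)

Section ProdNorm.
Context {R : realType}.
Notation K := R[i].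
Variables U V : normedModType K.
Implicit Type q : U * V.

Lemma nm_prod q : nm q = Num.max (nm q.1) (nm q.2).
Proof. by rewrite /nm prod_normE !nmE /Order.max ltcR; case: ifP. Qed.

Lemma nm_fst q : nm q.1 <= nm q.
Proof. by rewrite nm_prod le_max lexx. Qed.

Lemma nm_snd q : nm q.2 <= nm q.
Proof. by rewrite nm_prod le_max lexx orbT. Qed.

Lemma nm_prod_lt q (r : R) : (nm q < r) = (nm q.1 < r) && (nm q.2 < r).
Proof. by rewrite nm_prod gt_max. Qed.

Lemma nm_linear_differentiable (W W' : normedModType K) (f : W -> W') w :
  linear f -> (forall w, nm (f w) <= nm w) -> differentiable f w.
Proof.
move=> lf fle; pose L : {linear W -> W'} := HB.pack f (GRing.isLinear.Build _ _ _ _ _ lf).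
have Lc : continuous L.
  move=> x; apply/continuous_nmP => e e0; exists e => // y yx.
  by rewrite -linearB; exact: le_lt_trans (fle _) yx.
apply: (proj1 (nm_differentiable Lc _)) => e e0; exists 1 => // h _.
have LD : f (w + h) = f w + L h by exact: (linearD L).
rewrite LD addrAC addrK subrr nm0.
by rewrite mulr_ge0 ?nm_ge0 // ltW.
Qed.

Lemma df_fst q : differentiable (fst : U * V -> U) q.
Proof. by apply: nm_linear_differentiable => [a x y|x]; [|exact: nm_fst]. Qed.

Lemma df_snd q : differentiable (snd : U * V -> V) q.
Proof. by apply: nm_linear_differentiable => [a x y|x]; [|exact: nm_snd]. Qed.
End ProdNorm.

Section Weight.
Context {R : realType}.
Notation K := R[i].
Variables (L lam : R).
Hypotheses (L0 : 0 < L) (lam0 : 0 < lam).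

(** The exponential is multiplicative along a segment, so convolution affects only the factor (1 +
    lam r)^-2; it is reproduced up to the constant 4 / lam, which lam / 4 compensates. *)
Definition wt (r : R) : R := lam / 4 * expR ((L + lam) * r) / (1 + lam * r) ^+ 2.

Let pos r : 0 <= r -> 0 < 1 + lam * r.
Proof. by move=> r0; rewrite ltr_wpDr // mulr_ge0 // ltW. Qed.

Lemma wt_ge0 r : 0 <= wt r.
Proof. by rewrite divr_ge0 ?sqr_ge0 // mulr_ge0 ?expR_ge0 // divr_ge0 // ltW. Qed.

Lemma wt_le_exp r : 0 <= r -> wt r <= lam / 4 * expR ((L + lam) * r).
Proof.
move=> r0; rewrite /wt ler_pdivrMr ?exprn_gt0 ?pos // ler_peMr //.
  by rewrite mulr_ge0 ?expR_ge0 // divr_ge0 // ltW.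
by rewrite exprn_ege1 // lerDl mulr_ge0 // ltW.
Qed.

(** The spare rate [lam] in the exponent pays for the denominator: e^y >= 1 + y at y = lam r / 2
    gives (1 + lam r)^2 <= 4 e^(lam r). The gain 1 / lam is what makes the function parts small for
    large [lam]. *)
Lemma exp_le_wt (M r : R) : 0 <= M -> 0 <= r -> M * expR (L * r) <= 16 * M / lam * wt r.
Proof.
move=> M0 r0; have p := pos r0.
have lr : 0 <= lam * r by rewrite mulr_ge0 // ltW.
rewrite /wt [(L + lam) * r]mulrDl expRD.
have -> : 16 * M / lam * (lam / 4 * (expR (L * r) * expR (lam * r)) / (1 + lam * r) ^+ 2)
  = M * expR (L * r) * (4 * expR (lam * r) / (1 + lam * r) ^+ 2) by field; rewrite !gt_eqF.
rewrite ler_peMr ?mulr_ge0 ?expR_ge0 // ler_pdivlMr ?exprn_gt0 // mul1r.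
have -> : lam * r = lam * r / 2 + lam * r / 2 by field.
rewrite expRD; have := expR_ge1Dx (lam * r / 2); set y := lam * r / 2; set E := expR y => h.
have y0 : 0 <= y by rewrite divr_ge0.
have -> : 4 * (E * E) = (2 * E) ^+ 2 by ring.
rewrite lerXn2r ?nnegrE ?mulr_ge0 ?expR_ge0 //; first by lra.
lra.
Qed.

Lemma is_derive_inv (c d t : R) : d + c * t != 0 ->
  is_derive t (1 : R) (fun t : R => (d + c * t)^-1) (- c / (d + c * t) ^+ 2).
Proof.
move=> n0; have dd : is_derive t (1 : R) (fun t : R => d + c * t) c.
  apply: real_deriv => e e0; exists 1 => // s _.
  by rewrite [_ - _](_ : _ = 0) ?normr0 ?mulr_ge0 // ?ltW //; ring.
apply: is_derive_eq; rewrite [LHS](_ : _ = - (d + c * t) ^- 2 * c) //.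
by ring.
Qed.

Lemma bconv_wt (f g : K -> K) (z : K) (a b : R) : 0 <= a -> 0 <= b -> cseg f z -> cseg g z ->
  (forall t : R, 0 <= t <= 1 -> nm (f (t%:C * z)) <= a * wt (t * nm z)) ->
  (forall t : R, 0 <= t <= 1 -> nm (g (t%:C * z)) <= b * wt (t * nm z)) ->
  nm (bconv f g z) <= a * b * wt (nm z).
Proof.
move=> a0 b0 fc gc fa gb; have r0 := nm_ge0 z; set r := nm z in r0 fa gb *.
have p := pos r0; have fg := cseg_ccont fc gc.
pose E := expR ((L + lam) * r); have E0 : 0 <= E by exact: expR_ge0.
(* The denominators at t r and (1 - t) r; [B] is put in the form d + c t required by
   [is_derive_inv]. *)
pose A (t : R) : R := 1 + lam * r * t; pose B (t : R) : R := (1 + lam * r) + - (lam * r) * t.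
have lr : 0 <= lam * r by rewrite mulr_ge0 // ltW.
have A0 (t : R) : 0 <= t <= 1 -> 0 < A t.
  by move=> /andP[t0 t1]; rewrite ltr_wpDr // mulr_ge0.
have BE (t : R) : B t = 1 + lam * r * (1 - t) by rewrite /B; ring.
have B0 (t : R) : 0 <= t <= 1 -> 0 < B t.
  by move=> /andP[t0 t1]; rewrite BE ltr_wpDr // mulr_ge0 // subr_ge0.
pose c0 := a * b * (lam / 4) ^+ 2 * E * 2 / (1 + lam * r) ^+ 2.
have c00 : 0 <= c0.
  apply: divr_ge0; last exact: sqr_ge0.
  by apply: mulr_ge0 => //; apply: mulr_ge0 => //; apply: mulr_ge0; [exact: mulr_ge0|exact: sqr_ge0].
pose G (t : R) : R := c0 / lam * ((B t)^-1 - (A t)^-1).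
pose dG (t : R) : R := c0 / lam * (lam * r / (B t) ^+ 2 + lam * r / (A t) ^+ 2).
have dA (t : R) : 0 <= t <= 1 -> is_derive t (1 : R) (fun t => (A t)^-1) (- (lam * r) / (A t) ^+ 2).
  by move=> t01; apply: is_derive_inv; rewrite gt_eqF // A0.
have dB (t : R) : 0 <= t <= 1 -> is_derive t (1 : R) (fun t => (B t)^-1) (lam * r / (B t) ^+ 2).
  move=> t01; have := @is_derive_inv (- (lam * r)) (1 + lam * r) t.
  by rewrite opprK; apply; rewrite gt_eqF // B0.
have cA (t : R) : 0 <= t <= 1 -> {for t, continuous (fun t => (A t)^-1)}.
  by move=> /dA [/derivable1_diffP/differentiable_continuous].
have cB (t : R) : 0 <= t <= 1 -> {for t, continuous (fun t => (B t)^-1)}.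
  by move=> /dB [/derivable1_diffP/differentiable_continuous].
have H := @le_cint_FTC _ 0 1 (fun t => z * (f (t%:C * z) * g ((1 - t)%:C * z))) dG G ler01.
rewrite /bconv -cintZ //; apply: le_trans (H _ _ _ _) _.
- by apply: ccontM => //; exact: ccont_cst.
- apply: continuous_in_subspaceT => t; rewrite inE /= in_itv /= => t01.
  have E1 : dG = fun t => c0 / lam * (lam * r * ((B t)^-1 * (B t)^-1) + lam * r * ((A t)^-1 * (A t)^-1)).
    by apply/funext => s; rewrite /dG !expr2 !invfM.
  rewrite E1; apply: cvgM; first exact: cvg_cst.
  by apply: cvgD; (apply: cvgM; first exact: cvg_cst); apply: cvgM; (exact: cB || exact: cA).
- move=> t t01; have h1 := dA t t01; have h2 := dB t t01.
  rewrite /G; apply: is_derive_eq; rewrite /dG.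
  by rewrite [LHS](_ : _ = c0 / lam * (lam * r / B t ^+ 2 - - (lam * r) / A t ^+ 2)) //; ring.
- move=> t t01; have t01' : 0 <= 1 - t <= 1 by move: t01 => /andP[? ?]; apply/andP; split; lra.
  rewrite !nmM -/r.
  have At := A0 t t01; have Bt := B0 t t01.
  apply: (@le_trans _ _ (r * ((a * wt (t * r)) * (b * wt ((1 - t) * r))))).
    by rewrite ler_wpM2l //; apply: ler_pM; rewrite ?nm_ge0 ?fa ?gb.
  rewrite /wt.
  have -> : 1 + lam * (t * r) = A t by rewrite /A; ring.
  have -> : 1 + lam * ((1 - t) * r) = B t by rewrite BE; ring.
  have EE : expR ((L + lam) * (t * r)) * expR ((L + lam) * ((1 - t) * r)) = E.
    by rewrite -expRD /E; congr expR; ring.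
  have -> : r * (a * (lam / 4 * expR ((L + lam) * (t * r)) / A t ^+ 2) *
    (b * (lam / 4 * expR ((L + lam) * ((1 - t) * r)) / B t ^+ 2))) =
    r * (a * b * (lam / 4) ^+ 2 * E) * ((A t ^+ 2)^-1 * (B t ^+ 2)^-1).
    by rewrite -EE; field; rewrite !gt_eqF.
  have -> : dG t = r * (a * b * (lam / 4) ^+ 2 * E) * (2 / (1 + lam * r) ^+ 2 * ((B t ^+ 2)^-1 + (A t ^+ 2)^-1)).
    by rewrite /dG /c0; field; rewrite !gt_eqF.
  apply: ler_wpM2l; first by apply: mulr_ge0 => //; apply: mulr_ge0 => //; apply: mulr_ge0; [exact: mulr_ge0|exact: sqr_ge0].
  (* The key inequality is (1 + lam r)^2 <= (A + B)^2 <= 2 (A^2 + B^2): it replaces 1 / (A^2 B^2) by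
     a multiple of the sum of 1 / A^2 and 1 / B^2, whose primitives are explicit. *)
  have -> : 2 / (1 + lam * r) ^+ 2 * ((B t ^+ 2)^-1 + (A t ^+ 2)^-1) =
    (A t ^+ 2)^-1 * (B t ^+ 2)^-1 * (2 * (A t ^+ 2 + B t ^+ 2) / (1 + lam * r) ^+ 2).
    by field; rewrite !gt_eqF.
  rewrite ler_peMr ?mulr_ge0 ?invr_ge0 ?sqr_ge0 // ler_pdivlMr ?exprn_gt0 // mul1r.
  have : 1 + lam * r <= A t + B t by rewrite /A /B; move: lr; lra.
  move=> AB; have := ler_pM (ltW p) (ltW p) AB AB; rewrite -!expr2 => /le_trans; apply.
  rewrite -subr_ge0 (_ : _ - _ = (A t - B t) ^+ 2) ?sqr_ge0 //; ring.
rewrite /G -mulrBr.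
have -> : (B 1)^-1 - (A 1)^-1 - ((B 0)^-1 - (A 0)^-1) = 2 * (1 - (1 + lam * r)^-1).
  by rewrite /A /B !mulr1 !mulr0 !addr0 addrK invr1; ring.
apply: (@le_trans _ _ (c0 / lam * 2)).
  apply: ler_wpM2l; first by rewrite divr_ge0 // ltW.
  by apply: ler_piMr => //; rewrite gerBl invr_ge0 ltW.
by rewrite le_eqVlt; apply/orP; left; apply/eqP; rewrite /c0 /wt -/E; field; rewrite !gt_eqF.
Qed.

Section Param.
Variables (V : normedModType K) (X0 : set V) (T : set K).
Hypotheses (oX : open X0) (oT : open T)
  (star : forall (t : R) (z : K), 0 <= t <= 1 -> T z -> T (t%:C * z)).

Definition wadm (phi : V * K -> K) (s : R) :=
  holomorphic (X0 `*` T) phi /\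
  forall x z, X0 x -> T z -> nm (phi (x, z)) <= s * wt (nm z).

Definition pconv (phi psi : V * K -> K) (q : V * K) : K :=
  bconv (fun z => phi (q.1, z)) (fun z => psi (q.1, z)) q.2.

Lemma slice_diff (phi : V * K -> K) x z : holomorphic (X0 `*` T) phi -> X0 x -> T z ->
  differentiable (fun z => phi (x, z)) z.
Proof.
move=> hp Xx Tz; apply: (@df_comp _ _ _ _ (fun z : K => (x, z)) phi).
  by apply: differentiable_pair; [exact: differentiable_cst|exact: df_id].
by apply: hp.
Qed.

Lemma slice_cseg phi x z : holomorphic (X0 `*` T) phi -> X0 x -> T z ->
  cseg (fun z => phi (x, z)) z.
Proof.
by move=> hp Xx Tz; apply: diff_cseg => t t01; apply: slice_diff => //; exact: star.
Qed.

(** The bound is [bconv_wt]. Joint holomorphy comes from [quasi_affine_cint], applied to the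
    integrand as a function of the pair (x, z), with constants uniform in [t]. *)
Lemma wadm_pconv phi psi a b : 0 <= a -> 0 <= b ->
  wadm phi a -> wadm psi b -> wadm (pconv phi psi) (a * b).
Proof.
move=> a0 b0 [hp pa] [hq qb]; split; last first.
  move=> x z Xx Tz; rewrite /pconv /=.
  apply: bconv_wt => //; [exact: slice_cseg|exact: slice_cseg|move=> t t01|move=> t t01].
    by apply: le_trans (pa _ _ Xx (star t01 Tz)) _; rewrite nmM nmR ger0_norm //; case/andP: t01.
  by apply: le_trans (qb _ _ Xx (star t01 Tz)) _; rewrite nmM nmR ger0_norm //; case/andP: t01.
move=> [x0 z0] [/= Xx0 Tz0].
have /nbhs_nmP[r1 r10 Hr1] : nbhs x0 X0 by exact: open_nbhs_nbhs.
have /nbhs_nmP[r2 r20 Hr2] : nbhs z0 T by exact: open_nbhs_nbhs.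
pose r := Num.min r1 r2; have r0 : 0 < r by rewrite lt_min r10.
have sub q : nm (q - (x0, z0)) < r -> X0 q.1 /\ T q.2.
  move=> qr; split.
    by apply: Hr1; apply: le_lt_trans (nm_fst (q - (x0, z0))) _; apply: lt_le_trans qr _; rewrite ge_min lexx.
  by apply: Hr2; apply: le_lt_trans (nm_snd (q - (x0, z0))) _; apply: lt_le_trans qr _; rewrite ge_min lexx orbT.
pose M := lam / 4 * expR ((L + lam) * (nm z0 + r)).
have M0 : 0 <= M by rewrite mulr_ge0 ?expR_ge0 // divr_ge0 // ltW.
have LL : 0 <= L + lam by rewrite ltW // addr_gt0.
have wM q (t : R) : nm (q - (x0, z0)) < r -> 0 <= t <= 1 -> wt (nm (t%:C * q.2)) <= M.
  move=> qr t01; apply: le_trans (wt_le_exp (nm_ge0 _)) _.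
  apply: ler_wpM2l; first by rewrite divr_ge0 // ltW.
  rewrite ler_expR; apply: ler_wpM2l => //.
  apply: le_trans (nm_shrink _ t01) _.
  rewrite -[q.2](subrK z0) addrC; apply: le_trans (nmD _ _) _; rewrite lerD2l.
  by apply: le_trans (nm_snd (q - (x0, z0))) (ltW _).
have io_diff (t : R) (q : V * K) : differentiable (fun q : V * K => (q.1, t%:C * q.2)) q.
  apply: differentiable_pair; first exact: df_fst.
  by apply: dfM; [exact: dfC|exact: df_snd].
pose H (t : R) (q : V * K) : K := phi (q.1, t%:C * q.2) * psi (q.1, (1 - t)%:C * q.2).
have flip (t : R) : 0 <= t <= 1 -> 0 <= 1 - t <= 1.
  by move=> /andP[? ?]; apply/andP; split; lra.
have dH t q : 0 <= t <= 1 -> nm (q - (x0, z0)) < r -> differentiable (H t) q.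
  move=> t01 /sub[Xq Tq]; apply: dfM.
    apply: (@df_comp _ _ _ _ (fun q : V * K => (q.1, t%:C * q.2)) phi); first exact: io_diff.
    by apply: hp; split => //=; exact: star.
  apply: (@df_comp _ _ _ _ (fun q : V * K => (q.1, (1 - t)%:C * q.2)) psi); first exact: io_diff.
  by apply: hq; split => //=; apply: star => //; exact: flip.
have bH t q : 0 <= t <= 1 -> nm (q - (x0, z0)) < r -> nm (H t q) <= (a * M) * (b * M).
  move=> t01 qr; have [Xq Tq] := sub q qr; rewrite nmM; apply: ler_pM; rewrite ?nm_ge0 //.
    by apply: le_trans (pa _ _ Xq (star t01 Tq)) _; rewrite ler_wpM2l // wM.
  by apply: le_trans (qb _ _ Xq (star (flip _ t01) Tq)) _; rewrite ler_wpM2l // wM // flip.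
pose C := 64 * ((a * M) * (b * M)) / r ^+ 2.
have C0 : 0 <= C.
  apply: divr_ge0; last exact: sqr_ge0.
  by apply: mulr_ge0 => //; apply: mulr_ge0; exact: mulr_ge0.
have r8 : 0 < r / 8 by rewrite divr_gt0.
have qaI : quasi_affine (fun q => cint 0 1 (H^~ q)) (x0, z0) (r / 8) ((a * M) * (b * M)) C.
  apply: quasi_affine_cint => // [t t01|h hr].
    by apply: (holo_quasi_affine r0) => q qr; [exact: dH|exact: bH].
  have [Xh Th] : X0 ((x0, z0) + h).1 /\ T ((x0, z0) + h).2.
    apply: sub; rewrite addrAC subrr add0r; apply: lt_trans hr _.
    by rewrite ltr_pdivrMr // ltr_pMr // ltr1n.
  exact: (cseg_ccont (slice_cseg hp Xh Th) (slice_cseg hq Xh Th)).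
have [dI _] := quasi_affine_diff r8 (mulr_ge0 (mulr_ge0 a0 M0) (mulr_ge0 b0 M0)) C0 qaI.
rewrite [pconv _ _](_ : _ = fun q => q.2 * cint 0 1 (H^~ q)); last by apply/funext => q.
by apply: dfM; [exact: df_snd|exact: dI].
Qed.
End Param.
End Weight.

(** * The Picard iteration *)

Section BoxSums.

Lemma bconvNl (R : realType) (f g : R[i] -> R[i]) z : cseg f z -> cseg g z ->
  bconv (fun z => - f z) g z = - bconv f g z.
Proof.
move=> fc gc; apply: etrans (etrans (bconvZl (-1) fc gc) (mulN1r _)).
by apply: bconv_ext => // t _; exact: esym (mulN1r _).
Qed.

Lemma bconvNr (R : realType) (f g : R[i] -> R[i]) z : cseg f z -> cseg g z ->
  bconv f (fun z => - g z) z = - bconv f g z.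
Proof.
move=> fc gc; apply: etrans (etrans (bconvZr (-1) fc gc) (mulN1r _)).
by apply: bconv_ext => // t _; exact: esym (mulN1r _).
Qed.

(** Allows sums over boxes of different sizes to be compared term by term in the larger box. *)
Lemma sum_box_widen (N m M : nat) (A : nmodType) (F : ('I_N -> nat) -> A) : (m <= M)%N ->
  \sum_(al : {ffun 'I_N -> 'I_m.+1}) F (fun j => al j) =
  \sum_(al : {ffun 'I_N -> 'I_M.+1} | [forall j, (al j <= m)%N]) F (fun j => al j).
Proof.
move=> mM.
pose h (al : {ffun 'I_N -> 'I_m.+1}) : {ffun 'I_N -> 'I_M.+1} := [ffun j => inord (al j)].
pose h' (al : {ffun 'I_N -> 'I_M.+1}) : {ffun 'I_N -> 'I_m.+1} := [ffun j => inord (al j)].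
have lt (i : 'I_m.+1) : (i < M.+1)%N by rewrite (leq_trans (ltn_ord i)).
have hE al j : h al j = al j :> nat by rewrite ffunE inordK.
rewrite (reindex_onto h h') /=; last first.
  move=> al /forallP H; apply/ffunP => j; apply/val_inj => /=.
  by rewrite hE ffunE inordK // ltnS.
apply: eq_big => [al|al _].
  symmetry; apply/andP; split; first by apply/forallP => j; rewrite hE -ltnS.
  by apply/eqP/ffunP => j; apply/val_inj => /=; rewrite ffunE inordK hE // ltn_ord.
by congr F; apply/funext => j; rewrite hE.
Qed.

End BoxSums.

Section Picard.
Context {R : realType}.
Notation K := R[i].
Variables (L lam : R) (V : normedModType K) (X0 : set V) (T : set K) (N : nat).
Hypotheses (L0 : 0 < L) (lam0 : 0 < lam) (oX : open X0) (oT : open T)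
  (star : forall (t : R) (z : K), 0 <= t <= 1 -> T z -> T (t%:C * z)).

Notation wt := (wt L lam).
Notation wadm := (wadm L lam X0 T).

(* Elements (c, psi) of the convolution algebra with unit: c delta + psi. *)
Let elt : Type := ((V -> K) * (V * K -> K))%type.
Implicit Types (u v : elt) (phi psi : V * K -> K).

(** Multiplication by a pure function 0 delta + phi, so the unit component of the product is 0. *)
Definition mulE (phi : V * K -> K) (u : (V -> K) * (V * K -> K)) : (V -> K) * (V * K -> K) :=
  (fun=> 0, fun q => u.1 q.1 * phi q + pconv phi u.2 q).

(** The factors act on [u] one at a time, so neither associativity nor commutativity of the
    convolution enters. *)
Definition monE (w : 'I_N -> V * K -> K) (al : 'I_N -> nat) (u : (V -> K) * (V * K -> K)) :=
  foldr (fun j => iter (al j) (mulE (w j))) u (enum 'I_N).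

(** The majorant adds the size of the unit component and the weighted size of the function. The unit
    components of [u] and [v] coincide, so their difference is a pure function and can be measured
    by the weight alone. *)
Definition majE u v (t t' : R) := exists c s s' : R,
  [/\ t = c + s, t' = c + s', 0 <= c, 0 <= s' & s' <= s] /\
  [/\ holomorphic X0 u.1, forall x, X0 x -> u.1 x = v.1 x,
      forall x, X0 x -> nm (u.1 x) <= c,
      wadm u.2 s /\ wadm v.2 s' &
      forall x z, X0 x -> T z -> nm (u.2 (x, z) - v.2 (x, z)) <= (s - s') * wt (nm z)].

(* Majorizing differences as well makes the convergence of the iterates a
   consequence of that of the scalar majorants. *)
Definition majW phi psi (s s' : R) := [/\ 0 <= s', s' <= s, wadm phi s, wadm psi s' &
  forall x z, X0 x -> T z -> nm (phi (x, z) - psi (x, z)) <= (s - s') * wt (nm z)].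

Lemma wadmD phi psi a b : wadm phi a -> wadm psi b -> wadm (fun q => phi q + psi q) (a + b).
Proof.
move=> [h1 b1] [h2 b2]; split; first by move=> p Dp; apply: dfD; [exact: h1|exact: h2].
move=> x z Xx Tz; apply: le_trans (nmD _ _) _; rewrite mulrDl.
by apply: lerD; [exact: b1|exact: b2].
Qed.

Lemma df_fst_comp (c : V -> K) (q : V * K) : differentiable c q.1 ->
  differentiable (fun q : V * K => c q.1) q.
Proof. by move=> dc; apply: (@df_comp _ _ _ _ (fst : V * K -> V) c); [exact: df_fst|]. Qed.

Lemma wadmZ (c : V -> K) phi a b : 0 <= a -> holomorphic X0 c -> (forall x, X0 x -> nm (c x) <= a) ->
  wadm phi b -> wadm (fun q => c q.1 * phi q) (a * b).
Proof.
move=> a0 hc ca [hp pb]; split.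
  by move=> q [Xq Tq]; apply: dfM; [apply: df_fst_comp; exact: hc|exact: hp].
move=> x z Xx Tz; rewrite nmM -mulrA; apply: ler_pM; rewrite ?nm_ge0 //; [exact: ca|exact: pb].
Qed.

(** The telescoping phi * u - psi * v = (phi - psi) * u + psi * (u - v) matches the scalar identity
    s t - s' t' = (s - s') t + s' (t - t'), all of whose terms are nonnegative; this is why
    increments are majorized by increments. *)
Lemma majE_mul phi psi (s s' : R) u v t t' : majW phi psi s s' -> majE u v t t' ->
  majE (mulE phi u) (mulE psi v) (s * t) (s' * t').
Proof.
move=> [s'0 ss wp wq wd] [c [a [a' [[-> -> c0 a'0 aa] [hc uv uc [wu wv] ud]]]]].
have s0 : 0 <= s := le_trans s'0 ss.
have a0 : 0 <= a := le_trans a'0 aa.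
have hv : holomorphic X0 v.1.
  by move=> x Xx; apply: (differentiable_eq_on oX uv Xx); exact: hc.
have vc x : X0 x -> nm (v.1 x) <= c by move=> Xx; rewrite -uv //; exact: uc.
exists 0, (s * (c + a)), (s' * (c + a')); split.
  split=> //; rewrite ?add0r // ?mulr_ge0 ?addr_ge0 //.
  by apply: ler_pM; rewrite ?addr_ge0 ?lerD2l.
split.
- by move=> x _; exact: dfC.
- by move=> x _.
- by move=> x _; rewrite nm0.
- split; rewrite mulrDr [_ * c]mulrC; apply: wadmD.
  + exact: wadmZ.
  + exact: wadm_pconv.
  + exact: wadmZ.
  + exact: wadm_pconv.
move=> x z Xx Tz.
have [hp pb] := wp; have [hq qb] := wq; have [hu ub] := wu; have [hv2 vb] := wv.
have c1 := slice_cseg star hp Xx Tz; have c2 := slice_cseg star hq Xx Tz.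
have c3 := slice_cseg star hu Xx Tz; have c4 := slice_cseg star hv2 Xx Tz.
rewrite /pconv /= -uv //.
have E : bconv (fun z => phi (x, z)) (fun z => u.2 (x, z)) z - bconv (fun z => psi (x, z)) (fun z => v.2 (x, z)) z
  = bconv (fun z => phi (x, z) - psi (x, z)) (fun z => u.2 (x, z)) z +
    bconv (fun z => psi (x, z)) (fun z => u.2 (x, z) - v.2 (x, z)) z.
  have N1 : bconv (fun z => - psi (x, z)) (fun z => u.2 (x, z)) z = - bconv (fun z => psi (x, z)) (fun z => u.2 (x, z)) z.
    exact: (bconvNl c2 c3).
  have N2 : bconv (fun z => psi (x, z)) (fun z => - v.2 (x, z)) z = - bconv (fun z => psi (x, z)) (fun z => v.2 (x, z)) z.
    exact: (bconvNr c2 c4).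
  rewrite (bconvDl c1 (csegN c2) c3) (bconvDr c2 c3 (csegN c4)).
  by rewrite N1 N2; move: (bconv _ _ z) (bconv _ _ z) (bconv _ _ z) => A B C; ring.
have seg (t1 : R) : 0 <= t1 <= 1 -> nm (t1%:C * z) = t1 * nm z.
  by move=> /andP[h _]; rewrite nmM nmR ger0_norm.
rewrite opprD addrACA E -mulrBr.
have -> : (s * (c + a) - s' * (c + a')) * wt (nm z) =
  c * ((s - s') * wt (nm z)) + ((s - s') * a * wt (nm z) + s' * (a - a') * wt (nm z)) by ring.
apply: le_trans (nmD _ _) _; apply: lerD.
  by rewrite nmM; apply: ler_pM; rewrite ?nm_ge0 //; [exact: uc|exact: wd].
have ss0 : 0 <= s - s' by rewrite subr_ge0.
have aa0 : 0 <= a - a' by rewrite subr_ge0.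
apply: le_trans (nmD _ _) _; apply: lerD.
  apply: (bconv_wt lam0 ss0 a0 (csegD c1 (csegN c2)) c3) => t1 t01.
    by rewrite -seg //; apply: wd => //; exact: star.
  by rewrite -seg //; apply: ub => //; exact: star.
apply: (bconv_wt lam0 s'0 aa0 c2 (csegD c3 (csegN c4))) => t1 t01.
  by rewrite -seg //; apply: qb => //; exact: star.
by rewrite -seg //; apply: ud => //; exact: star.
Qed.

Lemma majE_mon (w w' : 'I_N -> V * K -> K) (s s' : R) al u v t t' :
  (forall j, majW (w j) (w' j) s s') -> majE u v t t' ->
  majE (monE w al u) (monE w' al v) (s ^+ (\sum_j al j)%N * t) (s' ^+ (\sum_j al j)%N * t').
Proof.
move=> hw huv; rewrite /monE.
have -> : (\sum_j al j)%N = (\sum_(j <- enum 'I_N) al j)%N by rewrite big_enum.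
elim: (enum 'I_N) => [|j l IH] /=; first by rewrite big_nil !expr0 !mul1r.
rewrite big_cons; elim: (al j) => [//|k IHk] /=.
by rewrite !addSn !exprS -!mulrA; apply: majE_mul.
Qed.

Variables (a : ('I_N -> nat) -> 'I_N -> V -> K) (b : ('I_N -> nat) -> 'I_N -> V * K -> K).
Variables (Ca rho delta S : R).
Notation deg al := (\sum_j al j)%N.
Hypotheses (Ca0 : 0 <= Ca) (rho0 : 0 < rho) (delta0 : 0 <= delta) (S0 : 0 < S)
  (ha : forall al i, holomorphic X0 (a al i))
  (aC : forall al i x, X0 x -> nm (a al i x) <= Ca / rho ^+ deg al)
  (a1 : forall al i, (deg al <= 1)%N -> a al i = fun=> 0)
  (hb : forall al i, wadm (b al i) (delta / rho ^+ deg al))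
  (Srho : 2 * S <= rho) (HS : 2 ^+ N * (delta + 4 * Ca * (S / rho) ^+ 2) <= S).

(* The box of multi-indices grows with the step, so that every sum is finite. *)
Definition pstep n (w : 'I_N -> V * K -> K) (i : 'I_N) : V * K -> K := fun q =>
  - \sum_(al : {ffun 'I_N -> 'I_n.+2}) (monE w (fun j => al j) (a (fun j => al j) i, b (fun j => al j) i)).2 q.

Fixpoint pic n : 'I_N -> V * K -> K := if n is m.+1 then pstep m (pic m) else fun _ _ => 0.

Definition tau (al : 'I_N -> nat) : R := ((if (deg al <= 1)%N then 0 else Ca) + delta) / rho ^+ deg al.

Definition maj_step n (s : R) : R := \sum_(al : {ffun 'I_N -> 'I_n.+2}) s ^+ deg (fun j => al j) * tau (fun j => al j).

Fixpoint maj n : R := if n is m.+1 then maj_step m (maj m) else 0.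

Lemma tau_ge0 al : 0 <= tau al.
Proof.
apply: divr_ge0; last by rewrite exprn_ge0 // ltW.
by apply: addr_ge0 => //; case: ifP.
Qed.

Lemma coef_maj al i : majE (a al i, b al i) (a al i, b al i) (tau al) (tau al).
Proof.
have r0 : 0 <= rho ^+ deg al by rewrite exprn_ge0 // ltW.
exists ((if (deg al <= 1)%N then 0 else Ca) / rho ^+ deg al), (delta / rho ^+ deg al), (delta / rho ^+ deg al).
split; first by split; rewrite // /tau ?mulrDl // divr_ge0 //; case: ifP.
split.
- exact: (@ha al i).
- by move=> x _.
- move=> x Xx; case: ifP => d1; last exact: aC.
  by rewrite /= a1 // nm0 mul0r.
- by split; exact: hb.
- by move=> x z _ _; rewrite !subrr nm0 mul0r.
Qed.

(** Each term is at most a constant times 2^-|alpha|: for |alpha| <= 1 only [delta] occurs, and for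
    degree d >= 2 one has (S/rho)^d = (2S/rho)^d 2^-d <= (2S/rho)^2 2^-d. The sum of 2^-|alpha| over
    a box of any size is at most 2^N, so the bound is uniform in [n]. *)
Lemma maj_box n s : 0 <= s -> s <= S -> maj_step n s <= S.
Proof.
move=> s0 sS; apply: le_trans HS.
have q0 : 0 <= S / rho by rewrite divr_ge0 ?ltW.
have q2 : S / rho <= 2^-1 by rewrite ler_pdivrMr // mulrC ler_pdivlMr // mulrC.
pose A := delta + 4 * Ca * (S / rho) ^+ 2.
have A0 : 0 <= A by rewrite addr_ge0 // mulr_ge0 ?sqr_ge0 // mulr_ge0.
have term (al : 'I_N -> nat) : s ^+ deg al * tau al <= A * \prod_j (2^-1) ^+ al j.
  rewrite [X in _ <= A * X]prodrXr; set d := deg al.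
  rewrite /tau -/d; set c := if _ then _ else _.
  have c0 : 0 <= c by rewrite /c; case: ifP.
  have -> : s ^+ d * ((c + delta) / rho ^+ d) = (c + delta) * (s / rho) ^+ d.
    by rewrite expr_div_n mulrCA.
  have sr : s / rho <= S / rho by rewrite ler_wpM2r // invr_ge0 ltW.
  have sr0 : 0 <= s / rho by rewrite divr_ge0 // ltW.
  have h1 : (s / rho) ^+ d <= (S / rho) ^+ d by rewrite lerXn2r ?nnegrE.
  have h2 : (S / rho) ^+ d <= 2^-1 ^+ d by rewrite lerXn2r ?nnegrE ?invr_ge0.
  have p2 : 0 <= (2^-1 : R) ^+ d by rewrite exprn_ge0 // invr_ge0.
  apply: (@le_trans _ _ ((c + delta) * (S / rho) ^+ d)).
    by apply: ler_wpM2l => //; exact: addr_ge0.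
  rewrite /c; case: ifPn => d1.
    rewrite add0r; apply: ler_pM => //; first by rewrite exprn_ge0.
    by rewrite /A lerDl mulr_ge0 ?sqr_ge0 // mulr_ge0.
  rewrite mulrDl /A addrC mulrDl; apply: lerD; first exact: ler_wpM2l.
  have -> : (S / rho) ^+ d = (2 * (S / rho)) ^+ d * 2^-1 ^+ d.
    by rewrite -exprMn mulrAC divff ?mul1r.
  rewrite mulrA; apply: ler_wpM2r => //.
  have -> : 4 * Ca * (S / rho) ^+ 2 = Ca * (2 * (S / rho)) ^+ 2 by ring.
  apply: ler_wpM2l => //; apply: ler_wiXn2l; first exact: mulr_ge0.
    by rewrite mulrC -ler_pdivlMr // mul1r.
  by rewrite ltnNge.
rewrite /maj_step.
apply: (@le_trans _ _ (\sum_(al : {ffun 'I_N -> 'I_n.+2}) A * \prod_j (2^-1) ^+ al j)).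
  by apply: ler_sum => al _; exact: (term (fun j => al j)).
rewrite -mulr_sumr mulrC; apply: ler_wpM2r => //.
rewrite -(bigA_distr_bigA (fun (_ : 'I_N) (k : 'I_n.+2) => 2^-1 ^+ k : R)).
have geo m : \sum_(k < m) (2^-1 : R) ^+ k = 2 - 2 * 2^-1 ^+ m.
  elim: m => [|m IH]; first by rewrite big_ord0 expr0; ring.
  by rewrite big_ord_recr /= IH exprS; field.
rewrite -[leRHS](_ : \prod_(j < N) 2 = _); last by rewrite prodr_const card_ord.
apply: ler_prod => j _; rewrite geo; apply/andP; split.
  by rewrite subr_ge0 ger_pMr // exprn_ile1 ?invr_ge0 // invf_le1 // ler1n.
by rewrite gerBl mulr_ge0 // exprn_ge0 // invr_ge0.
Qed.

Lemma wadm_le phi s s' : s <= s' -> wadm phi s -> wadm phi s'.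
Proof.
move=> ss [h1 h2]; split=> // x z Xx Tz; apply: le_trans (h2 x z Xx Tz) _.
by rewrite ler_wpM2r // wt_ge0.
Qed.

Lemma wadm0 : wadm (fun=> 0) 0.
Proof. by split=> [q _|x z _ _]; [exact: dfC|rewrite nm0 mul0r]. Qed.

Lemma majE_W u v t t' : majE u v t t' -> majW u.2 v.2 t t'.
Proof.
move=> [c [s [s' [[-> -> c0 s'0 ss] [_ _ _ [wu wv] d]]]]].
split; first exact: addr_ge0.
- by rewrite lerD2l.
- by apply: wadm_le wu; rewrite lerDr.
- by apply: wadm_le wv; rewrite lerDr.
- by move=> x z Xx Tz; rewrite opprD addrACA subrr add0r; exact: d.
Qed.

Lemma majW_zero phi psi s s' : majW phi psi s s' -> majW phi (fun=> 0) s 0.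
Proof.
move=> [s'0 ss wp _ _]; split; [exact: lexx|exact: le_trans ss|exact: wp|exact: wadm0|].
by move=> x z Xx Tz; rewrite !subr0; exact: wp.2.
Qed.

Lemma majW00 : majW (fun=> 0) (fun=> 0) 0 0.
Proof.
split; [exact: lexx|exact: lexx|exact: wadm0|exact: wadm0|].
by move=> x z _ _; rewrite !subr0 nm0 mul0r.
Qed.

Lemma majWD phi psi phi' psi' s s' t t' : majW phi psi s s' -> majW phi' psi' t t' ->
  majW (fun q => phi q + phi' q) (fun q => psi q + psi' q) (s + t) (s' + t').
Proof.
move=> [a0 b0 c0 d0 e0] [a2 b2 c2 d2 e2]; split.
- exact: addr_ge0.
- exact: lerD.
- exact: wadmD.
- exact: wadmD.
- move=> x z Xx Tz; rewrite !opprD addrACA [s + t + _]addrACA mulrDl.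
  by apply: le_trans (nmD _ _) _; apply: lerD; [exact: e0|exact: e2].
Qed.

Lemma wadmN phi s : wadm phi s -> wadm (fun q => - phi q) s.
Proof.
move=> [h1 h2]; split=> [q Dq|x z Xx Tz]; first by apply: dfN; exact: h1.
by rewrite nmN; exact: h2.
Qed.

Lemma majWN phi psi s s' : majW phi psi s s' -> majW (fun q => - phi q) (fun q => - psi q) s s'.
Proof.
move=> [h1 h2 h3 h4 h5]; split; [exact: h1|exact: h2|exact: wadmN|exact: wadmN|].
by move=> x z Xx Tz; rewrite -opprD nmN; exact: h5.
Qed.

Lemma majW_sum I (r : seq I) (f g : I -> V * K -> K) (t t' : I -> R) :
  (forall i, majW (f i) (g i) (t i) (t' i)) ->
  majW (fun q => \sum_(i <- r) f i q) (fun q => \sum_(i <- r) g i q) (\sum_(i <- r) t i) (\sum_(i <- r) t' i).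
Proof.
move=> H; elim: r => [|i r IH].
  rewrite !big_nil; under eq_fun do rewrite big_nil.
  rewrite [X in majW _ X](_ : _ = fun=> 0); last by apply/funext => q; rewrite big_nil.
  exact: majW00.
rewrite !big_cons; under eq_fun do rewrite big_cons.
rewrite [X in majW _ X](_ : _ = fun q => g i q + \sum_(i <- r) g i q); last by apply/funext => q; rewrite big_cons.
exact: majWD.
Qed.

Lemma majW_pstep0 n (w : 'I_N -> V * K -> K) s s' : 0 <= s ->
  (forall j, majW (w j) (fun=> 0) s s') ->
  forall i, majW (pstep n w i) (fun=> 0) (maj_step n s) 0.
Proof.
move=> s0 hw i; rewrite /pstep /maj_step.
pose f (al : {ffun 'I_N -> 'I_n.+2}) := (monE w (fun j => al j) (a (fun j => al j) i, b (fun j => al j) i)).2.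
have H al : majW (f al) (fun=> 0) (s ^+ deg (fun j => al j) * tau (fun j => al j)) 0.
  by apply: majW_zero (majE_W (majE_mon _ hw (coef_maj _ i))).
have := majWN (majW_sum (index_enum _) H).
by rewrite big1_eq oppr0 big1_eq.
Qed.

(** The multi-indices missing from the smaller box count as terms equal to 0, and a term compared
    with 0 is majorized by its own size, so enlarging the box is compatible with the majorization of
    differences. *)
Lemma majW_pstep n (w w' : 'I_N -> V * K -> K) s s' :
  (forall j, majW (w j) (w' j) s s') ->
  forall i, majW (pstep n.+1 w i) (pstep n w' i) (maj_step n.+1 s) (maj_step n s').
Proof.
move=> hw i.
pose f w al := (monE w al (a al i, b al i)).2.
have E q : pstep n w' i q = - \sum_(al : {ffun 'I_N -> 'I_n.+3})
    (if [forall j, (al j <= n.+1)%N] then f w' (fun j => al j) else (fun=> 0)) q.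
  rewrite /pstep (sum_box_widen (fun al => f w' al q) (leqnSn n.+1)) big_mkcond.
  by congr (- _); apply: eq_bigr => al _; case: ifP.
have -> : pstep n w' i = fun q => - \sum_(al : {ffun 'I_N -> 'I_n.+3})
    (if [forall j, (al j <= n.+1)%N] then f w' (fun j => al j) else (fun=> 0)) q.
  by apply/funext => q; exact: E.
have -> : maj_step n s' = \sum_(al : {ffun 'I_N -> 'I_n.+3})
    (if [forall j, (al j <= n.+1)%N] then s' ^+ deg (fun j => al j) * tau (fun j => al j) else 0).
  rewrite /maj_step (sum_box_widen (fun al => s' ^+ deg al * tau al) (leqnSn n.+1)) big_mkcond.
  by apply: eq_bigr => al _; case: ifP.
apply: majWN; apply: majW_sum => al.
have h := majE_W (majE_mon (fun j => al j) hw (coef_maj (fun j => al j) i)).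
by case: ifP => _; [exact: h|exact: majW_zero h].
Qed.

(** Majorization of two consecutive iterates reproduces itself under one step, and the monotonicity
    of the scalar sequence needs the same enlargement of the box; hence a single induction. *)
Lemma maj_pair n : [/\ 0 <= maj n, maj n <= maj n.+1, maj n.+1 <= S &
  forall i, majW (pic n.+1 i) (pic n i) (maj n.+1) (maj n)].
Proof.
have S1 : 0 <= S by exact: ltW.
elim: n => [|n [m0 m1 mS IH]].
  split; [exact: lexx| | |].
  - by rewrite /= /maj_step; apply: sumr_ge0 => al _; rewrite mulr_ge0 ?tau_ge0 // exprn_ge0.
  - exact: maj_box.
  - exact: (majW_pstep0 (w := fun _ => fun=> 0) 0 (lexx 0) (fun _ => majW00)).
have H := majW_pstep n IH.
have m10 : 0 <= maj n.+1 := le_trans m0 m1.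
split=> //.
- change (maj_step n (maj n) <= maj_step n.+1 (maj n.+1)).
  rewrite {1}/maj_step (sum_box_widen (fun al => maj n ^+ deg al * tau al) (leqnSn n.+1)) big_mkcond.
  apply: ler_sum => al _; case: ifP => _; last by rewrite mulr_ge0 ?tau_ge0 // exprn_ge0.
  by rewrite ler_wpM2r ?tau_ge0 // lerXn2r ?nnegrE.
- exact: maj_box.
Qed.

Lemma pic_wadm n i : wadm (pic n i) S.
Proof. by have [_ m1 mS H] := maj_pair n; have [_ _ _ w _] := H i; apply: wadm_le w; exact: le_trans mS. Qed.

Lemma Om_ball (x : V) (z : K) : X0 x -> T z -> exists2 r : R, 0 < r &
  forall q : V * K, nm (q - (x, z)) < r -> X0 q.1 /\ T q.2.
Proof.
move=> Xx Tz.
have /nbhs_nmP[r1 r10 Hr1] : nbhs x X0 by exact: open_nbhs_nbhs.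
have /nbhs_nmP[r2 r20 Hr2] : nbhs z T by exact: open_nbhs_nbhs.
exists (Num.min r1 r2) => [|q qr]; first by rewrite lt_min r10.
split.
  by apply: Hr1; apply: le_lt_trans (nm_fst (q - (x, z))) _; apply: lt_le_trans qr _; rewrite ge_min lexx.
by apply: Hr2; apply: le_lt_trans (nm_snd (q - (x, z))) _; apply: lt_le_trans qr _; rewrite ge_min lexx orbT.
Qed.

(** The rate is [limn maj - maj n]: the increasing bounded sequence of majorants converges and
    controls all differences of iterates. Holomorphy of the limit is [holo_lim], with a local bound
    given by [S] times the weight. *)
Lemma pic_limit : exists (phi : 'I_N -> V * K -> K) (eps : nat -> R),
  (forall n, 0 <= eps n) /\ (forall e, 0 < e -> exists n0, forall n, (n0 <= n)%N -> eps n <= e) /\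
  forall i, wadm (phi i) S /\
  forall n x z, X0 x -> T z -> nm (phi i (x, z) - pic n i (x, z)) <= eps n * wt (nm z).
Proof.
have nd : nondecreasing_seq maj.
  by apply/nondecreasing_seqP => n; have [] := maj_pair n.
have bd n : maj n <= S by have [_ m1 mS _] := maj_pair n; exact: le_trans mS.
have cv : cvgn maj.
  by apply: nondecreasing_is_cvgn => //; exists S => _ [n _ <-].
pose l := limn maj.
have ml n : maj n <= l by exact: nondecreasing_cvgn_le.
have diff n m i x z : X0 x -> T z -> (n <= m)%N ->
    nm (pic m i (x, z) - pic n i (x, z)) <= (maj m - maj n) * wt (nm z).
  move=> Xx Tz; elim: m => [|m IH]; first by rewrite leqn0 => /eqP ->; rewrite !subrr nm0 mul0r.
  rewrite leq_eqVlt => /predU1P[->|]; first by rewrite !subrr nm0 mul0r.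
  rewrite ltnS => /IH h; have [_ _ _ /(_ i)[_ _ _ _ d]] := maj_pair m.
  apply: le_trans (nm_tri (pic m i (x, z)) _ _) _.
  have -> : (maj m.+1 - maj n) * wt (nm z) = (maj m.+1 - maj m) * wt (nm z) + (maj m - maj n) * wt (nm z) by ring.
  by apply: lerD => //; exact: d.
have ex i q : exists y, X0 q.1 -> T q.2 -> tends (fun n => pic n i q) y.
  have [[Xq Tq]|nq] := pselect (X0 q.1 /\ T q.2); last by exists 0 => h1 h2; case: nq.
  have [n m /andP[_ nm_]||y ty _] := cauchy_limit (u := fun n => pic n i q) (e := fun n => (l - maj n) * wt (nm q.2)) (N := 0%N).
  - have := @diff n m i q.1 q.2 Xq Tq nm_; rewrite -surjective_pairing => h.
    apply: le_trans h _; by rewrite ler_wpM2r ?wt_ge0 // lerD2r.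
  - rewrite -[X in _ --> X](mul0r (wt (nm q.2))); apply: cvgMl.
    by rewrite -(subrr l); apply: cvgB; [exact: cvg_cst|exact: cv].
  - by exists y.
pose phi i q := sval (cid (ex i q)).
have tphi i q : X0 q.1 -> T q.2 -> tends (fun n => pic n i q) (phi i q).
  by move=> Xq Tq; rewrite /phi; case: cid => y /= h; exact: h.
exists phi, (fun n => l - maj n); split; first by move=> n; rewrite subr_ge0.
split.
  move=> e e0; have /cvgrPdist_le/(_ e e0)[n0 _ H] := cv; exists n0 => n n0n.
  by apply: le_trans (ler_norm _) _; exact: H.
move=> i; split; last first.
  move=> n x z Xx Tz.
  apply: (tends_le (u := fun m => pic m i (x, z) - pic n i (x, z))).
    by apply: tendsB; [exact: (tphi i (x, z))|exact: tends_cst].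
  exists n => m nm_; apply: le_trans (@diff n m i x z Xx Tz nm_) _.
  by rewrite ler_wpM2r ?wt_ge0 // lerD2r.
split.
  move=> [x z] [/= Xx Tz]; have [r r0 Hr] := Om_ball Xx Tz.
  apply: (@holo_lim _ _ (fun n => pic n i) (phi i) (x, z) r (S * (lam / 4 * expR ((L + lam) * (nm z + r))))) => //.
  - by move=> n q /Hr[Xq Tq]; apply: (pic_wadm n i).1.
  - move=> n q qr; have [Xq Tq] := Hr q qr.
    have := (pic_wadm n i).2 q.1 q.2 Xq Tq; rewrite -surjective_pairing => /le_trans; apply.
    apply: ler_wpM2l; first exact: ltW.
    apply: le_trans (wt_le_exp L lam0 (nm_ge0 _)) _.
    apply: ler_wpM2l; first by rewrite divr_ge0 // ltW.
    rewrite ler_expR; apply: ler_wpM2l; first by rewrite ltW // addr_gt0.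
    rewrite -[q.2](subrK z) addrC; apply: le_trans (nmD _ _) _; rewrite lerD2l.
    by apply: le_trans (nm_snd (q - (x, z))) (ltW _).
  - by move=> q /Hr[Xq Tq]; exact: tphi.
move=> x z Xx Tz; apply: (tends_le (tphi i (x, z) Xx Tz)).
by exists 0%N => n _; exact: (pic_wadm n i).2.
Qed.

End Picard.

(** * The iteration on formal power series *)

Section Formal.
Variables (K : fieldType) (N : nat).
Notation deg al := (\sum_(j < N) al j)%N.
Implicit Types (P Q : {poly K}) (v : 'I_N -> {poly K}) (A : ('I_N -> nat) -> 'I_N -> {poly K}).

(** Power series modulo X^n are represented by polynomials, congruence being divisibility of the
    difference by X^n. *)
Lemma dvdXnP n P : reflect (forall k, (k < n)%N -> P`_k = 0) ('X^n %| P).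
Proof.
apply: (iffP idP) => [/dvdpP[Q ->] k kn|H]; first by rewrite coefMXn kn.
apply/dvdpP; exists (drop_poly n P).
rewrite -[LHS](poly_take_drop n) [take_poly n P](_ : _ = 0) ?add0r //.
by apply/polyP => k; rewrite coef_take_poly coef0; case: ifP => // /H.
Qed.

Lemma dvdXn_le m n P : (m <= n)%N -> 'X^n %| P -> 'X^m %| P.
Proof. by move=> mn; apply: dvdp_trans; exact: dvdp_exp2l. Qed.

Definition mprod v (al : 'I_N -> nat) := \prod_j v j ^+ al j.
Definition fterm v A al i := mprod v al * A al i.

Lemma dvdXn_mprod v al : (forall j, 'X %| v j) -> 'X^(deg al) %| mprod v al.
Proof.
move=> Xv; rewrite /mprod -prodrXr.
elim/big_ind2: _ => [|P P' Q Q'|j _]; [exact: dvdpp|exact: dvdp_mul|exact: dvdp_exp2r].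
Qed.

Lemma dvdp_sum (I : Type) (r : seq I) (p : pred I) (F : I -> {poly K}) P :
  (forall i, p i -> P %| F i) -> P %| \sum_(i <- r | p i) F i.
Proof. by move=> H; elim/big_ind: _ => [|Q Q' h h'|i /H //]; [exact: dvdp0|exact: dvdp_add]. Qed.

(* The factor ['X] makes the statement multiplicative, including [alpha = 0]. *)
Lemma dvdXn_mprodB v v' n al : (forall j, 'X %| v j) -> (forall j, 'X %| v' j) ->
  (forall j, 'X^n %| v j - v' j) ->
  'X^(n + deg al) %| 'X * (mprod v al - mprod v' al).
Proof.
move=> Xv Xv' H; rewrite /mprod.
pose E (a : nat) (P P' : {poly K}) := [/\ 'X^a %| P, 'X^a %| P' & 'X^(n + a) %| 'X * (P - P')].
have E1 : E 0%N 1 1 by split; rewrite ?expr0 ?dvd1p // subrr mulr0 dvdp0.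
have EM a P P' b Q Q' : E a P P' -> E b Q Q' -> E (a + b)%N (P * Q) (P' * Q').
  move=> [h1 h2 h3] [k1 k2 k3]; split; [by rewrite exprD dvdp_mul|by rewrite exprD dvdp_mul|].
  have -> : 'X * (P * Q - P' * Q') = ('X * (P - P')) * Q + P' * ('X * (Q - Q')) by ring.
  apply: dvdp_add; first by rewrite addnA exprD dvdp_mul.
  by rewrite addnCA exprD dvdp_mul.
have EX j k : E k (v j ^+ k) (v' j ^+ k).
  elim: k => [//|k IH]; rewrite !exprS -add1n; apply: EM => //.
  by split; rewrite ?expr1 // exprD mulrC expr1 dvdp_mul.
suff [] : E (deg al) (\prod_j v j ^+ al j) (\prod_j v' j ^+ al j) by [].
by elim/big_ind3: _ => [|a P P' b Q Q'|j _]; [exact: E1|exact: EM|exact: EX].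
Qed.

(** Each term gains one order: in degree 0 it does not depend on [v], in degree 1 the coefficient
    has a factor X, and in degree at least 2 the monomial has a spare factor divisible by X. *)
Lemma fterm_cong v v' A n al i : (forall j, 'X %| v j) -> (forall j, 'X %| v' j) ->
  (forall j, 'X^n %| v j - v' j) -> ((deg al <= 1)%N -> 'X %| A al i) ->
  'X^(n.+1) %| fterm v A al i - fterm v' A al i.
Proof.
move=> Xv Xv' H HA; rewrite /fterm -mulrBl.
have h := dvdXn_mprodB al Xv Xv' H.
have XX k P : ('X^(k.+1) %| 'X * P) = ('X^k %| P).
  by rewrite exprS dvdp_mul2l // polyX_eq0.
have [d0|d0] := eqVneq (deg al) 0%N.
  suff E w : mprod w al = 1 by rewrite !E subrr mul0r dvdp0.
  rewrite /mprod big1 // => j _; have /eqP := d0; rewrite sum_nat_eq0 => /forallP/(_ j) /=.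
  by move=> /eqP ->.
have [d1|d1] := leqP (deg al) 1.
  rewrite -addn1 exprD expr1; apply: dvdp_mul; last exact: HA.
  by rewrite -XX -addn1; apply: dvdXn_le h; rewrite leq_add2l lt0n.
apply: dvdp_mulr; rewrite -XX; apply: dvdXn_le h; by rewrite -addn2 leq_add2l.
Qed.

(** A multi-index outside the smaller box has an entry above m, hence its monomial is divisible by
    X^(m+1): finite boxes lose nothing at this precision. *)
Lemma fsum_box v A m M i : (m <= M)%N -> (forall j, 'X %| v j) ->
  'X^(m.+1) %| (\sum_(al : {ffun 'I_N -> 'I_M.+1}) fterm v A (fun j => al j) i) -
               (\sum_(al : {ffun 'I_N -> 'I_m.+1}) fterm v A (fun j => al j) i).
Proof.
move=> mM Xv; rewrite (sum_box_widen (fun al => fterm v A al i) mM).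
rewrite (bigID (fun al : {ffun 'I_N -> 'I_M.+1} => [forall j, (al j <= m)%N])) /=.
rewrite addrAC subrr add0r; apply: dvdp_sum => al; rewrite negb_forall => /existsP[j].
rewrite -ltnNge => mj; apply: dvdp_mulr; apply: dvdXn_le (dvdXn_mprod _ Xv).
by apply: leq_trans mj _; rewrite (bigD1 j) //= leq_addr.
Qed.

Definition fstep A n v i := - \sum_(al : {ffun 'I_N -> 'I_n.+2}) fterm v A (fun j => al j) i.

Fixpoint fpic A n : 'I_N -> {poly K} := if n is m.+1 then fstep A m (fpic A m) else fun=> 0.

Section Fpic.
Variable A : ('I_N -> nat) -> 'I_N -> {poly K}.
Hypothesis HA : forall al i, (deg al <= 1)%N -> 'X %| A al i.

Lemma dvdX_fpic n i : 'X %| fpic A n i.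
Proof.
elim: n i => [|n IH] i; first exact: dvdp0.
rewrite /= /fstep dvdpNr; apply: dvdp_sum => al _.
have [d0|d0] := leqP (deg (fun j => al j)) 1; first by apply: dvdp_mull; exact: HA.
apply: dvdp_mulr; rewrite -['X]expr1; apply: dvdXn_le (dvdXn_mprod _ IH); exact: ltnW.
Qed.

Lemma fstep_cong n m M v v' i : (m <= n)%N -> (m <= M)%N -> 
  (forall j, 'X %| v j) -> (forall j, 'X %| v' j) -> (forall j, 'X^(m.+1) %| v j - v' j) ->
  'X^(m.+2) %| fstep A n v i - fstep A M v' i.
Proof.
move=> mn mM Xv Xv' H.
have B k w : (m <= k)%N -> (forall j, 'X %| w j) -> 'X^(m.+2) %| fstep A k w i - fstep A m w i.
  by move=> mk Xw; rewrite /fstep -opprD dvdpNr; apply: fsum_box.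
have h1 := B _ _ mn Xv; have h2 := B _ _ mM Xv'.
have h3 : 'X^(m.+2) %| fstep A m v i - fstep A m v' i.
  rewrite /fstep -opprD dvdpNr -sumrB; apply: dvdp_sum => al _.
  by apply: fterm_cong => //; exact: HA.
have -> : fstep A n v i - fstep A M v' i = (fstep A n v i - fstep A m v i) +
  (fstep A m v i - fstep A m v' i) - (fstep A M v' i - fstep A m v' i) by ring.
by apply: dvdp_sub => //; exact: dvdp_add.
Qed.

(** The start 0 is already right modulo X, because every iterate is divisible by X; hence n steps
    give precision X^(n+1). *)
Lemma fpic_stab n m i : (n <= m)%N -> 'X^(n.+1) %| fpic A m i - fpic A n i.
Proof.
elim: n m i => [|n IH] m i; first by rewrite expr1 subr0 dvdX_fpic.
case: m => // m nm; apply: fstep_cong => //; [exact: dvdX_fpic|exact: dvdX_fpic|].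
by move=> j; exact: IH.
Qed.

(** [P] stands for the jets of the Picard limit: agreement with two consecutive iterates at
    precision X^(M+1) yields the equation at that precision. *)
Lemma fpic_fix (P : 'I_N -> {poly K}) M : (forall j, 'X^(M.+1) %| P j - fpic A M j) ->
  (forall j, 'X^(M.+1) %| P j - fpic A M.+1 j) ->
  forall i, 'X^(M.+1) %| P i + \sum_(al : {ffun 'I_N -> 'I_M.+1}) fterm P A (fun j => al j) i.
Proof.
move=> H0 H1 i.
have XP j : 'X %| P j.
  rewrite -[P j](subrK (fpic A M j)); apply: dvdp_add; last exact: dvdX_fpic.
  by rewrite -['X]expr1; apply: dvdXn_le (H0 j).
have h := @fsum_box P A M M.+1 i (leqnSn M) XP.
have h2 : 'X^(M.+2) %| fstep A M P i - fstep A M (fpic A M) i.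
  by apply: fstep_cong => // j; exact: dvdX_fpic.
have h3 := dvdXn_le (leqnSn _) h2.
have -> : P i + \sum_(al : {ffun 'I_N -> 'I_M.+1}) fterm P A (fun j => al j) i =
  (P i - fpic A M.+1 i) - (fstep A M P i - fstep A M (fpic A M) i) -
  (- fstep A M P i - \sum_(al : {ffun 'I_N -> 'I_M.+1}) fterm P A (fun j => al j) i).
  by rewrite /=; ring.
apply: dvdp_sub; first by apply: dvdp_sub.
by rewrite /fstep opprK.
Qed.

(** By [fterm_cong] the coefficient of order m of the sum depends only on the lower coefficients of
    the unknown. *)
Lemma fix_unique (P Q : 'I_N -> {poly K}) m : (forall j, 'X %| P j) -> (forall j, 'X %| Q j) ->
  (forall j, 'X^m %| P j - Q j) ->
  (forall i, (P i + \sum_(al : {ffun 'I_N -> 'I_m.+1}) fterm P A (fun j => al j) i)`_m = 0) ->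
  (forall i, (Q i + \sum_(al : {ffun 'I_N -> 'I_m.+1}) fterm Q A (fun j => al j) i)`_m = 0) ->
  forall i, (P i)`_m = (Q i)`_m.
Proof.
move=> XP XQ H EP EQ i.
have /dvdXnP/(_ m (ltnSn m)) : 'X^(m.+1) %| \sum_(al : {ffun 'I_N -> 'I_m.+1}) fterm P A (fun j => al j) i
   - \sum_(al : {ffun 'I_N -> 'I_m.+1}) fterm Q A (fun j => al j) i.
  by rewrite -sumrB; apply: dvdp_sum => al _; apply: fterm_cong => //; exact: HA.
rewrite coefB => /eqP; rewrite subr_eq0 => /eqP h.
have E w : (w i + \sum_(al : {ffun 'I_N -> 'I_m.+1}) fterm w A (fun j => al j) i)`_m =
  (w i)`_m + (\sum_(al : {ffun 'I_N -> 'I_m.+1}) fterm w A (fun j => al j) i)`_m by rewrite coefD.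
by have := etrans (EP i) (esym (EQ i)); rewrite !E h => /addIr.
Qed.
End Fpic.
End Formal.

(** * Formal substitution rewritten as a fixed point equation *)

Section SubstCoef.
Context {R : realType}.
Notation K := R[i].
Variable N : nat.
Notation deg al := (\sum_(j < N) al j)%N.

Lemma partial_id (W : normedModType K) (g : 'rV[K]_N -> W) (al : 'I_N -> nat) :
  (deg al = 0)%N -> partial al g = g.
Proof.
move=> /eqP; rewrite sum_nat_eq0 => /forallP H; rewrite /partial.
elim: (enum 'I_N) => [//|j l IH] /=; rewrite IH.
by have /eqP -> := H j.
Qed.

Lemma partial_one (W : normedModType K) (g : 'rV[K]_N -> W) (j : 'I_N) :
  partial (fun j' => (j' == j) : nat) g = (fun z => 'D_(delta_mx 0 j) g z).
Proof.
rewrite /partial; have : j \in enum 'I_N by rewrite mem_enum.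
have := enum_uniq 'I_N.
have E (l : seq 'I_N) : j \notin l -> foldr (fun j' => iter (j' == j) (fun h z => 'D_(delta_mx 0 j') h z)) g l = g.
  elim: l => [//|k l IH]; rewrite inE negb_or => /andP[kj jl] /=; rewrite IH //.
  by rewrite eq_sym (negPf kj).
elim: (enum 'I_N) => [//|k l IH] /= /andP[kl ul]; rewrite !inE.
have [jk|kj] := eqVneq j k; first by move=> _; rewrite /= E jk.
by move=> /(IH ul).
Qed.

Definition wpoly (a : nat -> 'rV[K]_N) m (j : 'I_N) : {poly K} :=
  \poly_(n < m.+1) (if n == 0%N then 0 else a n 0 j).

(** The coefficients of hbar^0 in degree at most 1 are removed: they form the linear part, which
    [subst_coef_fix] accounts for as the unknown itself. *)
Definition apoly (E : ('I_N -> nat) -> nat -> 'I_N -> K) m (al : 'I_N -> nat) (i : 'I_N) : {poly K} :=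
  \poly_(k < m.+1) (if (deg al <= 1)%N && (k == 0%N) then 0 else E al k i).

Lemma dvdX_wpoly a m j : 'X %| wpoly a m j.
Proof. by rewrite -['X]expr1; apply/dvdXnP => -[|//] _; rewrite coef_poly. Qed.

Lemma dvdX_apoly E m al i : (deg al <= 1)%N -> 'X %| apoly E m al i.
Proof. by move=> d1; rewrite -['X]expr1; apply/dvdXnP => -[|//] _; rewrite coef_poly /= d1. Qed.

Lemma subst_coef0 (G : nat -> 'rV[K]_N -> 'rV[K]_N) (a : nat -> 'rV[K]_N) :
  subst_coef G a 0 = G 0%N (a 0%N).
Proof.
rewrite /subst_coef big_ord1 /=.
rewrite (bigD1 [ffun=> ord0]) //= [X in _ + X]big1 ?addr0; last first.
  by move=> al /negP[]; apply/eqP/ffunP => j; rewrite ffunE [al j]ord1.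
have Z (j : 'I_N) : [ffun=> ord0 : 'I_1] j = 0%N :> nat by rewrite ffunE.
have -> : (\prod_(j < N) ([ffun=> ord0 : 'I_1] j)`! = 1)%N by apply: big1 => j _; rewrite Z.
have -> : \prod_(j < N) (\poly_(n < 1) (if n == 0%N then 0 else a n 0 j)) ^+ [ffun=> ord0 : 'I_1] j = 1.
  by apply: big1 => j _; rewrite Z.
by rewrite coefC /= invr1 !scale1r partial_id // big1.
Qed.

(** Multiplication by the inverse Jacobian turns the hbar^0 terms of degree 1 into the i-th unknown,
    and the one of degree 0 vanishes by [G 0%N (a 0%N) = 0]; the remaining terms are those of
    [fterm]. *)
Lemma subst_coef_fix (G : nat -> 'rV[K]_N -> 'rV[K]_N) (a : nat -> 'rV[K]_N) (J : 'M[K]_N) m i :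
  G 0%N (a 0%N) = 0 -> J \in unitmx ->
  (forall j, 'D_(delta_mx 0 j) (G 0%N) (a 0%N) = row j J) -> (0 < m)%N ->
  let A := apoly (fun al k i => (((\prod_j (al j)`!)%N%:R^-1 *: partial al (G k) (a 0%N)) *m invmx J) 0 i) m in
  (subst_coef G a m *m invmx J) 0 i = 
   (wpoly a m i + \sum_(al : {ffun 'I_N -> 'I_m.+1}) fterm (wpoly a m) A (fun j => al j) i)`_m.
Proof.
move=> G0 uJ DJ m0 /=; set w := wpoly a m.
pose E (al : 'I_N -> nat) k i := (((\prod_j (al j)`!)%N%:R^-1 *: partial al (G k) (a 0%N)) *m invmx J) 0 i.
have -> : (subst_coef G a m *m invmx J) 0 i = \sum_(al : {ffun 'I_N -> 'I_m.+1}) \sum_(k < m.+1)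
    (mprod w (fun j => al j))`_(m - k) * E (fun j => al j) k i.
  rewrite /subst_coef mulmx_suml summxE exchange_big /=; apply: eq_bigr => k _.
  rewrite mulmx_suml summxE; apply: eq_bigr => al _.
  by rewrite -scalemxAl mxE.
pose d (al : 'I_N -> nat) := if (deg al <= 1)%N then (mprod w al)`_m * E al 0%N i else 0.
have -> : \sum_(al : {ffun 'I_N -> 'I_m.+1}) \sum_(k < m.+1)
    (mprod w (fun j => al j))`_(m - k) * E (fun j => al j) k i =
  \sum_(al : {ffun 'I_N -> 'I_m.+1}) d (fun j => al j) +
  (\sum_(al : {ffun 'I_N -> 'I_m.+1}) fterm w (apoly E m) (fun j => al j) i)`_m.
  rewrite [X in _ = _ + X]coef_sum -big_split; apply: eq_bigr => al _ /=.
  rewrite /fterm mulrC coefM !big_ord_recl /= addrA; congr (_ + _).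
    by rewrite subn0 coef_poly /d /= andbT; case: ifP => _; rewrite ?mul0r ?addr0 // add0r mulrC.
  apply: eq_bigr => k _; rewrite coef_poly /= /bump /= add1n ltnS ltn_ord andbF.
  by rewrite mulrC.
rewrite coefD; congr (_ + _).
(* The unit multi-indices; they lie in the box because 0 < m. *)
pose ej (j : 'I_N) : {ffun 'I_N -> 'I_m.+1} := [ffun j' => inord (j' == j)].
have ejE j j' : ej j j' = (j' == j) :> nat.
  by rewrite ffunE inordK // ltnS; case: eqP.
have inj : injective ej.
  by move=> j j' jj; have := ejE j j; rewrite jj ejE eqxx; case: eqP.
have fe j : mprod w (fun j' => ej j j') = w j.
  rewrite /mprod (bigD1 j) //= ejE eqxx expr1 big1 ?mulr1 // => j' /negPf jj.
  by rewrite ejE jj.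
have Ee j : E (fun j' => ej j j') 0%N i = (j == i)%:R.
  rewrite /E [\prod_j0 _]big1; last by move=> j' _; rewrite ejE; case: (_ == _).
  rewrite invr1 scale1r.
  have -> : (fun j' => ej j j' : nat) = fun j' => (j' == j) : nat by apply/funext => j'; exact: ejE.
  by rewrite partial_one DJ -row_mul mulmxV // mxE mxE eq_sym.
rewrite (bigID (fun al : {ffun 'I_N -> 'I_m.+1} => al \in [set ej j | j : 'I_N])) /=.
rewrite [X in _ + X]big1 ?addr0; last first.
  move=> al nal; rewrite /d; case: ifPn => // d1.
  have [d0|d0] := eqVneq (deg (fun j => al j)) 0%N.
    by rewrite /E partial_id // G0 scaler0 mul0mx mxE mulr0.
  case/negP: nal.
  have /existsP[j j0] : [exists j, al j != 0 :> nat].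
    by rewrite -negb_forall; apply: contra d0 => /forallP H; rewrite sum_nat_eq0; apply/forallP.
  apply/imsetP; exists j => //; apply/ffunP => j'; apply/val_inj; rewrite /= ejE.
  move: d1; rewrite (bigD1 j) //=; have [->|jj] := eqVneq j' j.
    by move=> h; apply/eqP; rewrite eqn_leq lt0n j0 andbT; apply: leq_trans h; exact: leq_addr.
  rewrite (bigD1 j') //= => h; apply/eqP; rewrite -leqn0 -(leq_add2l (al j)).
  by apply: leq_trans (leq_trans h _); [rewrite leq_add2l leq_addr|rewrite addn0 lt0n].
rewrite big_imset /=; last by move=> j j' _ _; exact: inj.
rewrite (bigD1 i) //= big1 ?addr0; last first.
  move=> j /negPf ji; rewrite /d; case: ifP => // _.
  by rewrite Ee ji mulr0.
rewrite /d fe Ee eqxx mulr1 ifT //.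
by rewrite (bigD1 i) //= ejE eqxx big1 // => j /negPf ji; rewrite ejE ji.
Qed.
End SubstCoef.

(** * Jets of the Picard iterates and of their limit *)

Section Asym.
Context {R : realType}.
Notation K := R[i].

Lemma asym_nderive (g : K -> K) (r B : R) m : 0 < r ->
  (forall z, nm z < r -> differentiable g z) -> (forall z, nm z < r -> nm (g z) <= B) ->
  (forall n, nm (nderive (1 : K) n g 0) <= n`!%:R * (2 * B / (r / 3) ^+ n)) /\
  asym g (fun n => n`!%:R^-1 * nderive (1 : K) n g 0) m.
Proof.
move=> r0 dg gB; have s0 : 0 < r / 3 by rewrite divr_gt0.
have sr : 2 * (r / 3) < r by move: r0; lra.
have v1 : nm (1 : K) <= 1 by rewrite nm1.
have dg' (z : K) : nm (z - 0) < r -> differentiable g z by rewrite subr0; exact: dg.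
have gB' (z : K) : nm (z - 0) < r -> nm (g z) <= B by rewrite subr0; exact: gB.
have [h1 h2] := nderive_expansion s0 sr v1 dg' gB'; split=> //.
have B0 : 0 <= B by apply: le_trans (nm_ge0 (g 0)) (gB 0 _); rewrite nm0.
exists (4 * B / (r / 3) ^+ m), (r / 3 / 2); split; first by rewrite divr_ge0 ?mulr_ge0 // exprn_ge0 // ltW.
  by rewrite divr_gt0.
move=> z /ltW zr; have := h2 m z zr.
have -> : 0 + z *: (1 : K) = z by rewrite add0r; exact: mulr1.
by rewrite expr_div_n mulrA mulrAC.
Qed.

(** By [asym_unique] the coefficients of an expansion are Taylor coefficients, so Cauchy's estimate
    holds for them. *)
Lemma asym_coef_bound (g : K -> K) c (r B : R) m : 0 < r ->
  (forall z, nm z < r -> differentiable g z) -> (forall z, nm z < r -> nm (g z) <= B) ->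
  asym g c m -> forall k, (k < m)%N -> nm (c k) <= 2 * B / (r / 3) ^+ k.
Proof.
move=> r0 dg gB gc k km; have [h1 h2] := asym_nderive m r0 dg gB.
rewrite (asym_unique gc h2 km) nmM nmV nm_nat.
by rewrite mulrC ler_pdivrMr ?ltr0n ?fact_gt0 // mulrC; exact: h1.
Qed.

Lemma asymB (f g : K -> K) c c' m : asym f c m -> asym g c' m ->
  asym (fun z => f z - g z) (fun n => c n - c' n) m.
Proof.
move=> [C [d [C0 d0 H]]] [C' [d' [C0' d0' H']]].
exists (C + C'), (Num.min d d'); split; first exact: addr_ge0.
  by rewrite lt_min d0.
move=> z; rewrite lt_min => /andP[/H h /H' h'].
have -> : f z - g z - \sum_(n < m) (c n - c' n) * z ^+ n =
  (f z - \sum_(n < m) c n * z ^+ n) - (g z - \sum_(n < m) c' n * z ^+ n).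
  by under eq_bigr do rewrite mulrBl; rewrite sumrB; ring.
by rewrite mulrDl; apply: le_trans (nm_triB _ _) _; exact: lerD.
Qed.
End Asym.

Section Jets.
Context {R : realType}.
Notation K := R[i].
Variables (L lam : R) (V : normedModType K) (X0 : set V) (T : set K) (N : nat).
Hypotheses (L0 : 0 < L) (lam0 : 0 < lam) (oX : open X0) (oT : open T)
  (star : forall (t : R) (z : K), 0 <= t <= 1 -> T z -> T (t%:C * z)).
Variable x : V.
Hypotheses (Xx : X0 x) (T0 : T 0).
Notation wt := (wt L lam).
Notation wadm := (wadm L lam X0 T).
Notation majW := (majW L lam X0 T).
Notation majE := (majE L lam X0 T).

Let slice_near (phi : V * K -> K) : holomorphic (X0 `*` T) phi ->
  exists2 d : R, 0 < d & forall z, nm z < d -> differentiable (fun z => phi (x, z)) z.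
Proof.
move=> hp; have /nbhs_nmP[d d0 Hd] : nbhs (0 : K) T by exact: open_nbhs_nbhs.
by exists d => // z zd; apply: slice_diff hp Xx _; apply: Hd; rewrite subr0.
Qed.

(** At [x], the element c delta + psi corresponds to the series with constant coefficient c whose
    remaining part has Borel transform psi, known up to order m. *)
Definition jetE (u : (V -> K) * (V * K -> K)) (Q : {poly K}) m :=
  u.1 x = Q`_0 /\ jet (fun z => u.2 (x, z)) Q m.

Lemma jetE_mul (w : V * K -> K) u s t (P Q : {poly K}) m : majW w w s s -> majE u u t t ->
  P`_0 = 0 -> jet (fun z => w (x, z)) P m -> jetE u Q m -> jetE (mulE w u) (P * Q) m.
Proof.
move=> [_ _ [hw _] _ _] [c [a [a' [_ [_ _ _ [[hu _] _] _]]]]] P0 jw [uQ ju]; split.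
  by rewrite /= coefM big_ord1 P0 mul0r.
have [d d0 dw] := slice_near hw; have [d' d'0 du] := slice_near hu.
have := @jet_bconv _ (fun z => w (x, z)) (fun z => u.2 (x, z)) P Q m (Num.min d d').
rewrite lt_min d0 d'0 /= => /(_ isT).
rewrite /pconv /= uQ => h; apply: h; [| |exact: P0|exact: jw|exact: ju].
  by move=> z; rewrite lt_min => /andP[? _]; exact: dw.
by move=> z; rewrite lt_min => /andP[_ ?]; exact: du.
Qed.

Lemma jetE_mon (w : 'I_N -> V * K -> K) u s t (v : 'I_N -> {poly K}) Q m al :
  (forall j, majW (w j) (w j) s s) -> majE u u t t ->
  (forall j, (v j)`_0 = 0) -> (forall j, jet (fun z => w j (x, z)) (v j) m) -> jetE u Q m ->
  jetE (monE w al u) (mprod v al * Q) m.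
Proof.
move=> hw hu v0 jw ju; rewrite /monE /mprod.
have -> : \prod_j v j ^+ al j = \prod_(j <- enum 'I_N) v j ^+ al j by rewrite big_enum.
pose H (u : (V -> K) * (V * K -> K)) Q := exists2 t, majE u u t t & jetE u Q m.
suff [] : H (foldr (fun j => iter (al j) (mulE (w j))) u (enum 'I_N))
  (\prod_(j <- enum 'I_N) v j ^+ al j * Q) by [].
elim: (enum 'I_N) => [|j l [t1 h1 h2]] /=; first by exists t; rewrite ?big_nil ?mul1r.
rewrite big_cons; elim: (al j) => [|k [t2 h3 h4]] /=; first by exists t1; rewrite ?expr0 ?mul1r.
exists (s * t2); first exact: majE_mul.
by rewrite exprS -!mulrA; apply: (jetE_mul (hw j) h3) => //; move: h4; rewrite !mulrA.
Qed.

Variables (a : ('I_N -> nat) -> 'I_N -> V -> K) (b : ('I_N -> nat) -> 'I_N -> V * K -> K).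
Variables (Ca rho delta S : R).
Notation deg al := (\sum_j al j)%N.
Hypotheses (Ca0 : 0 <= Ca) (rho0 : 0 < rho) (delta0 : 0 <= delta) (S0 : 0 < S)
  (ha : forall al i, holomorphic X0 (a al i))
  (aC : forall al i x, X0 x -> nm (a al i x) <= Ca / rho ^+ deg al)
  (a1 : forall al i, (deg al <= 1)%N -> a al i = fun=> 0)
  (hb : forall al i, wadm (b al i) (delta / rho ^+ deg al))
  (Srho : 2 * S <= rho) (HS : 2 ^+ N * (delta + 4 * Ca * (S / rho) ^+ 2) <= S).
Variables (A : ('I_N -> nat) -> 'I_N -> {poly K}) (m : nat).
Hypotheses (HA : forall al i, (deg al <= 1)%N -> 'X %| A al i)
  (jA : forall al i, jetE (a al i, b al i) (A al i) m).

Lemma jet_pic n i : jet (fun z => pic a b n i (x, z)) (fpic A n i) m.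
Proof.
elim: n i => [|n IH] i; first exact: jet0.
have mw (j : 'I_N) : majW (pic a b n j) (pic a b n j) S S.
  have w : wadm (pic a b n j) S by apply: (pic_wadm L0 lam0 oX oT star Ca0 rho0 delta0 S0 ha aC a1 hb Srho HS).
  by split=> //; [exact: ltW|move=> y z _ _; rewrite !subrr nm0 mul0r].
rewrite /= /pstep /fstep; apply: jetN; apply: jet_sum => al _.
have v0 (j : 'I_N) : (fpic A n j)`_0 = 0.
  by have := dvdX_fpic HA n j; rewrite -['X]expr1 => /dvdXnP; apply.
have cm : majE (a (fun j => al j) i, b (fun j => al j) i) (a (fun j => al j) i, b (fun j => al j) i) _ _
  := coef_maj Ca0 rho0 delta0 ha aC a1 hb (fun j => al j) i.
by have [] := jetE_mon (fun j => al j) mw cm v0 IH (jA (fun j => al j) i).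
Qed.

(** Coefficients pass to the limit by Cauchy's estimate for the difference with a late iterate on a
    small disc, where it is at most a small multiple of a constant; on the formal side the
    coefficient no longer changes with the iterate. *)
Lemma phi_jet (phi : V * K -> K) (eps : nat -> R) i : wadm phi S ->
  (forall n, 0 <= eps n) -> (forall e, 0 < e -> exists n0, forall n, (n0 <= n)%N -> eps n <= e) ->
  (forall n z, T z -> nm (phi (x, z) - pic a b n i (x, z)) <= eps n * wt (nm z)) ->
  forall n k, (m <= n)%N -> (k < m)%N -> nderive (1 : K) k (fun z => phi (x, z)) 0 = (fpic A n i)`_k.+1.
Proof.
move=> wp e0 esm E n k mn km.
have [d d0 dp] := slice_near wp.1.
have /nbhs_nmP[d' d'0 Hd] : nbhs (0 : K) T by exact: open_nbhs_nbhs.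
have TT (z : K) : nm z < d' -> T z by move=> zd; apply: Hd; rewrite subr0.
pose r := Num.min d d'.
have r0 : 0 < r by rewrite lt_min d0.
pose W := lam / 4 * expR ((L + lam) * r).
have W0 : 0 <= W by rewrite mulr_ge0 ?expR_ge0 // divr_ge0 // ltW.
have wW (z : K) : nm z < r -> wt (nm z) <= W.
  move=> zr; apply: le_trans (wt_le_exp L lam0 (nm_ge0 _)) _.
  apply: ler_wpM2l; first by rewrite divr_ge0 // ltW.
  by rewrite ler_expR; apply: ler_wpM2l; [rewrite ltW // addr_gt0|exact: ltW].
have dpr (z : K) : nm z < r -> differentiable (fun z => phi (x, z)) z.
  by rewrite lt_min => /andP[h _]; exact: dp.
have bp (z : K) : nm z < r -> nm (phi (x, z)) <= S * W.
  move=> zr; have := zr; rewrite lt_min => /andP[_ /TT Tz].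
  by apply: le_trans (wp.2 x z Xx Tz) _; apply: ler_wpM2l; [exact: ltW|exact: wW].
have [_ ap] := asym_nderive m r0 dpr bp.
set c := (fun n : nat => n`!%:R^-1 * _) in ap.
have f0 : (k`!%:R : K) != 0 by rewrite pnatr_eq0 -lt0n fact_gt0.
suff Eq : c k = (fpic A n i)`_k.+1 / k`!%:R.
  by move: Eq; rewrite /c mulrC => /(mulIf (invr_neq0 f0)).
apply/eqP; rewrite -subr_eq0; apply/eqP/nm_eps0 => e egt0.
pose M := 2 * W / (r / 3) ^+ k + 1.
have M0 : 0 < M by apply: ltr_wpDl => //; apply: divr_ge0; [exact: mulr_ge0|rewrite exprn_ge0 // divr_ge0 // ltW].
have [n0 Hn0] := esm (e / M) (divr_gt0 egt0 M0).
pose n1 := maxn n n0.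
have -> : (fpic A n i)`_k.+1 = (fpic A n1 i)`_k.+1.
  have h : 'X^(n.+1) %| fpic A n1 i - fpic A n i by apply: fpic_stab HA _ _ _ _; exact: leq_maxl.
  have /eqP := (dvdXnP _ _ h) k.+1 (leq_trans (km : (k.+1 < m.+1)%N) (mn : (m.+1 <= n.+1)%N)).
  by rewrite coefB subr_eq0 => /eqP.
have w1 : wadm (pic a b n1 i) S by apply: (pic_wadm L0 lam0 oX oT star Ca0 rho0 delta0 S0 ha aC a1 hb Srho HS).
have df z : nm z < r -> differentiable (fun z => phi (x, z) - pic a b n1 i (x, z)) z.
  move=> zr; have := zr; rewrite lt_min => /andP[_ /TT Tz].
  apply: dfB; [exact: dpr|exact: slice_diff w1.1 Xx Tz].
have bd z : nm z < r -> nm (phi (x, z) - pic a b n1 i (x, z)) <= eps n1 * W.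
  move=> zr; have := zr; rewrite lt_min => /andP[_ /TT Tz].
  by apply: le_trans (E n1 z Tz) _; apply: ler_wpM2l => //; exact: wW.
have := asym_coef_bound r0 df bd (asymB ap (jet_pic n1 i)) km.
move=> /le_trans; apply.
have -> : 2 * (eps n1 * W) / (r / 3) ^+ k = eps n1 * (2 * W / (r / 3) ^+ k) by ring.
apply: (@le_trans _ _ (eps n1 * M)); first by apply: ler_wpM2l => //; rewrite lerDl.
by rewrite -ler_pdivlMr //; apply: Hn0; exact: leq_maxr.
Qed.
End Jets.

(** * The implicit function *)

Section DeriveAux.
Variable K : numFieldType.
Lemma derive_linear_num (V W : normedModType K) (f : V -> W) (L : {linear V -> W}) q v :
  differentiable f q -> 'd f q = L :> (V -> W) -> 'D_v f q = L v.
Proof. by move=> df dE; rewrite (deriveE _ df) dE. Qed.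

Lemma derive_is_linear_num (V W : normedModType K) (f : V -> W) q a u v :
  differentiable f q -> 'D_(a *: u + v) f q = a *: 'D_u f q + 'D_v f q.
Proof. by move=> df; rewrite !(deriveE _ df) linearP. Qed.

Lemma derive_zero_num (V W : normedModType K) (f : V -> W) q : differentiable f q -> 'D_0 f q = 0.
Proof. by move=> df; rewrite (deriveE _ df) linear0. Qed.

Lemma diff_deriveE (V W : normedModType K) (f : V -> W) q v : differentiable f q -> 'd f q v = 'D_v f q.
Proof. by move=> df; rewrite deriveE. Qed.
End DeriveAux.

Section Rows.
Context {R : realType}.
Notation K := R[i].

Lemma fin_radius (I : finType) (P : I -> R -> Prop) :
  (forall i, exists2 r, 0 < r & P i r) -> (forall i r r', 0 < r' -> r' <= r -> P i r -> P i r') ->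
  exists2 r, 0 < r & forall i, P i r.
Proof.
move=> ex mono.
have /choice[rr H] i : exists r, 0 < r /\ P i r by have [r] := ex i; exists r.
have r0 : 0 < \big[Num.min/1]_i rr i.
  by elim/big_ind: _ => [|x y x0 y0|i _]; [exact: ltr01|rewrite lt_min x0|have [] := H i].
exists (\big[Num.min/1]_i rr i) => // i; apply: mono r0 _ (H i).2.
exact: bigmin_le_cond.
Qed.

Lemma nm_rV_le n (v : 'rV[K]_n) (B : R) : 0 <= B -> (forall i, nm (v 0 i) <= B) -> nm v <= B.
Proof.
move=> B0 H; rewrite -le_nmP; have [E|/mx_norm_neq0[[i j] /= E]] := eqVneq (mx_norm v) 0.
  by rewrite [`|v|]E lecR.
by rewrite [`|v|]E (ord1 i) le_nmP.
Qed.

Lemma nm_coord n (v : 'rV[K]_n) i : nm (v 0 i) <= nm v.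
Proof.
rewrite -le_nmP -nmE [leRHS]mx_normE.
by rewrite -[leLHS]nngE num_le; exact: (le_bigmax _ (fun i : 'I_1 * 'I_n => `|v i.1 i.2|%:nng) (0, i)).
Qed.

Lemma nm_rVB_le n (u v : 'rV[K]_n) (B : R) : 0 <= B -> (forall i, nm (u 0 i - v 0 i) <= B) ->
  nm (u - v) <= B.
Proof. by move=> B0 H; apply: nm_rV_le => // i; have := H i; rewrite !mxE. Qed.

Lemma nm_coordB n (u v : 'rV[K]_n) i : nm (u 0 i - v 0 i) <= nm (u - v).
Proof. by have := nm_coord (u - v) i; rewrite !mxE. Qed.

Lemma nm_delta n (j : 'I_n) : nm (delta_mx 0 j : 'rV[K]_n) <= 1.
Proof. by apply: nm_rV_le => // i; rewrite mxE; case: (_ && _); rewrite ?nm1 ?nm0. Qed.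

Lemma df_coord n (v : 'rV[K]_n) i : differentiable (fun v : 'rV[K]_n => v 0 i) v.
Proof.
by apply: (@nm_linear_differentiable R _ K) => [a x y|x]; [rewrite !mxE|exact: nm_coord].
Qed.

Lemma df_entry (V : normedModType K) n (G : V -> 'rV[K]_n) q i :
  differentiable G q -> differentiable (fun q => G q 0 i) q.
Proof. by move=> dG; apply: (@df_comp _ _ _ _ G (fun v => v 0 i) q dG); exact: df_coord. Qed.

Lemma derive_sum (V : normedModType K) I (r : seq I) (c : I -> K) (g : I -> V -> K) q v :
  (forall i, differentiable (g i) q) ->
  'D_v (fun q => \sum_(i <- r) c i * g i q) q = \sum_(i <- r) c i * 'D_v (g i) q.
Proof.
move=> dg; elim: r => [|i r IH].
  rewrite big_nil; apply: etrans (derive_cst (0 : K) q v).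
  by congr ('D_v _ q); apply/funext => z; rewrite big_nil.
have dS : differentiable (fun q => \sum_(i <- r) c i * g i q) q.
  by apply: df_sum => j _; apply: dfM; [exact: dfC|exact: dg].
rewrite big_cons -IH addrC -(derive_lincomb _ _ dS (dg i)); congr ('D_v _ q).
by apply/funext => z; rewrite big_cons addrC.
Qed.

Lemma df_snd_coord (V : normedModType K) n i (q : V * 'rV[K]_n) :
  differentiable (fun q : V * 'rV[K]_n => q.2 0 i) q.
Proof. by apply: df_entry; exact: df_snd. Qed.

Lemma derive_linear (V W : normedModType K) (f : V -> W) q v : linear f -> (forall w, nm (f w) <= nm w) ->
  'D_v f q = f v.
Proof.
move=> lf fle; pose L : {linear V -> W} := HB.pack f (GRing.isLinear.Build _ _ _ _ _ lf).
have Lc : continuous L.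
  move=> x; apply/continuous_nmP => e e0; exists e => // y yx.
  by rewrite -linearB; exact: le_lt_trans (fle _) yx.
have H (e : R) : 0 < e -> exists2 d : R, 0 < d & forall h, nm h < d -> nm (f (q + h) - f q - L h) <= e * nm h.
  move=> e0; exists 1 => // h _.
  have LD : f (q + h) = f q + L h by exact: (linearD L).
  by rewrite LD addrAC addrK subrr nm0 mulr_ge0 ?nm_ge0 // ltW.
have [df dE] := nm_differentiable Lc H.
exact: derive_linear_num df dE.
Qed.

Lemma derive_is_linear (V : normedModType K) (f : V -> K) q a u v :
  differentiable f q -> 'D_(a *: u + v) f q = a * 'D_u f q + 'D_v f q.
Proof. exact: derive_is_linear_num. Qed.

Lemma derive_row_sum (V : normedModType K) n (f : V * 'rV[K]_n -> K) q (k : 'rV[K]_n) :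
  differentiable f q -> 'd f q (0, k) = \sum_j k 0 j * 'D_(0, delta_mx 0 j) f q.
Proof.
move=> df; rewrite (diff_deriveE _ df).
have -> : (0, k) = \sum_j k 0 j *: ((0, delta_mx 0 j) : V * 'rV[K]_n).
  rewrite [LHS](_ : _ = (0, \sum_j k 0 j *: delta_mx 0 j)); last by rewrite -row_sum_delta.
  elim/big_ind2: _ => [//|x1 x2 y1 y2 <- <-|j _]; first by rewrite /GRing.add /= /Algebra.add /= /add_pair /= addr0.
  by rewrite /GRing.scale /= /scale_pair /= scaler0.
elim: (index_enum _) => [|j l IH]; first by rewrite !big_nil; exact: derive_zero_num df.
by rewrite !big_cons derive_is_linear // IH.
Qed.
End Rows.

Section Implicit.
Context {R : realType}.
Notation K := R[i].
Variables (V : normedModType K) (N : nat) (D : set (V * 'rV[K]_N)) (x0 : V) (z0 : 'rV[K]_N).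
Notation E := (V * 'rV[K]_N)%type.
Notation p0 := ((x0, z0) : E).
Hypotheses (oD : open D) (Dp : D p0).

(** The derivative in [z] vanishes at the base point, so nearby its linear effect is at most 1/4 of
    the increment; the quadratic remainder accounts for another 1/4. *)
Lemma contraction (g : E -> K) : holomorphic D g -> (forall k, 'D_(0, delta_mx 0 k) g p0 = 0) ->
  exists2 r : R, 0 < r & forall x z z', nm (x - x0) < r -> nm (z - z0) < r -> nm (z' - z0) < r ->
    nm (g (x, z') - g (x, z)) <= 2^-1 * nm (z' - z).
Proof.
move=> hg g0.
have [r1 [r10 gb]] := diff_loc_bounded (hg p0 Dp); set B := nm (g p0) + 1 in gb.
have B0 : 0 <= B by rewrite addr_ge0 // nm_ge0.
have /nbhs_nmP[r2 r20 DD] : nbhs p0 D by exact: open_nbhs_nbhs.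
have c0 : 0 < (4 * N.+1%:R)^-1 :> R by rewrite invr_gt0 mulr_gt0.
have [r3 r30 dsmall] : exists2 r, 0 < r & forall (k : 'I_N) (q : E), nm (q - p0) < r -> 
    nm ('D_(0, delta_mx 0 k) g q) <= (4 * N.+1%:R)^-1.
  apply: (@fin_radius R 'I_N (fun k r => forall q : E, nm (q - p0) < r -> 
    nm ('D_(0, delta_mx 0 k) g q) <= (4 * N.+1%:R)^-1)).
    move=> k; have dd : differentiable (fun q => 'D_(0, delta_mx 0 k) g q) p0 by apply: holo_derive Dp.
    have /continuous_nmP/(_ _ c0)[d d0 H] := differentiable_continuous dd.
    by exists d => // q /H; rewrite g0 subr0 => /ltW.
  by move=> k r r' r'0 rr H q qr; apply: H; apply: lt_le_trans rr.
pose r4 := Num.min r1 r2 / 2.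
have r40 : 0 < r4 by rewrite divr_gt0 // lt_min r10.
have in4 q q' : nm (q - p0) < r4 -> nm (q' - q) < r4 -> nm (q' - p0) < r1 /\ nm (q' - p0) < r2.
  move=> h1 h2; apply/andP; rewrite -lt_min.
  apply: le_lt_trans (nm_tri q _ _) _; have -> : Num.min r1 r2 = r4 + r4 by rewrite /r4; field.
  exact: ltrD.
pose C := 64 * B / r4 ^+ 2.
have C0 : 0 <= C by apply: divr_ge0; [exact: mulr_ge0|exact: sqr_ge0].
(* In order, the bounds keep the partial derivatives small, the base point [q] within r4, the
   increment h (less than 2 r) below r4 / 8 as [holo_remainder] demands, and C |h| below 1 / 4. *)
pose r := Num.min (Num.min r3 r4) (Num.min (r4 / 16) (8 * (C + 1))^-1).
have r0 : 0 < r.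
  by rewrite !lt_min r30 r40 divr_gt0 //= invr_gt0 mulr_gt0 // ltr_wpDl.
exists r => // x z z' xr zr z'r.
have pr (w : 'rV[K]_N) : nm (w - z0) < r -> nm ((x, w) - p0 : E) < r.
  by move=> wr; rewrite nm_prod_lt xr.
pose h : E := (0, z' - z).
have hE : nm h = nm (z' - z) by rewrite nm_prod nm0 max_r // nm_ge0.
have h2r : nm (z' - z) < r + r.
  by apply: le_lt_trans (nm_tri z0 _ _) _; rewrite [nm (z0 - z)]nmB ltrD.
have rle : [/\ r <= r3, r <= r4, r <= r4 / 16 & r <= (8 * (C + 1))^-1].
  by have := lexx r; rewrite {2}/r !le_min => /andP[/andP[-> ->] /andP[-> ->]].
have [rl3 rl4 rl16 rlC] := rle.
have zq := pr z zr; set q : E := (x, z) in zq.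
have q3 := lt_le_trans zq rl3; have q4 := lt_le_trans zq rl4.
have -> : (x, z') = q + h.
  by congr pair; rewrite /= ?addr0 // addrC subrK.
have hs : nm h <= r4 / 8.
  rewrite hE (_ : r4 / 8 = r4 / 16 + r4 / 16); first exact: le_trans (ltW h2r) (lerD rl16 rl16).
  by field.
have dg q' : nm (q' - q) < r4 -> differentiable g q'.
  by move=> h'; have [_ /DD] := in4 q q' q4 h'; exact: hg.
have bg q' : nm (q' - q) < r4 -> nm (g q') <= B.
  by move=> h'; have [/gb] := in4 q q' q4 h'.
have rem := holo_remainder r40 dg bg hs.
have dgq : differentiable g q by apply: dg; rewrite subrr nm0.
have lin : nm ('d g q h) <= 4^-1 * nm (z' - z).
  rewrite derive_row_sum //; apply: le_trans (nm_sum _ _ _) _.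
  apply: (@le_trans _ _ (\sum_(j < N) nm (z' - z) * (4 * N.+1%:R)^-1)).
    by apply: ler_sum => j _; rewrite nmM; apply: ler_pM; rewrite ?nm_ge0 ?nm_coord ?dsmall.
  rewrite sumr_const card_ord -[leLHS]mulr_natr; set a := nm (z' - z).
  have -> : a * (4 * N.+1%:R)^-1 * N%:R = 4^-1 * a * (N%:R / N.+1%:R) by rewrite invfM; ring.
  apply: ler_piMr; first by rewrite mulr_ge0 ?nm_ge0 // invr_ge0.
  by rewrite ler_pdivrMr ?ltr0Sn // mul1r ler_nat.
have quad : C * nm h ^+ 2 <= 4^-1 * nm (z' - z).
  rewrite hE expr2 mulrA; apply: ler_wpM2r; first exact: nm_ge0.
  have : nm (z' - z) <= 2 * (8 * (C + 1))^-1.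
    by rewrite mulr_natl mulr2n; apply: le_trans (ltW h2r) (lerD _ _).
  move=> /(ler_wpM2l C0)/le_trans; apply.
  have -> : C * (2 * (8 * (C + 1))^-1) = 4^-1 * (C / (C + 1)) by field; rewrite gt_eqF // ltr_wpDl.
  by rewrite ler_piMr // ler_pdivrMr ?ltr_wpDl // mul1r lerDl.
rewrite -[g (q + h) - g q](subrK ('d g q h)); apply: le_trans (nmD _ _) _.
apply: le_trans (lerD (le_trans rem quad) lin) _.
by rewrite -mulrDl; apply: ler_wpM2r; [exact: nm_ge0|rewrite le_eqVlt; apply/orP; left; apply/eqP; field].
Qed.

Variables (G : 'I_N -> E -> K) (J0 : 'M[K]_N).
Hypotheses (hG : forall i, holomorphic D (G i)) (G0 : forall i, G i p0 = 0)
  (uJ : J0 \in unitmx) (J0E : forall j i, J0 j i = 'D_(0, delta_mx 0 j) (G i) p0).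

(** Newton's map with the Jacobian frozen at the base point: its fixed points in [z] are the zeros
    of [G], and its derivative in [z] vanishes there. *)
Let H i (q : E) : K := q.2 0 i - \sum_(j < N) invmx J0 j i * G j q.

Let hH i : holomorphic D (H i).
Proof.
move=> q Dq; apply: dfB; first exact: df_snd_coord.
by apply: df_sum => j _; apply: dfM; [exact: dfC|exact: hG].
Qed.

Let dH i k : 'D_(0, delta_mx 0 k) (H i) p0 = 0.
Proof.
pose S (q : E) : K := \sum_(j < N) invmx J0 j i * G j q.
have dS : differentiable S p0.
  by apply: df_sum => j _; apply: dfM; [exact: dfC|exact: hG].
have -> : H i = fun q => q.2 0 i + (-1) * S q by apply/funext => q; rewrite mulN1r.
rewrite (derive_lincomb _ _ (df_snd_coord _ _) dS) derive_sum; last by move=> j; exact: hG.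
rewrite (derive_linear (f := fun q : E => q.2 0 i)); first last.
- by move=> w; apply: le_trans (nm_coord _ _) (nm_snd _).
- by move=> c u w; rewrite !mxE.
rewrite mulN1r /=; apply/eqP; rewrite subr_eq0; apply/eqP.
have := congr1 (fun A : 'M[K]_N => A k i) (mulmxV uJ); rewrite !mxE /= => E1.
rewrite eq_sym -E1; apply: eq_bigr => j _; by rewrite J0E mulrC.
Qed.

Let fixH i x z : (forall j, G j (x, z) = 0) -> H i (x, z) = z 0 i.
Proof. by move=> Gz; rewrite /H big1 ?subr0 // => j _; rewrite Gz mulr0. Qed.

Let Hfix x z : (forall i, H i (x, z) = z 0 i) -> forall j, G j (x, z) = 0.
Proof.
move=> Hz j; pose g : 'rV[K]_N := \row_j G j (x, z).
suff : g = 0 by move/(congr1 (fun v : 'rV[K]_N => v 0 j)); rewrite !mxE.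
rewrite -[g](mulmxKV uJ) [g *m _](_ : _ = 0) ?mul0mx //.
apply/rowP => i; rewrite !mxE; have /eqP := Hz i.
rewrite /H /= -subr_eq0 addrAC subrr add0r oppr_eq0 => /eqP E1.
by rewrite -[RHS]E1; apply: eq_bigr => k _; rewrite mxE mulrC.
Qed.

(** The radius of uniqueness is deliberately twice the bound on f x - z0: the interval between the
    two values is the gap to which [connected_gap] is applied. *)
Lemma implicit_function (eps : R) : 0 < eps -> exists rho r : R,
  [/\ 0 < rho, rho <= eps, 0 < r & r <= eps] /\ exists f : V -> 'rV[K]_N,
  forall x, nm (x - x0) < r -> [/\ differentiable f x, nm (f x - z0) <= rho / 2,
    forall i, G i (x, f x) = 0 &
    forall z, nm (z - z0) < rho -> (forall i, G i (x, z) = 0) -> z = f x].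
Proof.
move=> eps0.
have [r1 r10 Hc] : exists2 r1, 0 < r1 & forall i x z z', nm (x - x0) < r1 -> nm (z - z0) < r1 -> nm (z' - z0) < r1 ->
    nm (H i (x, z') - H i (x, z)) <= 2^-1 * nm (z' - z).
  apply: (@fin_radius R 'I_N (fun i r1 => forall x z z', nm (x - x0) < r1 -> nm (z - z0) < r1 -> nm (z' - z0) < r1 ->
    nm (H i (x, z') - H i (x, z)) <= 2^-1 * nm (z' - z))).
    by move=> i; exact: contraction (hH i) (dH i).
  move=> i r r' r'0 rr h x z z' h1 h2 h3.
  by apply: h; [exact: lt_le_trans h1 rr|exact: lt_le_trans h2 rr|exact: lt_le_trans h3 rr].
have /nbhs_nmP[r2 r20 DD] : nbhs p0 D by exact: open_nbhs_nbhs.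
pose rho := Num.min eps (Num.min r1 r2).
have rho0 : 0 < rho by rewrite !lt_min eps0 r10.
have [re ra rb] : [/\ rho <= eps, rho <= r1 & rho <= r2].
  by have := lexx rho; rewrite {2}/rho !le_min => /andP[-> /andP[-> ->]].
have rho4 : 0 < rho / 4 by rewrite divr_gt0.
(* With H (x, z0) within rho / 4 of z0, the factor 1/2 maps the ball of radius rho / 2 into
   itself. *)
have [r3 r30 Hx] : exists2 r3, 0 < r3 & forall i (q : E), nm (q - p0) < r3 -> nm (H i q - z0 0 i) <= rho / 4.
  apply: (@fin_radius R 'I_N (fun i r3 => forall q : E, nm (q - p0) < r3 -> nm (H i q - z0 0 i) <= rho / 4)).
    move=> i; have /continuous_nmP/(_ _ rho4)[d d0 h] := differentiable_continuous (hH i Dp).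
    exists d => // q /h; rewrite (_ : H i p0 = z0 0 i); first exact: ltW.
    by apply: fixH => j; exact: G0.
  by move=> i r r' r'0 rr h q qr; apply: h; exact: lt_le_trans rr.
pose r := Num.min rho r3.
have r0 : 0 < r by rewrite lt_min rho0.
have [rrho rr3] : r <= rho /\ r <= r3.
  by have := lexx r; rewrite {2}/r !le_min => /andP[-> ->].
exists rho, r; split; first by split=> //; exact: le_trans re.
pose hn := fix hn n (x : V) : 'rV[K]_N := if n is m.+1 then \row_i H i (x, hn m x) else z0.
have hnS n x : hn n.+1 x = \row_i H i (x, hn n x) by [].
have half : rho / 2 < rho by exact: half_lt.
have ball x z : nm (x - x0) < r -> nm (z - z0) <= rho / 2 ->
  [/\ nm (x - x0) < r1, nm (z - z0) < r1 & D (x, z)].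
  move=> xr zr; have xrho := lt_le_trans xr rrho; have zrho := le_lt_trans zr half.
  split; [exact: lt_le_trans ra|exact: lt_le_trans ra|].
  by apply: DD; rewrite nm_prod_lt /= (lt_le_trans xrho rb) (lt_le_trans zrho rb).
have zz : nm (z0 - z0) <= rho / 2 by rewrite subrr nm0 divr_ge0 // ltW.
have stay x z : nm (x - x0) < r -> nm (z - z0) <= rho / 2 ->
  nm ((\row_i H i (x, z) : 'rV[K]_N) - z0) <= rho / 2.
  move=> xr zr; have [h1 h2 _] := ball x z xr zr; have [_ h3 _] := ball x z0 xr zz.
  apply: nm_rV_le => [|i]; first by rewrite divr_ge0 // ltW.
  rewrite !mxE; apply: le_trans (nm_tri (H i (x, z0)) _ _) _.
  have a1 := Hc i x z0 z h1 h3 h2.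
  have a2 : nm (H i (x, z0) - z0 0 i) <= rho / 4.
    by apply: Hx; rewrite nm_prod_lt /= subrr nm0 r30 andbT; exact: lt_le_trans rr3.
  exact: half_quarterD a1 zr a2.
have hnb n x : nm (x - x0) < r -> nm (hn n x - z0) <= rho / 2.
  by move=> xr; elim: n => [//|n IH]; rewrite hnS; exact: stay.
have lip x z z' : nm (x - x0) < r -> nm (z - z0) <= rho / 2 -> nm (z' - z0) <= rho / 2 ->
   nm ((\row_i H i (x, z') : 'rV[K]_N) - (\row_i H i (x, z))) <= 2^-1 * nm (z' - z).
  move=> xr zr zr'; have [h1 h2 _] := ball x z xr zr; have [_ h3 _] := ball x z' xr zr'.
  apply: nm_rV_le => [|i]; first by rewrite mulr_ge0 ?nm_ge0 // invr_ge0.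
  by rewrite !mxE; exact: Hc.
have step n x : nm (x - x0) < r -> nm (hn n.+1 x - hn n x) <= rho / 2 * (2 ^+ n)^-1.
  move=> xr; elim: n => [|n IH]; first by rewrite expr0 invr1 mulr1; exact: hnb.
  rewrite [hn n.+2 x]hnS [in X in _ - X]hnS; apply: le_trans (lip _ _ _ xr (hnb _ _ xr) (hnb _ _ xr)) _.
  rewrite exprS invfM mulrCA; apply: ler_wpM2l => //; by rewrite invr_ge0.
have p2 n : 0 < (2 ^+ n)^-1 :> R by rewrite invr_gt0 exprn_gt0.
(* The difference of powers of 2 makes the induction on [m] telescope. *)
have cau n m x : nm (x - x0) < r -> (n <= m)%N -> nm (hn m x - hn n x) <= rho * ((2 ^+ n)^-1 - (2 ^+ m)^-1).
  move=> xr; elim: m => [|m IH]; first by rewrite leqn0 => /eqP ->; rewrite !subrr nm0 mulr0.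
  rewrite leq_eqVlt => /predU1P[->|]; first by rewrite !subrr nm0 mulr0.
  rewrite ltnS => /IH h; apply: le_trans (nm_tri (hn m x) _ _) _.
  have h2 := step m x xr.
  have e2 : (2 ^+ m.+1)^-1 = 2^-1 * (2 ^+ m)^-1 :> R by rewrite exprS invfM.
  rewrite e2; have -> : rho * ((2 ^+ n)^-1 - 2^-1 * (2 ^+ m)^-1) =
    rho / 2 * (2 ^+ m)^-1 + rho * ((2 ^+ n)^-1 - (2 ^+ m)^-1) by field; rewrite !expf_neq0.
  exact: lerD.
have cau' n m x : nm (x - x0) < r -> (n <= m)%N -> nm (hn m x - hn n x) <= rho * (2 ^+ n)^-1.
  move=> xr nm_; apply: le_trans (cau n m x xr nm_) _; apply: ler_wpM2l; first exact: ltW.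
  by rewrite gerBl ltW.
have ex x i : exists y, nm (x - x0) < r -> tends (fun n => hn n x 0 i) y.
  have [xr|xr] := boolP (nm (x - x0) < r); last by exists 0.
  have [n m /andP[_ nm_]||y ty _] := cauchy_limit (u := fun n => hn n x 0 i) (e := fun n => rho * (2 ^+ n)^-1) (N := 0%N).
  - apply: le_trans (cau' n m x xr nm_).
    exact: nm_coordB.
  - exact: geom_half_cvg.
  - by exists y.
have [f tf] : exists f : V -> 'rV[K]_N, forall x i, nm (x - x0) < r -> tends (fun n => hn n x 0 i) (f x 0 i).
  exists (fun x => \row_i sval (cid (ex x i))) => x i xr.
  by rewrite mxE; case: cid => y /= h; exact: h.
have fn x n : nm (x - x0) < r -> nm (f x - hn n x) <= rho * (2 ^+ n)^-1.
  move=> xr; apply: nm_rVB_le => [|i]; first by rewrite mulr_ge0 // ltW.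
  apply: (tends_le (u := fun m => hn m x 0 i - hn n x 0 i)).
    by apply: tendsB; [exact: tf|exact: tends_cst].
  exists n => m nm_; apply: le_trans (cau' n m x xr nm_).
  exact: nm_coordB.
have fb x : nm (x - x0) < r -> nm (f x - z0) <= rho / 2.
  move=> xr; apply: nm_rVB_le => [|i]; first by rewrite divr_ge0 // ltW.
  apply: (tends_le (u := fun m => hn m x 0 i - z0 0 i)).
    by apply: tendsB; [exact: tf|exact: tends_cst].
  exists 0%N => m _; apply: le_trans (hnb m x xr).
  exact: nm_coordB.
have dhn n x i : nm (x - x0) < r -> differentiable (fun x => hn n x 0 i) x.
  elim: n x i => [|n IH] x i xr; first exact: dfC.
  have -> : (fun x => hn n.+1 x 0 i) = fun x => H i (x, hn n x) by apply/funext => y; rewrite hnS mxE.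
  have [_ _ Dx] := ball x (hn n x) xr (hnb n x xr).
  apply: (@df_comp _ _ _ _ (fun x => (x, hn n x) : E) (H i)); last exact: hH.
  apply: differentiable_pair; first exact: ex_diff.
  by apply: differentiable_rV => j; exact: IH.
exists f => x xr.
have Gf : forall j, G j (x, f x) = 0.
  apply: Hfix => i; apply/eqP; rewrite -subr_eq0; apply/eqP/nm_eps0 => e e0.
  have [n Hn] := pow2_small (2 * rho) e0.
  apply: le_trans (nm_tri (hn n.+1 x 0 i) _ _) _.
  have h1 : nm (H i (x, f x) - hn n.+1 x 0 i) <= 2^-1 * nm (f x - hn n x).
    apply: le_trans (lip x _ _ xr (hnb n x xr) (fb x xr)).
    by rewrite hnS; have := nm_coordB (\row_i H i (x, f x)) (\row_i H i (x, hn n x)) i; rewrite !mxE.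
  have h2 : nm (hn n.+1 x 0 i - f x 0 i) <= rho * (2 ^+ n.+1)^-1.
    rewrite nmB; apply: le_trans (fn x n.+1 xr).
    exact: nm_coordB.
  have h3 := fn x n xr.
  have e2 : (2 ^+ n.+1)^-1 = 2^-1 * (2 ^+ n)^-1 :> R by rewrite exprS invfM.
  by rewrite e2 in h2; exact: picard_gap (nm_ge0 _) h1 h2 h3 (Hn n (leqnn n)).
split; [|exact: fb|exact: Gf|].
- apply: differentiable_rV => i.
  have s0 : 0 < r - nm (x - x0) by rewrite subr_gt0.
  have inb y : nm (y - x) < r - nm (x - x0) -> nm (y - x0) < r.
    by move=> yx; apply: le_lt_trans (nm_tri x _ _) _; rewrite -ltrBrDr.
  apply: (holo_lim (u := fun n x => hn n x 0 i) (B := nm z0 + rho) s0).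
  + by move=> n q /inb; exact: dhn.
  + move=> n q /inb qr; apply: le_trans (nm_coord _ _) _.
    rewrite -[hn n q](subrK z0) addrC; apply: le_trans (nmD _ _) _; rewrite lerD2l.
    by apply: le_trans (hnb n q qr) (ltW half).
  + by move=> q /inb; exact: tf.
- move=> z zr Gz; have xr1 : nm (x - x0) < r1 by apply: lt_le_trans ra; exact: lt_le_trans rrho.
  have fr1 : nm (f x - z0) < r1 by apply: lt_le_trans ra; exact: le_lt_trans (fb x xr) half.
  have zr1 : nm (z - z0) < r1 by apply: lt_le_trans ra.
  have h : nm (z - f x) <= 2^-1 * nm (z - f x).
    apply: nm_rVB_le => [|i]; first by rewrite mulr_ge0 ?nm_ge0 // invr_ge0.
    by have := Hc i x (f x) z xr1 fr1 zr1; rewrite !fixH.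
  apply/eqP; rewrite -subr_eq0; apply/eqP/nm0_eq0.
  exact: le_half_eq0 (nm_ge0 _) h.
Qed.
End Implicit.

(** * Connected sets, inverse matrices and power series *)

Section Misc.
Context {R : realType}.
Notation K := R[i].

Lemma path_continuous (V : normedModType K) (x v : V) : continuous (fun t : R => x + t%:C *: v).
Proof.
move=> t A /nbhs_nmP[e e0 eA]; apply/nbhs_ballP.
have M0 : 0 < nm v + 1 by rewrite ltr_wpDl // nm_ge0.
exists (e / (nm v + 1)) => /=; first exact: divr_gt0.
move=> s; rewrite /ball /= ltr_pdivlMr // => st; apply: eA.
have -> : x + s%:C *: v - (x + t%:C *: v) = (s - t)%:C *: v.
  by rewrite opprD addrACA subrr add0r -scalerBl rmorphB.
rewrite nmZ nmR distrC; apply: le_lt_trans st; apply: ler_wpM2l => //.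
by rewrite lerDl.
Qed.

Lemma ball_connected (V : normedModType K) (x0 : V) (r : R) : 0 < r -> connected [set x | nm (x - x0) < r].
Proof.
move=> r0; set B := [set x | _].
pose seg (x : V) := (fun t : R => x0 + t%:C *: (x - x0)) @` `[0, 1]%classic.
have Bx0 : B x0 by rewrite /B /= subrr nm0.
have -> : B = \bigcup_(x in B) seg x.
  apply/seteqP; split=> [x Bx|y [x Bx [t /=]]].
    exists x => //; exists 1; first by rewrite /= in_itv /= ler01 lexx.
    by rewrite scale1r addrC subrK.
  rewrite in_itv /= => /andP[t0 t1] <-; rewrite /B /= [x0 + _]addrC addrK nmZ nmR ger0_norm //.
  by apply: le_lt_trans Bx; rewrite ler_piMl // nm_ge0.
apply: bigcup_connected.
  exists x0 => x Bx; exists 0; first by rewrite /= in_itv /= lexx ler01.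
  by rewrite scale0r addr0.
move=> x _; apply: connected_continuous_connected; first exact: segment_connected.
by apply: continuous_subspaceT; exact: path_continuous.
Qed.

(* A gap in the values of [nm (g x - z0)] cannot be crossed on a connected set. *)
Lemma connected_gap (V W : normedModType K) (X0 : set V) (g : V -> W) x0 z0 (a b : R) :
  connected X0 -> open X0 -> X0 x0 -> (forall x, X0 x -> {for x, continuous g}) -> a < b ->
  nm (g x0 - z0) < b -> (forall x, X0 x -> nm (g x - z0) < b -> nm (g x - z0) <= a) ->
  forall x, X0 x -> nm (g x - z0) < b.
Proof.
move=> cX oX X0x0 cg ab g0 gap x Xx.
have ctri y (e : R) : X0 y -> 0 < e -> exists2 d : R, 0 < d & forall y', nm (y' - y) < d ->
    X0 y' /\ nm (g y' - g y) < e.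
  move=> Xy e0; have /continuous_nmP/(_ e e0)[d d0 H] := cg y Xy.
  have /nbhs_nmP[d' d'0 H'] : nbhs y X0 by exact: open_nbhs_nbhs.
  exists (Num.min d d'); first by rewrite lt_min d0.
  by move=> y'; rewrite lt_min => /andP[/H ? /H' ?].
pose B := [set y | X0 y /\ nm (g y - z0) < b].
suff E : B = X0.
  have : B x by rewrite E.
  by case.
apply: cX; first by exists x0.
- exists B; last by apply/seteqP; split=> y; [move=> [? ?]|move=> [? [? ?]]].
  rewrite openE => y [Xy gy].
  have e0 : 0 < b - nm (g y - z0) by rewrite subr_gt0.
  have [d d0 H] := ctri y _ Xy e0; apply/nbhs_nmP; exists d => // y' /H[Xy' gy'].
  by split=> //; apply: le_lt_trans (nm_tri (g y) _ _) _; rewrite -ltrBrDr.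
- exists (~` [set y | X0 y /\ a < nm (g y - z0)]).
    apply: open_closedC; rewrite openE => y [Xy gy].
    have e0 : 0 < nm (g y - z0) - a by rewrite subr_gt0.
    have [d d0 H] := ctri y _ Xy e0; apply/nbhs_nmP; exists d => // y' /H[Xy' gy'].
    split=> //; have := nm_tri (g y') (g y) z0; rewrite [nm (g y - g y')]nmB.
    by move: gy'; lra.
  apply/seteqP; split=> y.
    move=> [Xy gy]; split=> // -[_]; apply/negP; rewrite -leNgt; exact: gap.
  move=> [Xy ny]; split=> //; apply: le_lt_trans ab; rewrite leNgt; apply/negP => h; exact: ny.
Qed.

Lemma df_det (V : normedModType K) n (M : V -> 'M[K]_n) x :
  (forall i j, differentiable (fun x => M x i j) x) -> differentiable (fun x => \det (M x)) x.
Proof.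
move=> dM; rewrite /determinant; apply: df_sum => s _; apply: dfM; first exact: dfC.
by apply: df_prod => i _; exact: dM.
Qed.

Lemma df_adj (V : normedModType K) n (M : V -> 'M[K]_n) x i j :
  (forall i j, differentiable (fun x => M x i j) x) -> differentiable (fun x => (\adj (M x)) i j) x.
Proof.
move=> dM.
have -> : (fun x => (\adj (M x)) i j) = fun x => (-1) ^+ (j + i) * \det (row' j (col' i (M x))).
  by apply/funext => y; rewrite mxE.
apply: dfM; first exact: dfC.
apply: df_det => k l.
have -> : (fun x => row' j (col' i (M x)) k l) = fun x => M x (lift j k) (lift i l).
  by apply/funext => y; rewrite !mxE.
exact: dM.
Qed.

(** Cramer's rule gives holomorphy where the determinant is nonzero; the bound on a smaller ball is
    what later makes the constants uniform in x. *)
Lemma invmx_near (V : normedModType K) n (X1 : set V) (M : V -> 'M[K]_n) x0 : open X1 -> X1 x0 ->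
  (forall i j, holomorphic X1 (fun x => M x i j)) -> M x0 \in unitmx ->
  exists r B : R, [/\ 0 < r, 0 <= B & forall x, nm (x - x0) < r ->
    [/\ X1 x, M x \in unitmx & forall i j, differentiable (fun x => invmx (M x) i j) x /\
      nm (invmx (M x) i j) <= B]].
Proof.
move=> oX Xx0 hM u0.
have /nbhs_nmP[r1 r10 H1] : nbhs x0 X1 by exact: open_nbhs_nbhs.
pose D x := \det (M x).
have dD x : X1 x -> differentiable D x by move=> Xx; apply: df_det => i j; exact: hM.
have D0 : D x0 != 0 by move: u0; rewrite unitmxE unitfE.
have Dp : 0 < nm (D x0) by exact: nm_gt0.
have /continuous_nmP/(_ _ Dp)[r2 r20 H2] := differentiable_continuous (dD _ Xx0).
pose r3 := Num.min r1 r2; have r30 : 0 < r3 by rewrite lt_min r10.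
have U x : nm (x - x0) < r3 -> X1 x /\ M x \in unitmx.
  rewrite lt_min => /andP[/H1 Xx /H2 h]; split; first exact: Xx.
  have : D x != 0 by apply: contraTneq h => ->; rewrite sub0r nmN ltxx.
  by rewrite unitmxE unitfE.
have oB : open [set x | nm (x - x0) < r3] by exact: open_ball_nm.
have dI i j x : nm (x - x0) < r3 -> differentiable (fun x => invmx (M x) i j) x.
  move=> xr; have [Xx ux] := U x xr.
  apply: (@differentiable_eq_on _ _ _ _ (fun x => (D x)^-1 * (\adj (M x)) i j) _ oB); [|exact: xr|].
    by move=> y /U[_ uy]; rewrite /invmx uy [RHS]mxE.
  apply: dfM; first by apply: dfV; [exact: dD|rewrite /D; move: ux; rewrite unitmxE unitfE].
  by apply: df_adj => k l; exact: hM.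
have x0r : nm (x0 - x0) < r3 by rewrite subrr nm0.
pose B := \sum_(ij : 'I_n * 'I_n) (nm (invmx (M x0) ij.1 ij.2) + 1).
have [r4 r40 H4] : exists2 r, 0 < r & forall (ij : 'I_n * 'I_n) x, nm (x - x0) < r -> nm (invmx (M x) ij.1 ij.2) <= nm (invmx (M x0) ij.1 ij.2) + 1.
  apply: (@fin_radius R ('I_n * 'I_n)%type (fun ij r => forall x, nm (x - x0) < r -> nm (invmx (M x) ij.1 ij.2) <= nm (invmx (M x0) ij.1 ij.2) + 1)).
    by move=> ij; have [r [r0 h]] := diff_loc_bounded (dI ij.1 ij.2 x0 x0r); exists r.
  by move=> ij r r' r'0 rr h x xr; apply: h; exact: lt_le_trans rr.
have t0 (ij : 'I_n * 'I_n) : 0 <= nm (invmx (M x0) ij.1 ij.2) + 1 by rewrite addr_ge0 // nm_ge0.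
exists (Num.min r3 r4), B; split; first by rewrite lt_min r30.
  by apply: sumr_ge0.
move=> x; rewrite lt_min => /andP[xr /H4 h]; have [Xx ux] := U x xr; split=> // i j.
split; first exact: dI.
apply: le_trans (h (i, j)) _; rewrite /B (bigD1 (i, j)) //= lerDl.
by apply: sumr_ge0.
Qed.

Lemma cvg_tends (V : normedModType K) (u : nat -> V) l : u @ \oo --> l -> tends u l.
Proof.
move=> h e e0; have : nbhs l [set y | nm (y - l) < e] by apply/nbhs_nmP; exists e.
by move=> /h[n _ H]; exists n => k nk; apply: ltW; exact: H.
Qed.

Lemma tends_cvg (V : normedModType K) (u : nat -> V) l : tends u l -> u @ \oo --> l.
Proof.
move=> h A /nbhs_nmP[e e0 eA]; have e2 : 0 < e / 2 by rewrite divr_gt0.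
have [n H] := h _ e2; exists n => // k nk; apply: eA; apply: le_lt_trans (H k nk) _.
by move: e0; lra.
Qed.

(** The subtracted power in the bound makes the induction telescope; [series_asym] then drops it. *)
Lemma geo_tail (c : nat -> K) (z : K) (C M : R) m n : 0 <= C -> 0 < M -> (m <= n)%N ->
  (forall k, nm (c k) <= C * M ^+ k) -> M * nm z <= 2^-1 ->
  nm (\sum_(k < n) c k * z ^+ k - \sum_(k < m) c k * z ^+ k) <=
  2 * C * ((M * nm z) ^+ m - (M * nm z) ^+ n).
Proof.
move=> C0 M0 mn cC; set y := M * nm z => y2.
have y0 : 0 <= y by rewrite mulr_ge0 ?nm_ge0 // ltW.
elim: n mn => [|n IH]; first by rewrite leqn0 => /eqP ->; rewrite !subrr nm0 mulr0.
rewrite leq_eqVlt => /predU1P[->|]; first by rewrite !subrr nm0 mulr0.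
rewrite ltnS => /IH h; rewrite big_ord_recr /= addrAC; apply: le_trans (nmD _ _) _.
have h2 : nm (c n * z ^+ n) <= C * y ^+ n.
  rewrite nmM nmX exprMn mulrA; apply: ler_wpM2r; last exact: cC.
  by rewrite exprn_ge0 // nm_ge0.
have yn : 0 <= C * y ^+ n by rewrite mulr_ge0 // exprn_ge0.
have h3 : C * y ^+ n <= 2 * C * (y ^+ n - y ^+ n.+1).
  have -> : 2 * C * (y ^+ n - y ^+ n.+1) = C * y ^+ n * (2 * (1 - y)) by rewrite exprS; ring.
  by apply: ler_peMr => //; move: y2; lra.
apply: le_trans (lerD h (le_trans h2 h3)) _; rewrite -mulrDr.
by rewrite addrA subrK.
Qed.

Lemma series_asym (g : K -> K) (c : nat -> K) (C M d : R) (m : nat) : 0 <= C -> 0 < M -> 0 < d ->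
  (forall k, nm (c k) <= C * M ^+ k) ->
  (forall z : K, nm z < d -> tends (fun n => \sum_(k < n) c k * z ^+ k) (g z)) ->
  asym g c m.
Proof.
move=> C0 M0 d0 cC H.
exists (2 * C * M ^+ m), (Num.min d (2 * M)^-1); split.
- by apply: mulr_ge0; [exact: mulr_ge0|rewrite exprn_ge0 // ltW].
- by rewrite lt_min d0 invr_gt0 mulr_gt0.
move=> z; rewrite lt_min => /andP[zd zM].
have y2 : M * nm z <= 2^-1.
  have := ler_wpM2l (ltW M0) (ltW zM); rewrite invfM mulrCA divff ?mulr1 // gt_eqF //.
apply: (tends_le (u := fun n => \sum_(k < n) c k * z ^+ k - \sum_(k < m) c k * z ^+ k)).
  by apply: tendsB; [exact: H|exact: tends_cst].
exists m => n mn; apply: le_trans (geo_tail C0 M0 mn cC y2) _.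
have -> : 2 * C * M ^+ m * nm z ^+ m = 2 * C * (M * nm z) ^+ m by rewrite exprMn mulrA.
apply: ler_wpM2l; first exact: mulr_ge0.
by rewrite gerBl exprn_ge0 // mulr_ge0 ?nm_ge0 // ltW.
Qed.
End Misc.

(** * The coefficients of the convolution equation *)

Section ParamDerivative.
Context {R : realType}.
Notation K := R[i].

Lemma mder_param_holo (V' Y : normedModType K) N (D : set Y) (Phi : Y -> K) (e' : 'I_N -> Y)
  (io : V' -> 'rV[K]_N -> Y) (s : V' -> 'rV[K]_N) al q0 :
  open D -> holomorphic D Phi -> (forall q j h z, io q (h *: delta_mx 0 j + z) = h *: e' j + io q z) ->
  D (io q0 (s q0)) -> differentiable (fun q => io q (s q)) q0 ->
  differentiable (fun q => mder (fun j => delta_mx 0 j) al (fun z => Phi (io q z)) (s q)) q0.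
Proof.
move=> oD hP aff Dq dio.
have -> : (fun q => mder (fun j => delta_mx 0 j) al (fun z => Phi (io q z)) (s q)) =
  fun q => mder e' al Phi (io q (s q)).
  by apply/funext => q; rewrite (mder_affine al Phi (aff q)).
apply: (@df_comp _ _ _ _ (fun q => io q (s q)) (mder e' al Phi) q0 dio).
exact: (mder_holo e' al oD hP Dq).
Qed.

Variables (V : normedModType K) (N : nat) (X0 : set V) (U : set 'rV[K]_N)
  (f0 : V -> 'rV[K]_N) (IJ : V -> 'M[K]_N) (r BJ : R).
Hypotheses (oX : open X0) (oU : open U) (r0 : 0 < r) (BJ0 : 0 <= BJ)
  (rU : forall x z, X0 x -> nm (z - f0 x) < r -> U z)
  (hIJ : forall i j, holomorphic X0 (fun x => IJ x i j))
  (IJB : forall x i j, X0 x -> nm (IJ x i j) <= BJ).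
Notation deg al := (\sum_(j < N) al j)%N.
Notation ev := (fun j : 'I_N => delta_mx 0 j : 'rV[K]_N).

(** Linear in [h], and applied to the components of F_k, of the Borel transform at fixed xi, and of
    its expansion remainders, so that one Cauchy estimate serves for all of them. *)
Definition cof (al : 'I_N -> nat) i x (h : 'I_N -> 'rV[K]_N -> K) : K :=
  \sum_l ((\prod_j (al j)`!)%N%:R^-1 * mder ev al (h l) (f0 x)) * IJ x l i.

Let f0U x : X0 x -> U (f0 x).
Proof. by move=> Xx; apply: (rU Xx); rewrite subrr nm0. Qed.

Lemma cofE al i x (G : 'rV[K]_N -> 'rV[K]_N) : X0 x ->
  (forall l, holomorphic U (fun z => G z 0 l)) ->
  (((\prod_j (al j)`!)%N%:R^-1 *: partial al G (f0 x)) *m IJ x) 0 i = cof al i x (fun l z => G z 0 l).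
Proof.
move=> Xx hG; rewrite mxE; apply: eq_bigr => l _; rewrite mxE partialE.
by congr (_ * _ * _); exact: (mder_coord ev al oU hG l (f0U Xx)).
Qed.

Lemma cof_bound al i x (h : 'I_N -> 'rV[K]_N -> K) (B : R) : X0 x -> 0 <= B ->
  (forall l z, nm (z - f0 x) < r -> differentiable (h l) z) ->
  (forall l z, nm (z - f0 x) < r -> nm (h l z) <= B) ->
  nm (cof al i x h) <= N%:R * 2 ^+ N * BJ * B / (r / (8 * N.+1%:R)) ^+ deg al.
Proof.
move=> Xx B0 dh hB; set rho := r / _.
have rho0 : 0 < rho by rewrite divr_gt0 // mulr_gt0.
apply: le_trans (nm_sum _ _ _) _.
apply: (@le_trans _ _ (\sum_(l < N) (2 ^+ N * B / rho ^+ deg al) * BJ)).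
  apply: ler_sum => l _; rewrite nmM; apply: ler_pM; rewrite ?nm_ge0 ?IJB //.
  rewrite nmM nmV nm_nat mulrC ler_pdivrMr; last by rewrite ltr0n prodn_gt0 // => j; exact: fact_gt0.
  rewrite [leRHS]mulrC; apply: (@mder_bound _ _ _ (f0 x) ev al (h l) r B) => //.
  - by move=> j; exact: nm_delta.
  - exact: dh.
  - exact: hB.
  - by rewrite subrr nm0 divr_gt0.
rewrite sumr_const card_ord -[leLHS]mulr_natr le_eqVlt; apply/orP; left; apply/eqP; ring.
Qed.

Lemma cof_lin al i x (h h1 h2 : 'I_N -> 'rV[K]_N -> K) (c : K) : X0 x ->
  (forall l, holomorphic U (h1 l)) -> (forall l, holomorphic U (h2 l)) ->
  (forall l z, U z -> h l z = h1 l z + c * h2 l z) ->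
  cof al i x h = cof al i x h1 + c * cof al i x h2.
Proof.
move=> Xx k1 k2 E; rewrite /cof mulr_sumr -big_split; apply: eq_bigr => l _ /=.
rewrite (mder_linear ev al oU (k1 l) (k2 l) (E l) (f0U Xx)); ring.
Qed.

(** An expansion in xi that is uniform for z near f0 x may be differentiated in z: the remainder is
    holomorphic in z, and [cof_bound] transfers its order in xi to its derivatives. *)
Lemma cof_jet al i x (h : K -> 'I_N -> 'rV[K]_N -> K) (g : nat -> 'I_N -> 'rV[K]_N -> K)
  (c : nat -> K) (B s : R) m :
  X0 x -> 0 <= B -> 0 < s ->
  (forall xi l, nm xi < s -> holomorphic U (h xi l)) -> (forall k l, holomorphic U (g k l)) ->
  (forall xi l z, nm xi < s -> nm (z - f0 x) < r ->
    nm (h xi l z - \sum_(k < m) g k l z * (c k * xi ^+ k)) <= B * nm xi ^+ m) ->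
  asym (fun xi => cof al i x (h xi)) (fun k => cof al i x (g k) * c k) m.
Proof.
move=> Xx B0 s0 hh hg rem.
pose Rm n xi l z : K := h xi l z - \sum_(k < n) g k l z * (c k * xi ^+ k).
have hR n xi l : nm xi < s -> holomorphic U (Rm n xi l).
  move=> xs z Uz; apply: dfB; first exact: hh.
  by apply: df_sum => k _; apply: dfM; [exact: hg|exact: dfC].
have E n xi : nm xi < s -> cof al i x (h xi) = cof al i x (Rm n xi) + \sum_(k < n) cof al i x (g k) * c k * xi ^+ k.
  move=> xs; elim: n => [|n IH].
    rewrite big_ord0 addr0; congr cof; apply/funext => l; apply/funext => z.
    by rewrite /Rm big_ord0 subr0.
  rewrite IH big_ord_recr /= [X in _ = _ + X]addrC addrA; congr (_ + _).
  rewrite [X in _ + X](_ : _ = (c n * xi ^+ n) * cof al i x (g n)); last by ring.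
  apply: cof_lin Xx _ _ _; [|exact: hg|]; first by move=> l; exact: hR.
  by move=> l z _; rewrite /Rm big_ord_recr /=; ring.
set c1 := N%:R * 2 ^+ N * BJ / (r / (8 * N.+1%:R)) ^+ deg al.
have c0 : 0 <= c1.
  apply: divr_ge0; last by rewrite exprn_ge0 // divr_ge0 ?mulr_ge0 // ltW.
  by apply: mulr_ge0 => //; apply: mulr_ge0 => //; exact: exprn_ge0.
exists (c1 * B), s; split=> //; first exact: mulr_ge0.
move=> xi xs; rewrite (E m xi xs) addrK.
have -> : c1 * B * nm xi ^+ m = N%:R * 2 ^+ N * BJ * (B * nm xi ^+ m) / (r / (8 * N.+1%:R)) ^+ deg al.
  by rewrite /c1; ring.
have Xx' := Xx; apply: (@cof_bound al i x (Rm m xi) (B * nm xi ^+ m) Xx).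

- by rewrite mulr_ge0 // exprn_ge0 // nm_ge0.
- by move=> l z zr; apply: (hR m xi l xs z); exact: rU Xx' zr.
- by move=> l z zr; exact: rem.
Qed.
End ParamDerivative.

Section Expansion.
Context {R : realType}.
Notation K := R[i].

Lemma asym_ext (g : K -> K) c c' m : (forall k, (k < m)%N -> c k = c' k) -> asym g c m -> asym g c' m.
Proof.
by move=> E [C [d [C0 d0 H]]]; exists C, d; split=> // z /H; under eq_bigr do rewrite E //.
Qed.

(** The Borel series is known to converge only on a disc that may depend on the point. Identifying
    its coefficients with Taylor coefficients gives a remainder whose constants depend only on [r],
    [B] and [m]. *)
Lemma uniform_expansion (g : K -> K) c (r B : R) m : 0 < r ->
  (forall z, nm z < r -> differentiable g z) -> (forall z, nm z < r -> nm (g z) <= B) ->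
  asym g c m ->
  forall z, nm z <= r / 6 -> nm (g z - \sum_(k < m) c k * z ^+ k) <= 4 * B * (nm z / (r / 3)) ^+ m.
Proof.
move=> r0 dg gB gc z zr; have [_ h] := asym_nderive m r0 dg gB.
have s0 : 0 < r / 3 by rewrite divr_gt0.
have sr : 2 * (r / 3) < r by move: r0; lra.
have v1 : nm (1 : K) <= 1 by rewrite nm1.
have dg' (y : K) : nm (y - 0) < r -> differentiable g y by rewrite subr0; exact: dg.
have gB' (y : K) : nm (y - 0) < r -> nm (g y) <= B by rewrite subr0; exact: gB.
have [_ h2] := nderive_expansion s0 sr v1 dg' gB'.
have zs : nm z <= r / 3 / 2 by move: zr; lra.
have := h2 m z zs; have -> : 0 + z *: (1 : K) = z by rewrite add0r; exact: mulr1.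
by under eq_bigr => k _ do rewrite -(asym_unique gc h (ltn_ord k)).
Qed.

Lemma open_prod (V W : normedModType K) (A : set V) (B : set W) : open A -> open B -> open (A `*` B).
Proof.
move=> oA oB; rewrite openE => -[x y] [/= Ax By].
have /nbhs_nmP[r1 r10 H1] : nbhs x A by exact: open_nbhs_nbhs.
have /nbhs_nmP[r2 r20 H2] : nbhs y B by exact: open_nbhs_nbhs.
apply/nbhs_nmP; exists (Num.min r1 r2); first by rewrite lt_min r10.
move=> q; rewrite lt_min => /andP[q1 q2]; split.
  by apply: H1; exact: le_lt_trans (nm_fst (q - (x, y))) q1.
by apply: H2; exact: le_lt_trans (nm_snd (q - (x, y))) q2.
Qed.

Variable theta : R.
Notation e := (cos theta +i* sin theta : K).

Lemma tube_open (eps : R) : open (tube theta eps).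
Proof.
rewrite openE => xi [t t0]; rewrite lt_nmP => h; apply/nbhs_nmP.
exists (eps - nm (xi - t%:C * e)); first by rewrite subr_gt0.
move=> y yx; exists t => //; rewrite lt_nmP; apply: le_lt_trans (nm_tri xi _ _) _.
by rewrite -ltrBrDr.
Qed.

Lemma tube_star (eps : R) (s : R) xi : 0 <= s <= 1 -> tube theta eps xi -> tube theta eps (s%:C * xi).
Proof.
move=> /andP[s0 s1] [t t0]; rewrite lt_nmP => h; exists (s * t); first exact: mulr_ge0.
rewrite lt_nmP rmorphM -mulrA -mulrBr nmM nmR ger0_norm //.
by apply: le_lt_trans h; rewrite ler_piMl // nm_ge0.
Qed.

Lemma tube_ball (eps : R) xi : nm xi < eps -> tube theta eps xi.
Proof. by move=> h; exists 0 => //; rewrite lt_nmP mul0r subr0. Qed.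
End Expansion.

(** * The formal solution and its Borel transform *)

Section FormalUnique.
Context {R : realType}.
Notation K := R[i].
Variables (N : nat) (G : nat -> 'rV[K]_N -> 'rV[K]_N) (J : 'M[K]_N).

Lemma formal_unique (a a' : nat -> 'rV[K]_N) : a 0%N = a' 0%N ->
  G 0%N (a 0%N) = 0 -> J \in unitmx ->
  (forall j, 'D_(delta_mx 0 j) (G 0%N) (a 0%N) = row j J) ->
  (forall m, subst_coef G a m = 0) -> (forall m, subst_coef G a' m = 0) ->
  forall n, a n = a' n.
Proof.
move=> a0 G0 uJ DJ Ha Ha'; elim/ltn_ind => -[//|m] IH.
apply/rowP => i.
have G0' : G 0%N (a' 0%N) = 0 by rewrite -a0.
have DJ' j : 'D_(delta_mx 0 j) (G 0%N) (a' 0%N) = row j J by rewrite -a0.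
have h := fun i => esym (subst_coef_fix (m := m.+1) i G0 uJ DJ isT).
have h' := fun i => esym (subst_coef_fix (m := m.+1) i G0' uJ DJ' isT).
move: h h'; rewrite -a0 Ha Ha' mul0mx => h h'.
set A := apoly _ _ in h h'.
have HA al i0 : (\sum_(j < N) al j <= 1)%N -> 'X %| A al i0 by exact: dvdX_apoly.
have D j : 'X^(m.+1) %| wpoly a m.+1 j - wpoly a' m.+1 j.
  apply/dvdXnP => k km; rewrite coefB !coef_poly (leq_trans km) //.
  by case: eqP => [_|_]; rewrite ?subrr // IH // subrr.
have z0 i0 : (0 : 'rV[K]_N) 0 i0 = 0 by rewrite mxE.
have := fix_unique HA (dvdX_wpoly a m.+1) (dvdX_wpoly a' m.+1) D
  (fun i => etrans (h i) (z0 i)) (fun i => etrans (h' i) (z0 i)) i.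
by rewrite !coef_poly ltnSn.
Qed.
End FormalUnique.

Section LocalSolution.
Context {R : realType}.
Notation K := R[i].
Variables (theta : R) (V : normedModType K) (N : nat) (X0 : set V) (U : set 'rV[K]_N)
  (F : nat -> V * 'rV[K]_N -> 'rV[K]_N) (phi : (V * 'rV[K]_N) * K -> 'rV[K]_N)
  (f0 : V -> 'rV[K]_N) (J : V -> 'M[K]_N) (C M eps K1 L r BJ B0 : R).
Notation T := (tube theta eps).
Notation D := (X0 `*` U).
Notation deg al := (\sum_(j < N) al j)%N.
Hypotheses (oX : open X0) (oU : open U) (r0 : 0 < r) (BJ0 : 0 <= BJ)
  (C0 : 0 < C) (M0 : 0 < M) (eps0 : 0 < eps) (K10 : 0 < K1) (L0 : 0 < L)
  (rU : forall x z, X0 x -> nm (z - f0 x) < r -> U z)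
  (hF : forall k l, holomorphic D (fun p => F k p 0 l))
  (FB : forall n p, D p -> nm (F n p) <= C * M ^+ n * n`!%:R)
  (hphi : forall l, holomorphic (D `*` T) (fun q => phi q 0 l))
  (ser : forall p, D p -> exists2 d : R, 0 < d & forall xi : K, nm xi < d ->
     tends (series (fun k => xi ^+ k *: Borel_transform (F ^~ p) k)) (phi (p, xi)))
  (phiB : forall p xi, D p -> T xi -> nm (phi (p, xi)) <= K1 * expR (L * nm xi))
  (hf0 : holomorphic X0 f0) (f0B : forall x, X0 x -> nm (f0 x) <= B0)
  (F0 : forall x, X0 x -> F 0%N (x, f0 x) = 0)
  (uJ : forall x, X0 x -> J x \in unitmx)
  (DJ : forall x, X0 x -> forall j, 'D_(delta_mx 0 j) (fun z => F 0%N (x, z)) (f0 x) = row j (J x))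
  (hIJ : forall i j, holomorphic X0 (fun x => invmx (J x) i j))
  (IJB : forall x i j, X0 x -> nm (invmx (J x) i j) <= BJ).

Notation IJ := (fun x => invmx (J x)).
Notation cof := (cof f0 IJ).
(** The radius and the constant delivered by [cof_bound]. *)
Let rho := r / (8 * N.+1%:R).
Let Kc := N%:R * 2 ^+ N * BJ.

Let rho0 : 0 < rho. Proof. by rewrite divr_gt0 // mulr_gt0. Qed.
Let Kc0 : 0 <= Kc.
Proof. by apply: mulr_ge0 => //; apply: mulr_ge0 => //; exact: exprn_ge0. Qed.
Let Uf0 x : X0 x -> U (f0 x). Proof. by move=> Xx; apply: (rU Xx); rewrite subrr nm0. Qed.

Let acoef (al : 'I_N -> nat) (i : 'I_N) : V -> K :=
  if (deg al <= 1)%N then fun=> 0 else fun x => cof al i x (fun l z => F 0%N (x, z) 0 l).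

Let bcoef (al : 'I_N -> nat) (i : 'I_N) (q : V * K) : K :=
  cof al i q.1 (fun l z => phi ((q.1, z), q.2) 0 l).

Let oD : open D. Proof. exact: open_prod. Qed.
Let oDT : open (D `*` T). Proof. by apply: open_prod => //; exact: tube_open. Qed.

Let holo_z (g : V * 'rV[K]_N -> K) x : holomorphic D g -> X0 x -> holomorphic U (fun z => g (x, z)).
Proof.
move=> hg Xx z Uz; apply: (@df_comp _ _ _ _ (fun z => (x, z)) g); last exact: hg.
by apply: differentiable_pair; [exact: differentiable_cst|exact: ex_diff].
Qed.

Let holo_phi_z l x xi : X0 x -> T xi -> holomorphic U (fun z => phi ((x, z), xi) 0 l).
Proof.
move=> Xx Tx z Uz; apply: (@df_comp _ _ _ _ (fun z => ((x, z), xi)) (fun q => phi q 0 l)); last exact: hphi.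
apply: differentiable_pair; last exact: differentiable_cst.
by apply: differentiable_pair; [exact: differentiable_cst|exact: ex_diff].
Qed.

Let acoef_holo al i : holomorphic X0 (acoef al i).
Proof.
move=> x Xx; rewrite /acoef; case: ifP => _; first exact: dfC.
apply: df_sum => l _; apply: dfM; last exact: hIJ.
apply: dfM; first exact: dfC.
apply: (mder_param_holo (D := D) (Phi := fun p => F 0%N p 0 l) (e' := fun j => (0, delta_mx 0 j))
  (io := fun x z => (x, z)) (s := f0)) => //.
- by move=> q j h z; congr pair; rewrite /= scaler0 add0r.
- by split => //=; exact: Uf0.
- by apply: differentiable_pair; [exact: ex_diff|exact: hf0].
Qed.

Let acoef_bound al i x : X0 x -> nm (acoef al i x) <= Kc * C / rho ^+ deg al.
Proof.
move=> Xx; rewrite /acoef; case: ifP => _.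
  rewrite nm0; apply: divr_ge0; first by rewrite mulr_ge0 // ltW.
  by rewrite exprn_ge0 // ltW.
apply: (@cof_bound _ _ _ X0 f0 IJ r BJ r0 IJB al i x _ C Xx) => //; first exact: ltW.
- by move=> l z zr; apply: (holo_z (hF 0 l) Xx); exact: rU zr.
- move=> l z zr; apply: le_trans (nm_coord _ _) _.
  have Dz : D (x, z) by split=> //=; exact: rU zr.
  by apply: le_trans (FB 0%N Dz) _; rewrite expr0 fact0 !mulr1.
Qed.

Let bcoef_holo al i : holomorphic (X0 `*` T) (bcoef al i).
Proof.
move=> [x xi] [/= Xx Tx]; apply: df_sum => l _; apply: dfM; last first.
  by apply: (df_fst_comp (c := fun x => invmx (J x) l i)); exact: hIJ.
apply: dfM; first exact: dfC.
apply: (mder_param_holo (D := D `*` T) (Phi := fun q => phi q 0 l) (e' := fun j => ((0, delta_mx 0 j), 0))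
  (io := fun (q : V * K) z => ((q.1, z), q.2)) (s := fun q => f0 q.1)); [exact: oDT|exact: hphi| | |].
- by move=> q j h z; congr pair; [congr pair|]; rewrite /= scaler0 add0r.
- by split => //=; split => //=; exact: Uf0.
- apply: differentiable_pair; last exact: df_snd.
  apply: differentiable_pair; first exact: df_fst.
  by apply: (@df_comp _ _ _ _ (fst : V * K -> V) f0); [exact: df_fst|exact: hf0].
Qed.

Let bcoef_bound al i x xi : X0 x -> T xi ->
  nm (bcoef al i (x, xi)) <= (Kc * K1) * expR (L * nm xi) / rho ^+ deg al.
Proof.
move=> Xx Tx; rewrite -[Kc * K1 * _]mulrA.
apply: (@cof_bound _ _ _ X0 f0 IJ r BJ r0 IJB al i x _ (K1 * expR (L * nm xi)) Xx) => //.
- by rewrite mulr_ge0 ?expR_ge0 // ltW.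
- by move=> l z zr; apply: (holo_phi_z l Xx Tx); exact: rU zr.
- move=> l z zr; apply: le_trans (nm_coord _ _) _.
  by apply: phiB => //; split=> //=; exact: rU zr.
Qed.

Let Ec x (al : 'I_N -> nat) k i : K :=
  (((\prod_j (al j)`!)%N%:R^-1 *: partial al (fun z => F k (x, z)) (f0 x)) *m invmx (J x)) 0 i.

Let EcE x al k i : X0 x -> Ec x al k i = cof al i x (fun l z => F k (x, z) 0 l).
Proof.
move=> Xx; apply: (@cofE _ _ _ X0 U f0 IJ r oU r0 rU al i x (fun z => F k (x, z)) Xx).
by move=> l; exact: holo_z (hF k l) Xx.
Qed.

Let phi_asym x z l m : X0 x -> U z ->
  asym (fun xi => phi ((x, z), xi) 0 l) (fun k => F k.+1 (x, z) 0 l / k`!%:R) m.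
Proof.
move=> Xx Uz; have Dp : D (x, z) by [].
have [d d0 Hd] := ser Dp.
(* The factor k + 1 left over from (k+1)! / k! is at most 2^k, whence the ratio 2 M. *)
have M20 : 0 < 2 * M by rewrite mulr_gt0.
apply: (series_asym (C := C * M) (M := 2 * M) (d := d)) => //.
- by rewrite mulr_ge0 // ltW.
- move=> k; rewrite nmM nmV nm_nat ler_pdivrMr ?ltr0n ?fact_gt0 //.
  apply: le_trans (nm_coord _ _) _; apply: le_trans (FB k.+1 Dp) _.
  rewrite factS natrM exprMn exprS.
  have -> : C * (M * M ^+ k) * (k.+1%:R * k`!%:R) = C * M * (k.+1%:R * M ^+ k) * k`!%:R by ring.
  apply: ler_wpM2r => //; apply: ler_wpM2l; first by rewrite mulr_ge0 // ltW.
  apply: ler_wpM2r; first by rewrite exprn_ge0 // ltW.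
  by rewrite -natrX ler_nat ltn_expl.
- move=> xi xd e e0; have [n Hn] := Hd xi xd e e0; exists n => k /Hn.
  apply: le_trans; rewrite [X in nm (X - _)](_ : _ = series (fun k => xi ^+ k *: Borel_transform (F ^~ (x, z)) k) k 0 l).
    exact: nm_coordB.
  rewrite /series /= big_mkord summxE; apply: eq_bigr => j _.
  by rewrite !mxE; ring.
Qed.

Let bcoef_asym al i x m : X0 x ->
  asym (fun xi => bcoef al i (x, xi)) (fun k => Ec x al k.+1 i / k`!%:R) m.
Proof.
move=> Xx.
have H := @cof_jet R V N X0 U f0 IJ r BJ oU r0 BJ0 rU IJB al i x
  (fun xi l z => phi ((x, z), xi) 0 l) (fun k l z => F k.+1 (x, z) 0 l)
  (fun k => k`!%:R^-1) (4 * (K1 * expR (L * eps)) / (eps / 3) ^+ m) (eps / 6) m Xx.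
apply: asym_ext (H _ _ _ _ _) => [k _| | |xi l xs|k l|xi l z xs zr].
- by rewrite -EcE.
- apply: divr_ge0; last by rewrite exprn_ge0 // divr_ge0 // ltW.
  by rewrite mulr_ge0 // mulr_ge0 ?expR_ge0 // ltW.
- by rewrite divr_gt0.
- apply: holo_phi_z => //; apply: tube_ball; apply: lt_trans xs _.
  by rewrite ltr_pdivrMr // ltr_pMr // ltr1n.
- exact: holo_z (hF k.+1 l) Xx.
- have Uz : U z by exact: rU zr.
  have d1 y : nm y < eps -> differentiable (fun xi => phi ((x, z), xi) 0 l) y.
    move=> ye; apply: (@df_comp _ _ _ _ (fun xi => ((x, z), xi)) (fun q => phi q 0 l)).
      by apply: differentiable_pair; [exact: differentiable_cst|exact: df_id].
    by apply: hphi; split=> //=; exact: tube_ball.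
  have d2 (y : K) : nm y < eps -> nm (phi ((x, z), y) 0 l) <= K1 * expR (L * eps).
    move=> ye; apply: le_trans (nm_coord _ _) _.
    apply: le_trans (phiB (p := (x, z)) _ (tube_ball theta ye)) _ => //.
    apply: ler_wpM2l; first exact: ltW.
    by rewrite ler_expR; apply: ler_wpM2l; exact: ltW.
  have := uniform_expansion eps0 d1 d2 (phi_asym l m Xx Uz) (ltW xs).
  have -> : 4 * (K1 * expR (L * eps)) * (nm xi / (eps / 3)) ^+ m =
    4 * (K1 * expR (L * eps)) / (eps / 3) ^+ m * nm xi ^+ m by rewrite expr_div_n; ring.
  by under eq_bigr do rewrite -mulrA.
Qed.

Let jet_coef al i x m : X0 x ->
  jetE x (acoef al i, bcoef al i) (apoly (Ec x) m al i) m.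
Proof.
move=> Xx; split.
  rewrite coef_poly /acoef /= andbT; case: ifP => // _.
  by rewrite EcE.
apply: asym_ext (bcoef_asym al i m Xx) => k km.
by rewrite coef_poly ltnS km andbF.
Qed.

(** [S] is bounded by [d1] so that the unit parts contribute at most S / 2 to the left-hand side;
    [lam] is then taken inversely proportional to [S], so that the function parts contribute at most
    S / 2 as well. *)
Let constants : exists S lam : R, [/\ 0 < S, 0 < lam, 2 * S <= rho &
  2 ^+ N * (16 * (Kc * K1) / lam + 4 * (Kc * C) * (S / rho) ^+ 2) <= S].
Proof.
set M1 := Kc * K1; set Ca := Kc * C.
have M10 : 0 <= M1 by rewrite mulr_ge0 // ltW.
have Ca0 : 0 <= Ca by rewrite mulr_ge0 // ltW.
have P0 : 0 < 2 ^+ N :> R by rewrite exprn_gt0.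
have Ca1 : 0 < Ca + 1 by rewrite ltr_wpDl.
have M11 : 0 < M1 + 1 by rewrite ltr_wpDl.
pose d1 := rho ^+ 2 / (8 * 2 ^+ N * (Ca + 1)).
have d10 : 0 < d1 by rewrite divr_gt0 ?exprn_gt0 // mulr_gt0 // mulr_gt0.
pose S := Num.min (rho / 2) d1.
have S0 : 0 < S by rewrite lt_min d10 andbT divr_gt0.
have [S1 S2] : S <= rho / 2 /\ S <= d1 by have := lexx S; rewrite {2}/S le_min => /andP[].
pose lam := 2 ^+ N * 32 * (M1 + 1) / S.
have lam0 : 0 < lam by rewrite divr_gt0 // mulr_gt0 // mulr_gt0.
exists S, lam; split=> //; first by move: S1; lra.
have e1 : 2 ^+ N * (16 * M1 / lam) = S / 2 * (M1 / (M1 + 1)).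
  by rewrite /lam; field; rewrite !gt_eqF.
have e2 : 2 ^+ N * (4 * Ca * (S / rho) ^+ 2) = S * (2 ^+ N * 4 * Ca / rho ^+ 2 * S).
  by field; rewrite !gt_eqF.
have h1 : S / 2 * (M1 / (M1 + 1)) <= S / 2.
  apply: ler_piMr; first by rewrite divr_ge0 // ltW.
  by rewrite ler_pdivrMr // mul1r lerDl.
have h2 : 2 ^+ N * 4 * Ca / rho ^+ 2 * S <= 2^-1.
  apply: (@le_trans _ _ (2 ^+ N * 4 * Ca / rho ^+ 2 * d1)).
    apply: ler_wpM2l => //; apply: divr_ge0; last exact: sqr_ge0.
    by apply: mulr_ge0 => //; apply: mulr_ge0 => //; exact: ltW.
  have -> : 2 ^+ N * 4 * Ca / rho ^+ 2 * d1 = 2^-1 * (Ca / (Ca + 1)).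
    by rewrite /d1; field; rewrite !gt_eqF.
  apply: ler_piMr; first by rewrite invr_ge0.
  by rewrite ler_pdivrMr // mul1r lerDl.
rewrite mulrDr e1 e2; have h3 := ler_wpM2l (ltW S0) h2.
by move: h1 h3; lra.
Qed.

Lemma local_solution : exists f : nat -> V -> 'rV[K]_N,
  [/\ f 0%N = f0, forall n, holomorphic X0 (f n),
     forall x, X0 x -> forall m, subst_coef (fun k z => F k (x, z)) (f ^~ x) m = 0 &
     Borel_summable_uniformly theta X0 f].
Proof.
have [S [lam [S0 lam0 Srho HS]]] := constants.
have oT : open T by exact: tube_open.
have star (s : R) xi : 0 <= s <= 1 -> T xi -> T (s%:C * xi) by exact: tube_star.
have T0 : T 0 by apply: tube_ball; rewrite nm0.
have Ca0 : 0 <= Kc * C by rewrite mulr_ge0 // ltW.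
have M10 : 0 <= Kc * K1 by rewrite mulr_ge0 // ltW.
have delta0 : 0 <= 16 * (Kc * K1) / lam.
  by apply: divr_ge0; [exact: mulr_ge0|exact: ltW].
have a1 al i : (deg al <= 1)%N -> acoef al i = fun=> 0 by rewrite /acoef => ->.
have hb al i : wadm L lam X0 T (bcoef al i) (16 * (Kc * K1) / lam / rho ^+ deg al).
  split; first exact: bcoef_holo.
  move=> x xi Xx Tx; apply: le_trans (bcoef_bound al i Xx Tx) _.
  rewrite [leRHS]mulrAC; apply: ler_wpM2r; first by rewrite invr_ge0 exprn_ge0 // ltW.
  apply: exp_le_wt => //; exact: nm_ge0.
have [psi [ep [ep0 [eps_ Hpsi]]]] := pic_limit L0 lam0 oX oT star Ca0 rho0 delta0 S0
  acoef_holo acoef_bound a1 hb Srho HS.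
have wpsi i : wadm L lam X0 T (psi i) S by have [] := Hpsi i.
pose sl i x := fun xi : K => psi i (x, xi).
(* The derivative on the product space gives holomorphy in x; the derivative of the slice gives the
   Taylor coefficient in xi. *)
have nE i x n : nderive ((0, 1) : V * K) n (psi i) (x, 0) = nderive (1 : K) n (sl i x) 0.
  rewrite /sl (nderive_affine (io := fun xi : K => (x, xi)) (v := (0, 1))) // => h z.
  by congr pair; rewrite /= scaler0 add0r.
(* The Borel transform has coefficients f_(k+1) / k!, so f_(k+1) must be the k-th derivative at xi =
   0. *)
pose f n : V -> 'rV[K]_N := if n is k.+1 then fun x => \row_i nderive ((0, 1) : V * K) k (psi i) (x, 0) else f0.
have fS k x i : f k.+1 x 0 i = nderive (1 : K) k (sl i x) 0 by rewrite mxE nE.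
have sd i x y : X0 x -> nm y < eps -> differentiable (sl i x) y.
  by move=> Xx ye; apply: slice_diff (wpsi i).1 Xx (tube_ball theta ye).
pose W := S * (lam / 4 * expR ((L + lam) * eps)).
have lam4 : 0 <= lam / 4 by rewrite divr_ge0 // ltW.
have W0 : 0 <= W by apply: mulr_ge0; [exact: ltW|apply: mulr_ge0 => //; exact: expR_ge0].
have Sexp i x xi : X0 x -> T xi -> nm (psi i (x, xi)) <= S * (lam / 4) * expR ((L + lam) * nm xi).
  move=> Xx Tx; apply: le_trans ((wpsi i).2 x xi Xx Tx) _.
  rewrite -mulrA; apply: ler_wpM2l; first exact: ltW.
  exact: (wt_le_exp L lam0 (nm_ge0 _)).
have sb i x y : X0 x -> nm y < eps -> nm (sl i x y) <= W.
  move=> Xx ye; apply: le_trans (Sexp i x y Xx (tube_ball theta ye)) _.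
  rewrite -mulrA; apply: ler_wpM2l; first exact: ltW.
  apply: ler_wpM2l => //; rewrite ler_expR; apply: ler_wpM2l; last exact: ltW.
  by rewrite ltW // addr_gt0.
exists f; split=> //.
- case=> [|n]; first exact: hf0.
  move=> x Xx; apply: differentiable_rV => i.
  have -> : (fun x => f n.+1 x 0 i) = fun x => nderive ((0, 1) : V * K) n (psi i) (x, 0).
    by apply/funext => y; rewrite mxE.
  apply: (@df_comp _ _ _ _ (fun x => (x, 0)) (nderive ((0, 1) : V * K) n (psi i))).
    by apply: differentiable_pair; [exact: ex_diff|exact: differentiable_cst].
  have oXT : open (X0 `*` T) by exact: open_prod.
  have DX : (X0 `*` T) (x, 0) by split.
  exact: (@nderive_holo _ _ (X0 `*` T) ((0, 1) : V * K) n (psi i) oXT (wpsi i).1 (x, 0) DX).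
- move=> x Xx [|m]; first by rewrite subst_coef0 /= F0.
  set G := fun k z => F k (x, z).
  have G0 : G 0%N (f 0%N x) = 0 by exact: F0.
  suff Z : subst_coef G (f ^~ x) m.+1 *m invmx (J x) = 0.
    by rewrite -[LHS](mulmxKV (uJ Xx)) Z mul0mx.
  apply/rowP => i; rewrite [RHS]mxE (subst_coef_fix i G0 (uJ Xx) (DJ Xx)) //.
  set A := apoly _ _.
  have HA al i0 : (deg al <= 1)%N -> 'X %| A al i0 by exact: dvdX_apoly.
  have jA al i0 : jetE x (acoef al i0, bcoef al i0) (A al i0) m.+1 by exact: jet_coef.
  (* From step m + 1 on, the iterates carry the right coefficients up to order m + 1, so two
     consecutive ones can be fed to [fpic_fix]. *)
  have D n j : (m.+1 <= n)%N -> 'X^(m.+2) %| wpoly (f ^~ x) m.+1 j - fpic A n j.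
    move=> mn; apply/dvdXnP => -[|k] km; rewrite coefB coef_poly km /=.
      have /dvdXnP : 'X^1 %| fpic A n j by rewrite expr1; exact: dvdX_fpic.
      by move=> ->; rewrite ?subrr.
    rewrite fS; have [_ Hj] := Hpsi j.
    have := phi_jet L0 lam0 oX oT star Xx T0 Ca0 rho0 delta0 S0
      acoef_holo acoef_bound a1 hb Srho HS HA jA (wpsi j) ep0 eps_ (fun n z => Hj n x z Xx) mn.
    by move=> /(_ k km) ->; rewrite subrr.
  have /dvdXnP -> // := fpic_fix HA (fun j => D m.+1 j (leqnn _)) (fun j => D m.+2 j (leqnSn _)) i.
pose s := eps / 3; have s0 : 0 < s by rewrite divr_gt0.
(* Cauchy's estimate gives |f_(n+1)| <= 2 W n! s^-n. Adding 1 to s^-1 makes M1 >= 1, which absorbs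
   the shift from n to n + 1; the absolute value of B0 makes the sum visibly positive. *)
pose C1 := `|B0| + 2 * W + 1; pose M1 := s^-1 + 1.
have C10 : 0 < C1 by rewrite ltr_wpDl // addr_ge0 // mulr_ge0.
have M11 : 1 <= M1 by rewrite lerDr invr_ge0 ltW.
have M10' : 0 < M1 by exact: lt_le_trans M11.
exists C1, M1, eps, (S * (lam / 4)), (L + lam); split.
- split=> //; last by rewrite addr_gt0.
  by rewrite mulr_gt0 // divr_gt0.
- case=> [|n] x Xx; rewrite le_nmP.
    rewrite expr0 fact0 !mulr1; apply: le_trans (f0B Xx) _; apply: le_trans (ler_norm _) _.
    by rewrite /C1 -addrA lerDl addr_ge0 // mulr_ge0.
  have R0 : 0 <= C1 * M1 ^+ n.+1 * n.+1`!%:R.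
    by apply: mulr_ge0 => //; apply: mulr_ge0; [exact: ltW|rewrite exprn_ge0 // ltW].
  apply: nm_rV_le => // i; rewrite fS.
  have [h _] := asym_nderive 0 eps0 (fun y => @sd i x y Xx) (fun y => @sb i x y Xx).
  apply: le_trans (h n) _; rewrite mulrC; apply: ler_pM => //.
  + by apply: divr_ge0; [exact: mulr_ge0|apply: exprn_ge0; exact: ltW].
  + apply: ler_pM.
    * exact: mulr_ge0.
    * by rewrite invr_ge0; apply: exprn_ge0; exact: ltW.
    * by rewrite /C1 addrAC lerDr addr_ge0.
    * apply: (@le_trans _ _ (M1 ^+ n)); last by rewrite ler_weXn2l.
      by rewrite -exprVn lerXn2r ?nnegrE ?invr_ge0 ?(ltW s0) ?(ltW M10') // lerDl.
  + by rewrite ler_nat factS leq_pmull.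
exists (fun q => \row_i psi i q); split.
- move=> q Dq; apply: differentiable_rV => i.
  have -> : (fun q => (\row_i0 psi i0 q : 'rV[K]_N) 0 i) = psi i by apply/funext => y; rewrite mxE.
  exact: (wpsi i).1.
(* For |xi| < eps / 6 the ratio |xi| / (eps / 3) is below 1 / 2, so the Taylor remainder is at most
   4 W 2^-n. *)
- move=> x Xx; apply/nbhs_nmP; exists (eps / 6); first by rewrite divr_gt0.
  move=> xi; rewrite subr0 => xe; apply: tends_cvg => e e0.
  have [n0 Hn0] := pow2_small (4 * W) e0; exists n0 => n /Hn0 h.
  apply: nm_rVB_le => [|i]; first exact: ltW.
  apply: le_trans h; rewrite nmB mxE.
  have -> : series (fun k => xi ^+ k *: Borel_transform (f ^~ x) k) n 0 i =
     \sum_(k < n) (k`!%:R^-1 * nderive (1 : K) k (sl i x) 0) * xi ^+ k.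
    rewrite /series /= big_mkord summxE; apply: eq_bigr => k _.
    by rewrite mxE mxE fS; ring.
  have [_ ha] := asym_nderive n eps0 (fun y => @sd i x y Xx) (fun y => @sb i x y Xx).
  have := uniform_expansion eps0 (fun y => @sd i x y Xx) (fun y => @sb i x y Xx) ha (ltW xe).
  move=> /le_trans; apply; apply: ler_wpM2l; first exact: mulr_ge0.
  rewrite -exprVn lerXn2r ?nnegrE ?invr_ge0 //.
    by rewrite divr_ge0 ?nm_ge0 // divr_ge0 // ltW.
  by rewrite ler_pdivrMr ?divr_gt0 //; move: xe; lra.
- move=> x xi Xx Tx; rewrite le_nmP; apply: nm_rV_le => [|i].
    by apply: mulr_ge0; [apply: mulr_ge0 => //; exact: ltW|exact: expR_ge0].
  by rewrite mxE; exact: Sexp.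
Qed.
End LocalSolution.

(** * The Jacobian in terms of partial derivatives, and the conclusion on a ball *)

Lemma partial_coord (R : realType) (V : normedModType R[i]) (N : nat)
  (F : V * 'rV[R[i]]_N -> 'rV[R[i]]_N) (D : set (V * 'rV[R[i]]_N)) (x : V) (z : 'rV[R[i]]_N) j i :
  holomorphic D F -> D (x, z) ->
  ('D_(delta_mx 0 j) (fun z => F (x, z)) z) 0 i = 'D_(0, delta_mx 0 j) (fun p => F p 0 i) (x, z).
Proof.
move=> hF Dz; have dF : differentiable (fun z => F (x, z)) z.
  apply: (differentiable_comp (f := fun z : 'rV[R[i]]_N => (x, z)) (g := F)); last exact: hF.
  by apply: differentiable_pair; [exact: differentiable_cst|exact: ex_diff].
apply: etrans (esym (derive_coord (delta_mx 0 j) i dF)) _.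
apply: (@derive_affine _ _ _ _ (fun z : 'rV[R[i]]_N => (x, z)) (delta_mx 0 j) (0, delta_mx 0 j) (fun p => F p 0 i)) => h.
by congr pair; rewrite /= scaler0 add0r.
Qed.

Lemma jacobian_row (R : realType) (N : nat) (f : 'rV[R[i]]_N -> 'rV[R[i]]_N) z j : differentiable f z ->
  row j (jacobian f z) = 'D_(delta_mx 0 j) f z.
Proof.
move=> df; rewrite -(diff_deriveE _ df) /jacobian rowE.
by rewrite mul_rV_lin1.
Qed.

Theorem corollary1p4 (R : realType) (d N : nat) (hN : (1 <= N)%N)
  (x0 : 'rV[R[i]]_d) (z0 : 'rV[R[i]]_N) (X : set 'rV[R[i]]_d) (theta : R)
  (F : nat -> 'rV[R[i]]_d * 'rV[R[i]]_N -> 'rV[R[i]]_N)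
  (hX : domain X) (hx0 : X x0)
  (hF : forall k, holomorphic (X `*` setT) (F k))
  (hF0 : F 0%N (x0, z0) = 0)
  (hJ : jacobian (fun z => F 0%N (x0, z)) z0 \in unitmx)
  (hB : forall z1 : 'rV[R[i]]_N, exists U : set 'rV[R[i]]_N,
     open_nbhs z1 U /\ Borel_summable_uniformly theta (X `*` U) F) :
  exists X0 : set 'rV[R[i]]_d,
    [/\ domain X0, X0 x0, X0 `<=` X &
    exists f : nat -> 'rV[R[i]]_d -> 'rV[R[i]]_N,
      [/\ formal_solution x0 z0 F X0 f,
          forall g, formal_solution x0 z0 F X0 g ->
            forall n x, X0 x -> g n x = f n x &
          Borel_summable_uniformly theta X0 f]].
Proof.
have [oX _ _] := hX.
have [U [[oU Uz0] [C [M [eps [K1 [L [[C0 M0 eps0 K10 L0] FB [phi [hphi ser phiB]]]]]]]]]] := hB z0.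
have oXU : open (X `*` U) by exact: open_prod.
have hFU k : holomorphic (X `*` U) (F k) by move=> p [Xp _]; apply: hF; split.
have hFi k i : holomorphic (X `*` U) (fun p => F k p 0 i).
  by move=> p Dp; apply: df_entry; exact: hFU.
pose J (f : 'rV[R[i]]_d -> 'rV[R[i]]_N) x : 'M[R[i]]_N :=
  \matrix_(j, i) 'D_(0, delta_mx 0 j) (fun p => F 0%N p 0 i) (x, f x).
have rowJ f x j : (X `*` U) (x, f x) -> 'D_(delta_mx 0 j) (fun z => F 0%N (x, z)) (f x) = row j (J f x).
  by move=> Dx; apply/rowP => i; rewrite !mxE; exact: (partial_coord _ _ (hFU 0%N)).
have D0 : (X `*` U) (x0, z0) by [].
have dF0 : differentiable (fun z => F 0%N (x0, z)) z0.
  apply: (differentiable_comp (f := fun z : 'rV[R[i]]_N => (x0, z)) (g := F 0%N)); last exact: hFU.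
  by apply: differentiable_pair; [exact: differentiable_cst|exact: ex_diff].
set J0 := jacobian _ _ in hJ.
have J0E j i : J0 j i = 'D_(0, delta_mx 0 j) (fun p => F 0%N p 0 i) (x0, z0).
  rewrite -(partial_coord _ _ (hFU 0%N)) // -(jacobian_row _ dF0) !mxE; by [].
have /nbhs_nmP[ru ru0 Hu] : nbhs z0 U by exact: open_nbhs_nbhs.
have /nbhs_nmP[rx rx0 Hx] : nbhs x0 X by exact: open_nbhs_nbhs.
have G0 i : F 0%N (x0, z0) 0 i = 0 by rewrite hF0 mxE.
(* Both radii of the implicit function are kept below this minimum, so that its graph stays in the
   product of [X] and [U]. *)
have rm0 : 0 < Num.min ru rx by rewrite lt_min ru0.
have [rho [r1 [[rho0 rhole r10 r1le] [f Hf]]]] :=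
  implicit_function oXU D0 (hFi 0%N) G0 hJ J0E rm0.
have rhou : rho <= ru by apply: le_trans rhole _; rewrite ge_min lexx.
have r1x : r1 <= rx by apply: le_trans r1le _; rewrite ge_min lexx orbT.
have half : rho / 2 < rho by exact: half_lt.
have x0r : nm (x0 - x0) < r1 by rewrite subrr nm0.
have fx0 : f x0 = z0.
  by have [_ _ _ u] := Hf x0 x0r; apply/esym/u => //; rewrite subrr nm0.
have inD x : nm (x - x0) < r1 -> (X `*` U) (x, f x).
  move=> xr; have [_ fz _ _] := Hf x xr; split=> /=.
    by apply: Hx; exact: lt_le_trans r1x.
  by apply: Hu; apply: le_lt_trans fz _; exact: lt_le_trans rhou.
have hJf j i : holomorphic [set x | nm (x - x0) < r1] (fun x => J f x j i).
  move=> x xr; have [df _ _ _] := Hf x xr.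
  have -> : (fun x => J f x j i) = fun x => 'D_(0, delta_mx 0 j) (fun p => F 0%N p 0 i) (x, f x).
    by apply/funext => y; rewrite mxE.
  apply: (@df_comp _ _ _ _ (fun x => (x, f x)) (fun p => 'D_(0, delta_mx 0 j) (fun p => F 0%N p 0 i) p)).
    by apply: differentiable_pair; [exact: ex_diff|exact: df].
  by apply: (holo_derive _ oXU (hFi 0%N i)); exact: inD.
have uJ0 : J f x0 \in unitmx.
  suff -> : J f x0 = J0 by [].
  by apply/matrixP => j i; rewrite J0E mxE fx0.
have [r2 [BJ [r20 BJ0 H2]]] := invmx_near (@open_ball_nm _ _ x0 r1) x0r hJf uJ0.
(* On this ball the inverse Jacobian has the uniform bound [BJ], and a ball is connected, as the
   uniqueness argument requires. *)
pose X0 := [set x | nm (x - x0) < r2].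
have oX0 : open X0 by exact: open_ball_nm.
have X0r1 x : X0 x -> nm (x - x0) < r1 by move=> /H2[].
have X0x0 : X0 x0 by rewrite /X0 /= subrr nm0.
have X0X : X0 `<=` X by move=> x /X0r1/inD[].
have sub p : (X0 `*` U) p -> (X `*` U) p by move=> [/X0X].
have F0 x : X0 x -> F 0%N (x, f x) = 0.
  by move=> /X0r1/Hf[_ _ fG _]; apply/rowP => i; rewrite fG mxE.
have uJ x : X0 x -> J f x \in unitmx by move=> /H2[].
have DJ x : X0 x -> forall j, 'D_(delta_mx 0 j) (fun z => F 0%N (x, z)) (f x) = row j (J f x).
  by move=> Xx j; apply: rowJ; apply: inD; exact: X0r1.
have [s [s0 hs subs Bs]] : exists s : nat -> 'rV[R[i]]_d -> 'rV[R[i]]_N,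
  [/\ s 0%N = f, forall n, holomorphic X0 (s n),
     forall x, X0 x -> forall m, subst_coef (fun k z => F k (x, z)) (s ^~ x) m = 0 &
     Borel_summable_uniformly theta X0 s].
  (* Points within rho / 2 of f x, itself within rho / 2 of z0, stay in [U]; hence the radius rho /
     2 for the Cauchy estimates in z. *)
  apply: (@local_solution R theta _ N X0 U F phi f (J f) C M eps K1 L (rho / 2) BJ (nm z0 + rho)) => //.
  - by rewrite divr_gt0.
  - move=> x z Xx zf; have [_ fz _ _] := Hf x (X0r1 x Xx); apply: Hu; apply: lt_le_trans rhou.
    by apply: le_lt_trans (nm_tri (f x) _ _) _; exact: lt_halfD zf fz.
  - by move=> k l p /sub; exact: hFi.
  - by move=> n p /sub Dp; rewrite -le_nmP; exact: FB.
  - move=> l [p xi] [/sub Dp Tx]; apply: df_entry; exact: hphi.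
  - move=> p /sub Dp; have /nbhs_nmP[e e0 He] := ser p Dp; exists e => // xi xe.
    by apply: cvg_tends; apply: He; rewrite subr0.
  - by move=> p xi /sub Dp Tx; rewrite -le_nmP; exact: phiB.
  - by move=> x /X0r1/Hf[].
  - move=> x /X0r1/Hf[_ fz _ _]; rewrite -[f x](subrK z0) addrC; apply: le_trans (nmD _ _) _.
    by rewrite lerD2l; apply: le_trans fz (ltW half).
  - by move=> i j x /H2[_ _ /(_ i j)[]].
  - by move=> x i j /H2[_ _ /(_ i j)[]].
exists X0; split=> //.
  by split=> //; [exact: ball_connected|exists x0].
exists s; split=> //; first by split=> //; rewrite s0.
(* A priori g_0 is prescribed only at x0. The gap between rho / 2 and rho forces g_0 = f on all of
   X0, after which [formal_unique] settles the higher coefficients at each x separately. *)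
move=> g [hg g0 sg] n x Xx.
have Fg y : X0 y -> F 0%N (y, g 0%N y) = 0 by move=> Xy; rewrite -[RHS](sg y Xy 0%N) subst_coef0.
have gz y : X0 y -> nm (g 0%N y - z0) < rho -> g 0%N y = f y.
  move=> Xy gy; have [_ _ _ u] := Hf y (X0r1 y Xy); apply: u => // i.
  by rewrite Fg // mxE.
have cX0 : connected X0 by exact: ball_connected.
have cg y : X0 y -> {for y, continuous (g 0%N)}.
  by move=> Xy; apply: differentiable_continuous; exact: hg.
have g0rho : nm (g 0%N x0 - z0) < rho by rewrite g0 subrr nm0.
have gap y : X0 y -> nm (g 0%N y - z0) < rho -> nm (g 0%N y - z0) <= rho / 2.
  by move=> Xy gy; rewrite (gz y Xy gy); have [] := Hf y (X0r1 y Xy).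
have gall := connected_gap cX0 oX0 X0x0 cg half g0rho gap.
have gf : g 0%N x = f x by exact: gz (gall x Xx).
apply: (@formal_unique R N (fun k z => F k (x, z)) (J f x) (g ^~ x) (s ^~ x)).
- by rewrite gf s0.
- exact: Fg.
- exact: uJ.
- by move=> j; rewrite gf; exact: DJ.
- exact: sg.
- exact: subs.
Qed.
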